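(* Let $B$ be an elliptic or doubly parabolic finite Blaschke product of degree $d\ge2$. Let $\lambda_i$, $i\ge 0$, be positive real numbers with $\lambda_0>\lambda_1>\dots$ and $\lim_{n\to\infty}\lambda_n=0$. Then there is $w\in\mathbb{A}$ such that the operator $T:\mathbb{A}\to\mathbb{A}$, $(Tf)(z)=w(z)f(B(z))$, $f\in\mathbb{A}$, $z\in\mathbb{D}$, satisfies $$\sigma_{usf}(T)=\{0\}\cup\bigcup_{i\ge0}\lambda_i\mathbb{T}.$$
   Context: $\mathbb{U}$ is the open unit disc, $\mathbb{D}$ the closed unit disc, $\mathbb{T}=\partial\mathbb{D}$; $\lambda\mathbb{T}=\{\lambda t:t\in\mathbb{T}\}$. The disc algebra $\mathbb{A}$ consists of functions analytic in $\mathbb{U}$ and continuous on $\mathbb{D}$, with the sup norm. A finite Blaschke product of degree $d$ is $B(z)=e^{i\theta}\prod_{j=1}^d \frac{z-a_j}{1-\overline{a_j}z}$, $|a_j|<1$. Its Wolff–Denjoy point $z_0\in\mathbb{D}$ is the unique point such that the iterates of $B$ converge to $z_0$ uniformly on compact subsets of $\mathbb{U}$; $B$ is elliptic if $z_0\in\mathbb{U}$, and doubly parabolic if $z_0\in\mathbb{T}$, $|B'(z_0)|=1$ and $z_0$ is a fixed point of multiplicity 2. For a bounded operator $T$ on a Banach space $X$, $\sigma_{usf}(T)$ is the set of $\lambda$ for which there exist $x_n\in X$, $\|x_n\|=1$, with $Tx_n-\lambda x_n\to0$ and $(x_n)$ having no norm-convergent subsequence. *)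

(* Defs.v *)
From Stdlib Require Import Reals List.
From Coquelicot Require Import Coquelicot.
Open Scope R_scope.

Definition closed_disc (z : C) : Prop := Cmod z <= 1.

(* The disc algebra A: functions analytic (complex differentiable) on the
   open unit disc and continuous on the closed unit disc.  Values outside
   the closed disc are irrelevant. *)
Definition in_disc_algebra (f : C -> C) : Prop :=
  (forall z : C, Cmod z < 1 -> ex_derive f z) /\
  (forall z : C, Cmod z <= 1 ->
     filterlim f (within closed_disc (locally z)) (locally (f z))).

Definition supnorm (f : C -> C) : R :=
  real (Lub_Rbar (fun r => exists z : C, Cmod z <= 1 /\ r = Cmod (f z))).

Definition blaschke (theta : R) (a : list C) (z : C) : C :=
  Cmult (cos theta, sin theta)
    (fold_right (fun aj acc =>
        Cmult (Cdiv (Cminus z aj) (Cminus (RtoC 1) (Cmult (Cconj aj) z))) acc)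
      (RtoC 1) a).

(* z0 is the Wolff-Denjoy point of B: z0 in D and the iterates B^n converge
   to z0 uniformly on compact subsets of the open disc (equivalently, on
   every closed disc {|z| <= r}, r < 1). *)
Definition wolff_denjoy_point (B : C -> C) (z0 : C) : Prop :=
  Cmod z0 <= 1 /\
  forall r : R, 0 <= r < 1 ->
  forall eps : R, 0 < eps ->
  exists N : nat, forall n : nat, (N <= n)%nat ->
  forall z : C, Cmod z <= r -> Cmod (Cminus (Nat.iter n B z) z0) < eps.

Definition elliptic (B : C -> C) : Prop :=
  exists z0 : C, wolff_denjoy_point B z0 /\ Cmod z0 < 1.

(* z0 is a fixed point of B of multiplicity 2, i.e. z0 is a zero of order
   exactly 2 of B(z) - z:  B z0 = z0, B'(z0) = 1, B''(z0) <> 0. *)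
Definition fixed_point_mult2 (B : C -> C) (z0 : C) : Prop :=
  B z0 = z0 /\ C_derive B z0 = RtoC 1 /\ C_derive (C_derive B) z0 <> RtoC 0.

Definition doubly_parabolic (B : C -> C) : Prop :=
  exists z0 : C, wolff_denjoy_point B z0 /\ Cmod z0 = 1 /\
    Cmod (C_derive B z0) = 1 /\ fixed_point_mult2 B z0.

Definition wco (w B : C -> C) (f : C -> C) : C -> C :=
  fun z => Cmult (w z) (f (B z)).

Definition in_sigma_usf (T : (C -> C) -> (C -> C)) (mu : C) : Prop :=
  exists x : nat -> C -> C,
    (forall n, in_disc_algebra (x n)) /\
    (forall n, supnorm (x n) = 1) /\
    is_lim_seq (fun n => supnorm (fun z => Cminus (T (x n) z) (Cmult mu (x n z)))) 0 /\
    ~ (exists (phi : nat -> nat) (g : C -> C),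
         (forall n, (phi n < phi (S n))%nat) /\ in_disc_algebra g /\
         is_lim_seq (fun n => supnorm (fun z => Cminus (x (phi n) z) (g z))) 0).

(* Main.v *)
Require Import Defs.
From Stdlib Require Import ZArith Reals List Lra Lia Psatz Classical ClassicalEpsilon Cantor FinFun.
From Coquelicot Require Import Coquelicot.
Open Scope R_scope.

(** On the circle, [B] lifts to an increasing homeomorphism [F] of the line with
    [F (x + tau) = F x + d tau], normalised so that [F 0 = 0] and [F x > x] for [x > 0].
    For each [i] there is a point [x_i] with [F^(i+2) x_i = x_i + tau], hence an orbit
    [O_i] of period [i + 2]; these orbits are pairwise disjoint and accumulate only on
    the set [L] consisting of the fixed point and an orbit homoclinic to it.  Let [E] be
    the closed countable set formed by [L] and all [O_i].

    A weight [w] in the disc algebra is constructed with [|w| = lam_i] on [O_i], [w = 0]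
    on the other points of [B^-1 E], [w <> 0] on the rest of the circle, and
    [|w| <= lam_0].  It has the form [lam_0 / (1 + R)], with [R] a series of rational
    functions of nonnegative real part.

    If [|mu|] is neither [0] nor one of the [lam_i], then every point [t] of the circle
    has some [m] with [|w_m(t)| < |mu|^m], or [|w_m(u)| > |mu|^m] for some [u] with
    [B^m u = t], where [w_m(z) = w(z) w(B z) ... w(B^(m-1) z)]: off [E] this holds because
    every point has backward orbits converging to [O_0] along which [w] does not vanish.
    By the maximum principle and compactness [T - mu] is then bounded below.

    If [|mu| = lam_i], choose a nonperiodic [v] close to [O_i]; tapered sums of
    [mu^-j T^j (g^K)], with [g] peaking at [v] and [K] large, are approximate eigenvectors
    which tend to [0] inside the disc. *)

Implicit Types (f g : C -> C) (z : C).

(** * Continuity and complex differentiability *)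

(** Two demands force the zeros of [w]. The orbits [O_i] must accumulate somewhere on the circle,
    and since [lam_i] tends to [0], a continuous [w] has to vanish there. Moreover, for
    [|mu| = lam_i], the tapered sums are under control only if every chain of preimages of a point
    near [O_i] carries a product of weights comparable to [lam_i^j]; so a preimage that is not near
    [O_i] has to lie near a zero. These zeros do no harm off [E]: since [E] is forward invariant, a
    backward orbit of a point off [E] stays off [B^-1 E]. The accumulation is kept countable by the
    order of the line. Since [F x > x] to the right of the fixed point, the backward orbit of [tau]
    cuts [(0, tau)] into fundamental intervals, and [O_i] has at most one point in each of them.
    Countability allows the moduli to be prescribed one point at a time, every new term vanishing at
    the points already treated. The maximum principle is obtained from Goursat's lemma in the
    logarithmic coordinate, where circles become vertical segments and the centre is pushed to
    infinity. *)

Definition cont_within (D : C -> Prop) (f : C -> C) (z : C) : Prop :=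
  forall eps, 0 < eps -> exists del, 0 < del /\
    forall y, D y -> Cmod (y - z) < del -> Cmod (f y - f z) < eps.

Definition everywhere (z : C) : Prop := True.

(* Caratheodory's form of differentiability: the slope extends continuously. *)
Definition cdiff (f : C -> C) (z : C) : Prop :=
  exists s, cont_within everywhere s z /\
    forall y, (f y - f z = (y - z) * s y)%C.

Definition disc_alg (f : C -> C) : Prop :=
  (forall z, Cmod z < 1 -> cdiff f z) /\
  (forall z, Cmod z <= 1 -> cont_within closed_disc f z).

Lemma Cmod_sub_sym (a b : C) : Cmod (a - b) = Cmod (b - a).
Proof. rewrite <- Cmod_opp. f_equal. ring. Qed.

Lemma Cmod_sub_triangle (a b c : C) :
  Cmod (a - c) <= Cmod (a - b) + Cmod (b - c).
Proof.
  replace (a - c)%C with ((a - b) + (b - c))%C by ring. apply Cmod_triangle.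
Qed.

Lemma Cmod_sub_self (a : C) : Cmod (a - a) = 0.
Proof. replace (a - a)%C with (RtoC 0) by ring. apply Cmod_0. Qed.

Lemma Cmod_le_sub (a b : C) : Cmod a <= Cmod b + Cmod (a - b).
Proof.
  replace a with (b + (a - b))%C at 1 by ring. apply Cmod_triangle.
Qed.

Lemma Cmod_sub_le (a b : C) : Cmod (a - b) <= Cmod a + Cmod b.
Proof. unfold Cminus. rewrite <- (Cmod_opp b). apply Cmod_triangle. Qed.

Lemma Csub_eq_0 (a b : C) : Cmod (a - b) = 0 -> a = b.
Proof.
  intros H. apply Cmod_eq_0 in H.
  replace a with ((a - b) + b)%C by ring. rewrite H. ring.
Qed.

Lemma Csub_pos (a b : C) : a <> b -> 0 < Cmod (a - b).
Proof.
  intros H. destruct (Cmod_ge_0 (a - b)) as [h|h]; auto.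
  elim H. apply Csub_eq_0; auto.
Qed.

Lemma Csub_neq0 (a b : C) : a <> b -> (a - b)%C <> 0.
Proof.
  intros H h. apply H. replace a with ((a - b) + b)%C by ring. rewrite h. ring.
Qed.

Section ContWithin.
Variable D : C -> Prop.

Lemma cont_const c z : cont_within D (fun _ => c) z.
Proof. intros e He. exists 1. split; [lra|]. intros. rewrite Cmod_sub_self; auto. Qed.

Lemma cont_id z : cont_within D (fun y => y) z.
Proof. intros e He. exists e. split; auto. Qed.

Lemma cont_plus f g z :
  cont_within D f z -> cont_within D g z ->
  cont_within D (fun y => f y + g y)%C z.
Proof.
  intros Hf Hg e He.
  destruct (Hf (e/2)) as (d1 & H1 & K1); [lra|].
  destruct (Hg (e/2)) as (d2 & H2 & K2); [lra|].
  exists (Rmin d1 d2). split; [now apply Rmin_glb_lt|].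
  intros y Dy Hy.
  assert (A1 := K1 y Dy (Rlt_le_trans _ _ _ Hy (Rmin_l _ _))).
  assert (A2 := K2 y Dy (Rlt_le_trans _ _ _ Hy (Rmin_r _ _))).
  replace (f y + g y - (f z + g z))%C with ((f y - f z) + (g y - g z))%C by ring.
  eapply Rle_lt_trans; [apply Cmod_triangle|]. lra.
Qed.

Lemma cont_mult f g z :
  cont_within D f z -> cont_within D g z ->
  cont_within D (fun y => f y * g y)%C z.
Proof.
  intros Hf Hg e He.
  set (M := Cmod (f z) + Cmod (g z) + 1).
  assert (HM : 1 <= M) by (unfold M; pose proof (Cmod_ge_0 (f z)); pose proof (Cmod_ge_0 (g z)); lra).
  assert (He' : 0 < Rmin 1 (e / (2 * M))).
  { apply Rmin_glb_lt; [lra|]. apply Rdiv_lt_0_compat; lra. }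
  destruct (Hf _ He') as (d1 & H1 & K1).
  destruct (Hg _ He') as (d2 & H2 & K2).
  exists (Rmin d1 d2). split; [now apply Rmin_glb_lt|].
  intros y Dy Hy.
  assert (A1 := K1 y Dy (Rlt_le_trans _ _ _ Hy (Rmin_l _ _))).
  assert (A2 := K2 y Dy (Rlt_le_trans _ _ _ Hy (Rmin_r _ _))).
  replace (f y * g y - f z * g z)%C
    with ((f y - f z) * (g y - g z) + (f y - f z) * g z + f z * (g y - g z))%C by ring.
  eapply Rle_lt_trans; [apply Cmod_triangle|].
  eapply Rle_lt_trans; [apply Rplus_le_compat_r, Cmod_triangle|].
  rewrite !Cmod_mult.
  set (m := Rmin 1 (e / (2 * M))) in *.
  assert (m <= 1) by apply Rmin_l.
  assert (Hm2 : m * (2 * M) <= e).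
  { assert (m <= e / (2 * M)) by apply Rmin_r.
    apply Rmult_le_compat_r with (r := 2 * M) in H0; [|lra].
    replace (e / (2 * M) * (2 * M)) with e in H0 by (field; lra). exact H0. }
  pose proof (Cmod_ge_0 (f y - f z)). pose proof (Cmod_ge_0 (g y - g z)).
  pose proof (Cmod_ge_0 (f z)). pose proof (Cmod_ge_0 (g z)).
  assert (Cmod (f y - f z) * Cmod (g y - g z) <= m * 1) by (apply Rmult_le_compat; lra).
  assert (Cmod (f y - f z) * Cmod (g z) <= m * Cmod (g z)) by (apply Rmult_le_compat_r; lra).
  assert (Cmod (f z) * Cmod (g y - g z) <= Cmod (f z) * m) by (apply Rmult_le_compat_l; lra).
  unfold M in Hm2.
  assert (m * (2 * (Cmod (f z) + Cmod (g z) + 1)) = 2 * (m * 1 + m * Cmod (g z) + Cmod (f z) * m)) by ring.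
  lra.
Qed.

Lemma cont_inv f z :
  f z <> 0 -> cont_within D f z -> cont_within D (fun y => / f y)%C z.
Proof.
  intros Hz Hf e He.
  assert (Hp : 0 < Cmod (f z)) by exact (proj1 (Cmod_gt_0 _) Hz).
  set (p := Cmod (f z)) in *.
  assert (He' : 0 < Rmin (p / 2) (e * p * p / 2)).
  { apply Rmin_glb_lt; [lra|]. assert (0 < e * p * p) by (repeat apply Rmult_lt_0_compat; auto). lra. }
  destruct (Hf _ He') as (d & H1 & K1).
  exists d. split; auto. intros y Dy Hy.
  assert (A := K1 y Dy Hy).
  assert (A1 := Rlt_le_trans _ _ _ A (Rmin_l _ _)).
  assert (A2 := Rlt_le_trans _ _ _ A (Rmin_r _ _)).
  assert (B : p / 2 < Cmod (f y)).
  { pose proof (Cmod_le_sub (f z) (f y)). rewrite Cmod_sub_sym in H. fold p in H. lra. }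
  assert (Hy0 : f y <> 0) by (intros h; rewrite h, Cmod_0 in B; lra).
  replace (/ f y - / f z)%C with ((f z - f y) / (f y * f z))%C by (field; auto).
  rewrite Cmod_div by (apply Cmult_neq_0; auto).
  rewrite Cmod_mult, Cmod_sub_sym. fold p.
  apply Rmult_lt_reg_r with (Cmod (f y) * p); [apply Rmult_lt_0_compat; lra|].
  unfold Rdiv. rewrite Rmult_assoc, Rinv_l, Rmult_1_r by (apply Rgt_not_eq, Rmult_lt_0_compat; lra).
  assert (e * (p / 2 * p) < e * (Cmod (f y) * p)).
  { apply Rmult_lt_compat_l; [exact He|]. apply Rmult_lt_compat_r; [exact Hp|exact B]. }
  lra.
Qed.

Lemma cont_opp f z : cont_within D f z -> cont_within D (fun y => - f y)%C z.
Proof.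
  intros Hf e He. destruct (Hf e He) as (d & Hd & K). exists d; split; auto.
  intros y Dy Hy. specialize (K y Dy Hy).
  replace (- f y - - f z)%C with (- (f y - f z))%C by ring. now rewrite Cmod_opp.
Qed.

Lemma cont_minus f g z :
  cont_within D f z -> cont_within D g z ->
  cont_within D (fun y => f y - g y)%C z.
Proof. intros. apply cont_plus; auto. apply cont_opp; auto. Qed.

Lemma cont_div f g z :
  g z <> 0 -> cont_within D f z -> cont_within D g z ->
  cont_within D (fun y => f y / g y)%C z.
Proof. intros. apply cont_mult; auto. apply cont_inv; auto. Qed.

Lemma cont_comp (E : C -> Prop) f g z :
  (forall y, D y -> E (g y)) ->
  cont_within D g z -> cont_within E f (g z) ->
  cont_within D (fun y => f (g y)) z.
Proof.
  intros HE Hg Hf e He.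
  destruct (Hf e He) as (d & Hd & K).
  destruct (Hg d Hd) as (d' & Hd' & K').
  exists d'; split; auto.
Qed.

Lemma cont_pow f z n : cont_within D f z -> cont_within D (fun y => f y ^ n)%C z.
Proof.
  intros Hf. induction n; simpl; [apply cont_const|].
  apply cont_mult; auto.
Qed.

End ContWithin.

Lemma cont_ext D f g z : (forall y, f y = g y) -> cont_within D f z -> cont_within D g z.
Proof.
  intros H Hf e He. destruct (Hf e He) as (d & Hd & K). exists d; split; auto.
  intros. rewrite <- !H. auto.
Qed.

Lemma cdiff_cont f z : cdiff f z -> cont_within everywhere f z.
Proof.
  intros (s & Hs & Hf).
  apply cont_ext with (fun y => f z + (y - z) * s y)%C.
  { intros y. rewrite <- Hf. ring. }
  apply cont_plus; [apply cont_const|].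
  apply cont_mult; auto. apply cont_minus; [apply cont_id|apply cont_const].
Qed.

Lemma cdiff_const c z : cdiff (fun _ => c) z.
Proof. exists (fun _ => 0). split; [apply cont_const|]. intros; ring. Qed.

Lemma cdiff_id z : cdiff (fun y => y) z.
Proof. exists (fun _ => 1). split; [apply cont_const|]. intros; ring. Qed.

Lemma cdiff_plus f g z : cdiff f z -> cdiff g z -> cdiff (fun y => f y + g y)%C z.
Proof.
  intros (s & Hs & Hf) (t & Ht & Hg). exists (fun y => s y + t y)%C.
  split; [now apply cont_plus|]. intros y.
  replace (f y + g y - (f z + g z))%C with ((f y - f z) + (g y - g z))%C by ring.
  rewrite Hf, Hg. ring.
Qed.

Lemma cdiff_opp f z : cdiff f z -> cdiff (fun y => - f y)%C z.
Proof.
  intros (s & Hs & Hf). exists (fun y => - s y)%C. split; [now apply cont_opp|].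
  intros y. replace (- f y - - f z)%C with (- (f y - f z))%C by ring. rewrite Hf. ring.
Qed.

Lemma cdiff_minus f g z : cdiff f z -> cdiff g z -> cdiff (fun y => f y - g y)%C z.
Proof. intros. apply cdiff_plus; auto. apply cdiff_opp; auto. Qed.

Lemma cdiff_mult f g z : cdiff f z -> cdiff g z -> cdiff (fun y => f y * g y)%C z.
Proof.
  intros Hf' Hg'. assert (Cf := cdiff_cont _ _ Hf').
  destruct Hf' as (s & Hs & Hf). destruct Hg' as (t & Ht & Hg).
  exists (fun y => s y * g z + f y * t y)%C.
  split.
  { apply cont_plus; apply cont_mult; auto. apply cont_const. }
  intros y.
  replace (f y * g y - f z * g z)%C with ((f y - f z) * g z + f y * (g y - g z))%C by ring.
  rewrite Hf, Hg. ring.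
Qed.

Lemma cdiff_comp f g z : cdiff g z -> cdiff f (g z) -> cdiff (fun y => f (g y)) z.
Proof.
  intros Hg' (s & Hs & Hf). assert (Cg := cdiff_cont _ _ Hg').
  destruct Hg' as (t & Ht & Hg).
  exists (fun y => s (g y) * t y)%C. split.
  { apply cont_mult; auto. apply cont_comp with everywhere; auto. }
  intros y. rewrite Hf, Hg. ring.
Qed.

Lemma cdiff_pow f z n : cdiff f z -> cdiff (fun y => f y ^ n)%C z.
Proof.
  intros Hf. induction n; simpl; [apply cdiff_const|]. apply cdiff_mult; auto.
Qed.

(** The slope is the difference quotient completed at [z] by the derivative. This form is local,
    whereas the slope identity is required at every point of the plane; it is also the one that
    compares with [is_derive]. *)
Lemma cdiff_iff_eps f z :
  cdiff f z <->
  exists l, forall eps, 0 < eps -> exists del, 0 < del /\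
    forall y, Cmod (y - z) < del -> Cmod (f y - f z - (y - z) * l) <= eps * Cmod (y - z).
Proof.
  split.
  - intros (s & Hs & Hf). exists (s z). intros e He.
    destruct (Hs e He) as (d & Hd & K). exists d; split; auto.
    intros y Hy. specialize (K y I Hy). rewrite Hf.
    replace ((y - z) * s y - (y - z) * s z)%C with ((y - z) * (s y - s z))%C by ring.
    rewrite Cmod_mult. pose proof (Cmod_ge_0 (y - z)). nra.
  - intros (l & H).
    exists (fun y => if excluded_middle_informative (y = z) then l else (f y - f z) / (y - z))%C.
    split.
    + intros e He. destruct (H (e / 2)) as (d & Hd & K); [lra|].
      exists d; split; auto. intros y _ Hy.
      destruct (excluded_middle_informative (z = z)) as [_|n]; [|now elim n].
      destruct (excluded_middle_informative (y = z)) as [E|E].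
      { rewrite Cmod_sub_self; lra. }
      assert (Hn := Csub_neq0 _ _ E). assert (Hp := Csub_pos _ _ E).
      replace ((f y - f z) / (y - z) - l)%C with ((f y - f z - (y - z) * l) / (y - z))%C
        by (field; auto).
      rewrite Cmod_div by auto. specialize (K y Hy).
      apply Rmult_lt_reg_r with (Cmod (y - z)); auto.
      unfold Rdiv. rewrite Rmult_assoc, Rinv_l by lra. nra.
    + intros y. destruct (excluded_middle_informative (y = z)) as [E|E].
      * subst. ring.
      * field. now apply Csub_neq0.
Qed.

Lemma cdiff_local f g z r :
  0 < r -> (forall y, Cmod (y - z) < r -> f y = g y) -> cdiff f z -> cdiff g z.
Proof.
  intros Hr H. rewrite !cdiff_iff_eps. intros (l & K). exists l.
  intros e He. destruct (K e He) as (d & Hd & K').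
  exists (Rmin d r). split; [now apply Rmin_glb_lt|].
  intros y Hy. rewrite <- !H.
  - apply K'. eapply Rlt_le_trans; [apply Hy|apply Rmin_l].
  - rewrite Cmod_sub_self; auto.
  - eapply Rlt_le_trans; [apply Hy|apply Rmin_r].
Qed.

(** The natural slope [- s y / (f y * f z)] satisfies the required identity only where [f y <> 0],
    hence the passage through the local form on a disc where [f] does not vanish. *)
Lemma cdiff_inv f z : f z <> 0 -> cdiff f z -> cdiff (fun y => / f y)%C z.
Proof.
  intros Hz Hf'. assert (Cf := cdiff_cont _ _ Hf').
  destruct Hf' as (s & Hs & Hf).
  assert (Hp : 0 < Cmod (f z)) by exact (proj1 (Cmod_gt_0 _) Hz).
  destruct (Cf _ Hp) as (d & Hd & K).
  assert (Hn : forall y, Cmod (y - z) < d -> f y <> 0).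
  { intros y Hy h. specialize (K y I Hy). rewrite h in K.
    replace (0 - f z)%C with (- f z)%C in K by ring. rewrite Cmod_opp in K. lra. }
  apply cdiff_iff_eps. exists (- s z / (f z * f z))%C. intros e He.
  assert (Cs : cont_within everywhere (fun y => - s y / (f y * f z))%C z).
  { apply cont_div; [now apply Cmult_neq_0| now apply cont_opp|].
    apply cont_mult; auto. apply cont_const. }
  destruct (Cs e He) as (d' & Hd' & K').
  exists (Rmin d d'). split; [now apply Rmin_glb_lt|]. intros y Hy.
  assert (Hy1 := Rlt_le_trans _ _ _ Hy (Rmin_l _ _)).
  assert (Hy2 := Rlt_le_trans _ _ _ Hy (Rmin_r _ _)).
  specialize (K' y I Hy2). specialize (Hn y Hy1).
  replace (/ f y - / f z)%C with (- (f y - f z) / (f y * f z))%C by (field; auto).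
  rewrite Hf.
  replace (- ((y - z) * s y) / (f y * f z) - (y - z) * (- s z / (f z * f z)))%C
    with ((y - z) * (- s y / (f y * f z) - - s z / (f z * f z)))%C by (field; auto).
  rewrite Cmod_mult. pose proof (Cmod_ge_0 (y - z)). nra.
Qed.

Lemma cdiff_div f g z : g z <> 0 -> cdiff f z -> cdiff g z -> cdiff (fun y => f y / g y)%C z.
Proof. intros. apply cdiff_mult; auto. apply cdiff_inv; auto. Qed.

(** * Comparison with the topological definitions, and the disc algebra *)

Lemma locally_Cmod (z : C) (P : C -> Prop) :
  @locally C_UniformSpace z P <->
  exists del, 0 < del /\ forall y, Cmod (y - z) < del -> P y.
Proof.
  split.
  - intros (d & Hd). exists d. split; [apply cond_pos|].
    intros y Hy. apply Hd. apply C_NormedModule_mixin_compat1. exact Hy.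
  - intros (d & Hd & K).
    assert (Hs : 0 < sqrt 2) by (apply sqrt_lt_R0; lra).
    assert (Hd' : 0 < d / sqrt 2) by now apply Rdiv_lt_0_compat.
    (* Balls of the product uniform structure are squares; one of radius [r] lies in the disc of
       radius [sqrt 2 * r]. *)
    exists (mkposreal _ Hd'). intros y Hy. apply K.
    apply C_NormedModule_mixin_compat2 in Hy. simpl in Hy.
    replace (sqrt 2 * (d / sqrt 2)) with d in Hy by (field; lra). exact Hy.
Qed.

Lemma filterlim_cont_within f z :
  filterlim f (within closed_disc (@locally C_UniformSpace z)) (@locally C_UniformSpace (f z))
  <-> cont_within closed_disc f z.
Proof.
  split.
  - intros H e He.
    assert (A : @locally C_UniformSpace (f z) (fun y => Cmod (y - f z) < e)).
    { apply locally_Cmod. exists e; auto. }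
    specialize (H _ A). unfold filtermap, within in H.
    apply locally_Cmod in H. destruct H as (d & Hd & K). exists d; split; auto.
  - intros H P HP. apply locally_Cmod in HP. destruct HP as (e & He & HP).
    destruct (H e He) as (d & Hd & K).
    unfold filtermap, within. apply locally_Cmod. exists d; split; auto.
Qed.

Lemma ex_derive_cdiff f z : @ex_derive C_AbsRing C_NormedModule f z <-> cdiff f z.
Proof.
  rewrite cdiff_iff_eps. split.
  - intros (l & _ & H). exists l. intros e He.
    specialize (H z (fun P HP => HP) (mkposreal e He)).
    apply locally_C in H. apply locally_Cmod in H. destruct H as (d & Hd & K).
    exists d; split; [exact Hd|exact K].
  - intros (l & H). exists l. split.
    + apply is_linear_scal_l.
    + intros x Hx e.
      assert (x = z) by (symmetry; now apply is_filter_lim_locally_unique). subst x.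
      apply locally_C. apply locally_Cmod.
      destruct (H e (cond_pos e)) as (d & Hd & K).
      exists d; split; [exact Hd|exact K].
Qed.

Lemma in_disc_algebra_iff f : in_disc_algebra f <-> disc_alg f.
Proof.
  split; intros (H1 & H2); split; intros z Hz.
  - apply ex_derive_cdiff; auto.
  - apply filterlim_cont_within; auto.
  - apply ex_derive_cdiff; auto.
  - apply filterlim_cont_within; auto.
Qed.

Lemma disc_alg_const c : disc_alg (fun _ => c).
Proof. split; intros; [apply cdiff_const|apply cont_const]. Qed.

Lemma disc_alg_id : disc_alg (fun z => z).
Proof. split; intros; [apply cdiff_id|apply cont_id]. Qed.

Lemma disc_alg_plus f g : disc_alg f -> disc_alg g -> disc_alg (fun z => f z + g z)%C.
Proof.
  intros (F1 & F2) (G1 & G2); split; intros; [apply cdiff_plus|apply cont_plus]; auto.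
Qed.

Lemma disc_alg_minus f g : disc_alg f -> disc_alg g -> disc_alg (fun z => f z - g z)%C.
Proof.
  intros (F1 & F2) (G1 & G2); split; intros; [apply cdiff_minus|apply cont_minus]; auto.
Qed.

Lemma disc_alg_mult f g : disc_alg f -> disc_alg g -> disc_alg (fun z => f z * g z)%C.
Proof.
  intros (F1 & F2) (G1 & G2); split; intros; [apply cdiff_mult|apply cont_mult]; auto.
Qed.

Lemma disc_alg_div f g :
  (forall z, Cmod z <= 1 -> g z <> 0) ->
  disc_alg f -> disc_alg g -> disc_alg (fun z => f z / g z)%C.
Proof.
  intros H (F1 & F2) (G1 & G2); split; intros; [apply cdiff_div|apply cont_div]; auto.
  apply H; lra.
Qed.

Lemma disc_alg_pow f n : disc_alg f -> disc_alg (fun z => f z ^ n)%C.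
Proof.
  intros (F1 & F2); split; intros; [apply cdiff_pow|apply cont_pow]; auto.
Qed.

Lemma disc_alg_comp f b :
  disc_alg f -> disc_alg b ->
  (forall z, Cmod z < 1 -> Cmod (b z) < 1) ->
  (forall z, Cmod z <= 1 -> Cmod (b z) <= 1) ->
  disc_alg (fun z => f (b z)).
Proof.
  intros (F1 & F2) (G1 & G2) H1 H2; split; intros.
  - apply cdiff_comp; auto.
  - apply cont_comp with closed_disc; auto.
Qed.

Lemma disc_alg_ext f g : (forall z, f z = g z) -> disc_alg f -> disc_alg g.
Proof.
  intros H (F1 & F2). split; intros z Hz.
  - apply cdiff_local with f 1; auto. lra.
  - apply cont_ext with f; auto.
Qed.

(** [real] sends both infinities to [0], so the least upper bound has to be shown finite: [M]
    excludes one infinity and the value at the centre the other. *)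
Lemma supnorm_le f M :
  (forall z, Cmod z <= 1 -> Cmod (f z) <= M) -> supnorm f <= M.
Proof.
  intros H. unfold supnorm.
  destruct (Lub_Rbar_correct (fun r => exists z : C, Cmod z <= 1 /\ r = Cmod (f z))) as [U L].
  set (s := Lub_Rbar _) in *.
  assert (Hle : Rbar_le s M) by (apply L; intros r (z & Hz & ->); apply H; auto).
  assert (H0 : Rbar_le (Cmod (f 0)) s).
  { apply U. exists 0. split; auto. rewrite Cmod_0; lra. }
  destruct s; simpl in *; auto; contradiction.
Qed.

Lemma le_supnorm f M z :
  (forall z, Cmod z <= 1 -> Cmod (f z) <= M) -> Cmod z <= 1 -> Cmod (f z) <= supnorm f.
Proof.
  intros H Hz. unfold supnorm.
  destruct (Lub_Rbar_correct (fun r => exists z : C, Cmod z <= 1 /\ r = Cmod (f z))) as [U L].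
  set (s := Lub_Rbar _) in *.
  assert (Hle : Rbar_le s M) by (apply L; intros r (y & Hy & ->); apply H; auto).
  assert (H0 : Rbar_le (Cmod (f z)) s) by (apply U; exists z; auto).
  destruct s; simpl in *; auto; contradiction.
Qed.

(** * Goursat's lemma for closed one-forms *)

Lemma RInt_near_const (f : R -> R) a b k e :
  a <= b -> ex_RInt f a b ->
  (forall x, a <= x <= b -> Rabs (f x - k) <= e) ->
  Rabs (RInt f a b - k * (b - a)) <= e * (b - a).
Proof.
  intros Hab Hex H.
  assert (H1 : RInt (fun _ => k - e) a b <= RInt f a b).
  { apply RInt_le; auto. apply ex_RInt_const.
    intros x Hx. specialize (H x). assert (Hx' : a <= x <= b) by lra.
    specialize (H Hx'). apply Rabs_le_between in H. lra. }
  assert (H2 : RInt f a b <= RInt (fun _ => k + e) a b).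
  { apply RInt_le; auto. apply ex_RInt_const.
    intros x Hx. specialize (H x). assert (Hx' : a <= x <= b) by lra.
    specialize (H Hx'). apply Rabs_le_between in H. lra. }
  rewrite RInt_const in H1, H2. unfold scal in *; simpl in *; unfold mult in *; simpl in *.
  apply Rabs_le. nra.
Qed.

Section Goursat.
Variables (p q : R -> R -> R) (B0 : R).

(** The form [p dx + q dy] is differentiable at each point of the half-plane, and closedness is
    expressed by the single [p2], which is at once the [y]-derivative of [p] and the [x]-derivative
    of [q]. No continuity of derivatives is assumed. *)
Hypothesis closed_form : forall x y, x < B0 -> exists p1 p2 q2,
  forall eps, 0 < eps -> exists del, 0 < del /\
  forall x' y', Rabs (x' - x) < del -> Rabs (y' - y) < del ->
    Rabs (p x' y' - p x y - p1 * (x' - x) - p2 * (y' - y)) <= eps * (Rabs (x' - x) + Rabs (y' - y)) /\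
    Rabs (q x' y' - q x y - p2 * (x' - x) - q2 * (y' - y)) <= eps * (Rabs (x' - x) + Rabs (y' - y)).

Lemma affine_approx_continuous (h : R -> R) (x l : R) :
  (exists del, 0 < del /\ forall x', Rabs (x' - x) < del ->
     Rabs (h x' - h x - l * (x' - x)) <= Rabs (x' - x)) ->
  continuous h x.
Proof.
  intros (d & Hd & H). apply continuity_pt_filterlim. intros e He.
  set (M := Rabs l + 1). assert (HM : 1 <= M) by (unfold M; pose proof (Rabs_pos l); lra).
  exists (Rmin d (e / (2 * M))). split.
  { apply Rmin_glb_lt; auto. apply Rdiv_lt_0_compat; lra. }
  intros x' (_ & Hx'). simpl in *. unfold R_dist in *.
  assert (A1 := Rlt_le_trans _ _ _ Hx' (Rmin_l _ _)).
  assert (A2 := Rlt_le_trans _ _ _ Hx' (Rmin_r _ _)).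
  specialize (H x' A1).
  replace (h x' - h x) with ((h x' - h x - l * (x' - x)) + l * (x' - x)) by ring.
  eapply Rle_lt_trans; [apply Rabs_triang|]. rewrite Rabs_mult.
  apply Rmult_lt_compat_r with (r := 2 * M) in A2; [|lra].
  replace (e / (2 * M) * (2 * M)) with e in A2 by (field; lra).
  pose proof (Rabs_pos (x' - x)). unfold M in A2.
  assert (Rabs l * Rabs (x' - x) + Rabs (x' - x) = Rabs (x' - x) * (Rabs l + 1)) by ring.
  assert (0 <= Rabs (x' - x) * (Rabs l + 1)) by (apply Rmult_le_pos; [auto|unfold M in HM; lra]).
  lra.
Qed.

Lemma p_continuous_x y x : x < B0 -> continuous (fun x => p x y) x.
Proof.
  intros Hx. destruct (closed_form x y Hx) as (p1 & p2 & q2 & H).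
  destruct (H 1) as (d & Hd & K); [lra|].
  apply affine_approx_continuous with p1. exists d; split; auto.
  intros x' Hx'. destruct (K x' y Hx') as (K1 & _).
  { rewrite Rminus_diag, Rabs_R0; auto. }
  rewrite Rminus_diag, Rabs_R0 in K1.
  replace (p x' y - p x y - p1 * (x' - x) - p2 * 0) with (p x' y - p x y - p1 * (x' - x)) in K1 by ring.
  lra.
Qed.

Lemma q_continuous_y x y : x < B0 -> continuous (fun y => q x y) y.
Proof.
  intros Hx. destruct (closed_form x y Hx) as (p1 & p2 & q2 & H).
  destruct (H 1) as (d & Hd & K); [lra|].
  apply affine_approx_continuous with q2. exists d; split; auto.
  intros y' Hy'. destruct (K x y') as (_ & K1); auto.
  { rewrite Rminus_diag, Rabs_R0; auto. }
  rewrite Rminus_diag, Rabs_R0 in K1.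
  replace (q x y' - q x y - p2 * 0 - q2 * (y' - y)) with (q x y' - q x y - q2 * (y' - y)) in K1 by ring.
  lra.
Qed.

(** The integral of [p dx + q dy] along the boundary of [[a,b] x [c,d]], counterclockwise, with
    opposite sides paired. *)
Definition rect_int a b c d :=
  RInt (fun x => p x c - p x d) a b + RInt (fun y => q b y - q a y) c d.

Lemma ex_int_p a b c d : a < B0 -> b < B0 -> ex_RInt (fun x => p x c - p x d) a b.
Proof.
  intros Ha Hb. apply (@ex_RInt_continuous R_CompleteNormedModule). intros z Hz.
  assert (z < B0) by (eapply Rle_lt_trans; [apply Hz|]; now apply Rmax_lub_lt).
  apply (continuous_minus (fun x => p x c) (fun x => p x d)); apply p_continuous_x; auto.
Qed.

Lemma ex_int_q a b c d : a < B0 -> b < B0 -> ex_RInt (fun y => q b y - q a y) c d.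
Proof.
  intros Ha Hb. apply (@ex_RInt_continuous R_CompleteNormedModule). intros z Hz.
  apply (continuous_minus (fun x => q b x) (fun x => q a x)); apply q_continuous_y; auto.
Qed.

Lemma rect_int_split_x a m b c d : a < B0 -> m < B0 -> b < B0 ->
  rect_int a b c d = rect_int a m c d + rect_int m b c d.
Proof.
  intros Ha Hm Hb. unfold rect_int.
  rewrite <- (RInt_Chasles (fun x => p x c - p x d) a m b) by (apply ex_int_p; auto).
  assert (E : RInt (fun y => q b y - q a y) c d =
     RInt (fun y => q m y - q a y) c d + RInt (fun y => q b y - q m y) c d).
  { rewrite <- (RInt_plus (fun y => q m y - q a y)) by (apply ex_int_q; auto).
    apply RInt_ext. intros. unfold plus; simpl. ring. }
  rewrite E. unfold plus; simpl. ring.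
Qed.

Lemma rect_int_split_y a b c m d : a < B0 -> b < B0 ->
  rect_int a b c d = rect_int a b c m + rect_int a b m d.
Proof.
  intros Ha Hb. unfold rect_int.
  rewrite <- (RInt_Chasles (fun y => q b y - q a y) c m d) by (apply ex_int_q; auto).
  assert (E : RInt (fun x => p x c - p x d) a b =
     RInt (fun x => p x c - p x m) a b + RInt (fun x => p x m - p x d) a b).
  { rewrite <- (RInt_plus (fun x => p x c - p x m)) by (apply ex_int_p; auto).
    apply RInt_ext. intros. unfold plus; simpl. ring. }
  rewrite E. unfold plus; simpl. ring.
Qed.

(** The square of the half-perimeter shrinks by [4] when the sides are halved, and one of the four
    quarters keeps at least a quarter of the integral; so badness passes to a quarter with the same
    [e]. *)
Definition bad e a b c d :=
  a < b /\ b < B0 /\ c < d /\ e * ((b - a) + (d - c)) ^ 2 < Rabs (rect_int a b c d).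

Lemma bad_quarter e a b c d : bad e a b c d ->
  exists a' b' c' d', bad e a' b' c' d' /\ a <= a' /\ b' <= b /\ c <= c' /\ d' <= d /\
    b' - a' = (b - a) / 2 /\ d' - c' = (d - c) / 2.
Proof.
  intros (Hab & Hb & Hcd & H).
  set (m := (a + b) / 2). set (n := (c + d) / 2).
  assert (Q : exists a' b' c' d', ((a' = a /\ b' = m) \/ (a' = m /\ b' = b)) /\
     ((c' = c /\ d' = n) \/ (c' = n /\ d' = d)) /\
     e * ((b - a) + (d - c)) ^ 2 < 4 * Rabs (rect_int a' b' c' d')).
  { apply NNPP. intros N.
    assert (S : rect_int a b c d = rect_int a m c n + rect_int a m n d + (rect_int m b c n + rect_int m b n d)).
    { rewrite (rect_int_split_x a m b c d), (rect_int_split_y a m c n d), (rect_int_split_y m b c n d);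
        unfold m; lra. }
    assert (T : forall a' b' c' d', ((a' = a /\ b' = m) \/ (a' = m /\ b' = b)) ->
     ((c' = c /\ d' = n) \/ (c' = n /\ d' = d)) ->
     4 * Rabs (rect_int a' b' c' d') <= e * ((b - a) + (d - c)) ^ 2).
    { intros. apply Rnot_lt_le. intros K. apply N. exists a', b', c', d'. auto. }
    assert (T1 := T a m c n (or_introl (conj eq_refl eq_refl)) (or_introl (conj eq_refl eq_refl))).
    assert (T2 := T a m n d (or_introl (conj eq_refl eq_refl)) (or_intror (conj eq_refl eq_refl))).
    assert (T3 := T m b c n (or_intror (conj eq_refl eq_refl)) (or_introl (conj eq_refl eq_refl))).
    assert (T4 := T m b n d (or_intror (conj eq_refl eq_refl)) (or_intror (conj eq_refl eq_refl))).
    rewrite S in H.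
    pose proof (Rabs_triang (rect_int a m c n + rect_int a m n d) (rect_int m b c n + rect_int m b n d)).
    pose proof (Rabs_triang (rect_int a m c n) (rect_int a m n d)).
    pose proof (Rabs_triang (rect_int m b c n) (rect_int m b n d)).
    lra. }
  destruct Q as (a' & b' & c' & d' & X & Y & Q).
  exists a', b', c', d'.
  assert (Ew : b' - a' = (b - a) / 2) by (unfold m in X; destruct X as [(-> & ->)|(-> & ->)]; field).
  assert (Eh : d' - c' = (d - c) / 2) by (unfold n in Y; destruct Y as [(-> & ->)|(-> & ->)]; field).
  assert (a <= a' /\ b' <= b) by (unfold m in X; lra).
  assert (c <= c' /\ d' <= d) by (unfold n in Y; lra).
  repeat split; try tauto; try lra.
  rewrite Ew, Eh.
  replace (((b - a) / 2 + (d - c) / 2) ^ 2) with ((b - a + (d - c)) ^ 2 / 4) by field.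
  lra.
Qed.

(** Near [(x, y)] the form is affine up to [e / 2] times the size. For the affine part the two pairs
    of sides give [p2 (c - d) (b - a)] and [p2 (b - a) (d - c)], which cancel; each side contributes
    one error [e / 2], two for a pair. *)
Lemma no_bad_near e x y : 0 < e -> x < B0 -> exists del, 0 < del /\
  forall a b c d, a <= x <= b -> c <= y <= d -> b - a < del -> d - c < del -> ~ bad e a b c d.
Proof.
  intros He Hx. destruct (closed_form x y Hx) as (p1 & p2 & q2 & H).
  destruct (H (e / 2)) as (del & Hdel & K); [lra|].
  exists del; split; auto. intros a b c d Hxa Hyc Hw Hh (Hab & Hb & Hcd & Hbad).
  set (s := (b - a) + (d - c)) in *.
  assert (A : forall x' y', a <= x' <= b -> c <= y' <= d ->
     Rabs (p x' y' - p x y - p1 * (x' - x) - p2 * (y' - y)) <= e / 2 * s /\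
     Rabs (q x' y' - q x y - p2 * (x' - x) - q2 * (y' - y)) <= e / 2 * s).
  { intros x' y' Hx' Hy'.
    assert (X : Rabs (x' - x) <= b - a) by (apply Rabs_le; lra).
    assert (Y : Rabs (y' - y) <= d - c) by (apply Rabs_le; lra).
    assert (Z : e / 2 * (Rabs (x' - x) + Rabs (y' - y)) <= e / 2 * s)
      by (apply Rmult_le_compat_l; unfold s; lra).
    destruct (K x' y'); lra. }
  assert (I1 := RInt_near_const (fun x => p x c - p x d) a b (p2 * (c - d)) (e * s)
     ltac:(lra) ltac:(apply ex_int_p; lra)).
  assert (I2 := RInt_near_const (fun y => q b y - q a y) c d (p2 * (b - a)) (e * s)
     ltac:(lra) ltac:(apply ex_int_q; lra)).
  unfold rect_int in Hbad.
  lapply I1; clear I1; [intros I1|].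
  - lapply I2; clear I2; [intros I2|].
    + set (U := RInt _ a b) in *. set (V := RInt _ c d) in *.
      assert (Rabs (U + V) <= e * s ^ 2).
      { replace (U + V) with ((U - p2 * (c - d) * (b - a)) + (V - p2 * (b - a) * (d - c))) by ring.
        eapply Rle_trans; [apply Rabs_triang|].
        replace (e * s ^ 2) with (e * s * (b - a) + e * s * (d - c)) by (unfold s; ring). lra. }
      lra.
    + intros y' Hy'. destruct (A b y') as (_ & A1); [lra|lra|]. destruct (A a y') as (_ & A2); [lra|lra|].
      apply Rabs_le_between in A1, A2. apply Rabs_le. lra.
  - intros x' Hx'. destruct (A x' c) as (A1 & _); [lra|lra|]. destruct (A x' d) as (A2 & _); [lra|lra|].
    apply Rabs_le_between in A1, A2. apply Rabs_le. lra.
Qed.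

Record quad := Quad { qa : R; qb : R; qc : R; qd : R }.

Lemma not_bad e a b c d : 0 < e -> ~ bad e a b c d.
Proof.
  intros He H0.
  assert (St : forall r : {r : quad | bad e (qa r) (qb r) (qc r) (qd r)},
    {r' : {r : quad | bad e (qa r) (qb r) (qc r) (qd r)} |
       qa (proj1_sig r) <= qa (proj1_sig r') /\ qb (proj1_sig r') <= qb (proj1_sig r) /\
       qc (proj1_sig r) <= qc (proj1_sig r') /\ qd (proj1_sig r') <= qd (proj1_sig r) /\
       qb (proj1_sig r') - qa (proj1_sig r') = (qb (proj1_sig r) - qa (proj1_sig r)) / 2 /\
       qd (proj1_sig r') - qc (proj1_sig r') = (qd (proj1_sig r) - qc (proj1_sig r)) / 2}).
  { intros (r & Hr). apply constructive_indefinite_description. simpl.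
    destruct (bad_quarter _ _ _ _ _ Hr) as (a' & b' & c' & d' & Hb & Hr').
    exists (exist _ (Quad a' b' c' d') Hb). simpl. tauto. }
  set (s := nat_rect (fun _ => {r : quad | bad e (qa r) (qb r) (qc r) (qd r)})
     (exist _ (Quad a b c d) H0) (fun _ r => proj1_sig (St r))).
  set (A := fun n => qa (proj1_sig (s n))). set (B := fun n => qb (proj1_sig (s n))).
  set (U := fun n => qc (proj1_sig (s n))). set (V := fun n => qd (proj1_sig (s n))).
  assert (Hs : forall n, A n <= A (S n) /\ B (S n) <= B n /\ U n <= U (S n) /\ V (S n) <= V n /\
     B (S n) - A (S n) = (B n - A n) / 2 /\ V (S n) - U (S n) = (V n - U n) / 2).
  { intros n. unfold A, B, U, V. simpl. destruct (St (s n)) as (r' & Hr'). exact Hr'. }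
  assert (Hbad : forall n, bad e (A n) (B n) (U n) (V n)) by (intros n; exact (proj2_sig (s n))).
  assert (Hmon : forall n m, A n <= A (n + m)%nat /\ B (n + m)%nat <= B n /\ U n <= U (n + m)%nat /\ V (n + m)%nat <= V n).
  { intros n m. induction m; [rewrite Nat.add_0_r; lra|].
    rewrite Nat.add_succ_r. destruct (Hs (n + m)%nat). lra. }
  assert (Hcross : forall n m, A n <= B m /\ U n <= V m).
  { intros n m. destruct (Hmon n m) as (M1 & _ & M3 & _). destruct (Hmon m n) as (_ & M2 & _ & M4).
    rewrite Nat.add_comm in M2, M4. destruct (Hbad (n + m)%nat) as (? & ? & ? & _). lra. }
  (* The suprema of the left and of the lower edges give a point common to all nested rectangles; it
     stays left of [B0] because it is bounded by the right edge of the first one. *)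
  destruct (completeness (fun x => exists n, x = A n)) as (x & Ux & Lx).
  { exists (B 0%nat). intros y (n & ->). apply Hcross. }
  { exists (A 0%nat). eauto. }
  destruct (completeness (fun x => exists n, x = U n)) as (y & Uy & Ly).
  { exists (V 0%nat). intros y (n & ->). apply Hcross. }
  { exists (U 0%nat). eauto. }
  assert (HX : forall n, A n <= x <= B n).
  { intros n. split; [apply Ux; eauto|]. apply Lx. intros t (m & ->). apply Hcross. }
  assert (HY : forall n, U n <= y <= V n).
  { intros n. split; [apply Uy; eauto|]. apply Ly. intros t (m & ->). apply Hcross. }
  assert (HxB : x < B0).
  { destruct (HX 0%nat). destruct (Hbad 0%nat) as (_ & ? & _). lra. }
  destruct (no_bad_near e x y He HxB) as (del & Hdel & N).
  assert (Hsz : forall n, B n - A n = (B 0%nat - A 0%nat) * (/2) ^ n /\ V n - U n = (V 0%nat - U 0%nat) * (/2) ^ n).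
  { induction n; [simpl; lra|]. destruct (Hs n) as (_ & _ & _ & _ & -> & ->).
    destruct IHn as (-> & ->). simpl. lra. }
  set (W := B 0%nat - A 0%nat + (V 0%nat - U 0%nat)).
  assert (HW : 0 < B 0%nat - A 0%nat /\ 0 < V 0%nat - U 0%nat)
    by (destruct (Hbad 0%nat) as (? & _ & ? & _); lra).
  destruct (pow_lt_1_zero (/2) ltac:(rewrite Rabs_pos_eq; lra) (del / W)) as (n & Hn).
  { apply Rdiv_lt_0_compat; unfold W; lra. }
  specialize (Hn n (le_n _)). rewrite Rabs_pos_eq in Hn by (apply pow_le; lra).
  apply Rmult_lt_compat_r with (r := W) in Hn; [|unfold W; lra].
  replace (del / W * W) with del in Hn by (field; unfold W; lra).
  assert (0 < (/2) ^ n) by (apply pow_lt; lra).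
  destruct (Hsz n) as (S1 & S2). unfold W in Hn.
  apply (N (A n) (B n) (U n) (V n)); auto; try rewrite S1; try rewrite S2; nra.
Qed.

Lemma goursat a b c d : a < b -> b < B0 -> c < d -> rect_int a b c d = 0.
Proof.
  intros Hab Hb Hcd. apply NNPP. intros N.
  assert (0 < Rabs (rect_int a b c d)) by now apply Rabs_pos_lt.
  set (s := (b - a) + (d - c)). assert (0 < s) by (unfold s; lra).
  assert (0 < s ^ 2) by (apply pow_lt; lra).
  (* With half of the integral divided by [s ^ 2] as tolerance, the rectangle itself would be
     bad. *)
  apply (not_bad (Rabs (rect_int a b c d) / (2 * s ^ 2)) a b c d).
  { apply Rdiv_lt_0_compat; lra. }
  repeat split; auto. fold s.
  replace (Rabs (rect_int a b c d) / (2 * s ^ 2) * s ^ 2) with (Rabs (rect_int a b c d) / 2) by (field; lra).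
  lra.
Qed.

End Goursat.

(** * The unit circle *)

Definition cis (x : R) : C := (cos x, sin x).

Lemma Cmod_sqr_eq z (m : R) : 0 <= m -> Re z ^ 2 + Im z ^ 2 = m ^ 2 -> Cmod z = m.
Proof.
  intros Hm H. rewrite <- Cmod2_alt in H.
  apply Rsqr_inj; auto. apply Cmod_ge_0. unfold Rsqr. lra.
Qed.

Lemma Cmod_cis x : Cmod (cis x) = 1.
Proof.
  apply Cmod_sqr_eq; [lra|]. unfold cis; simpl.
  pose proof (sin2_cos2 x). unfold Rsqr in H. lra.
Qed.

Lemma cis_plus x y : cis (x + y) = (cis x * cis y)%C.
Proof. unfold cis, Cmult; simpl. rewrite cos_plus, sin_plus. f_equal; ring. Qed.

Lemma cis_0 : cis 0 = 1.
Proof. unfold cis. rewrite cos_0, sin_0. reflexivity. Qed.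

Lemma cis_2PI : cis (2 * PI) = 1.
Proof. unfold cis. rewrite cos_2PI, sin_2PI. reflexivity. Qed.

Lemma cis_opp x : cis (- x) = Cconj (cis x).
Proof. unfold cis, Cconj; simpl. now rewrite cos_neg, sin_neg. Qed.

Lemma cis_period x (k : Z) : cis (x + IZR k * (2 * PI)) = cis x.
Proof.
  assert (N : forall n y, cis (y + INR n * (2 * PI)) = cis y).
  { induction n; intros y.
    - simpl. f_equal. ring.
    - rewrite S_INR. replace (y + (INR n + 1) * (2 * PI)) with ((y + INR n * (2 * PI)) + 2 * PI) by ring.
      rewrite cis_plus, IHn, cis_2PI. ring. }
  destruct (Z.le_gt_cases 0 k).
  - rewrite <- (Z2Nat.id k) by auto. rewrite <- INR_IZR_INZ. apply N.
  - rewrite <- (N (Z.to_nat (- k)) (x + IZR k * (2 * PI))).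
    rewrite INR_IZR_INZ, Z2Nat.id by lia. rewrite opp_IZR. f_equal. ring.
Qed.

Lemma Cmod_cis_sub x y : Cmod (cis y - cis x) ^ 2 = 2 - 2 * cos (y - x).
Proof.
  rewrite Cmod2_alt. unfold cis; simpl. rewrite cos_minus.
  pose proof (sin2_cos2 x). pose proof (sin2_cos2 y). unfold Rsqr in *. lra.
Qed.

Lemma Rabs_sin_le u : Rabs (sin u) <= Rabs u.
Proof.
  assert (P : forall v, 0 <= v -> Rabs (sin v) <= v).
  { intros v [Hv|<-]; [|rewrite sin_0, Rabs_R0; lra].
    destruct (Rle_lt_dec v 1) as [H1|H1].
    - rewrite Rabs_pos_eq; [left; now apply sin_lt_x|].
      apply sin_ge_0; [lra|]. pose proof PI2_1. lra.
    - pose proof (SIN_bound v). apply Rabs_le. lra. }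
  destruct (Rle_lt_dec 0 u).
  - rewrite (Rabs_pos_eq u) by auto. auto.
  - rewrite <- Rabs_Ropp, <- sin_neg, (Rabs_left u) by auto. apply P; lra.
Qed.

Lemma cis_lip x y : Cmod (cis y - cis x) <= Rabs (y - x).
Proof.
  apply Rsqr_incr_0_var; [|apply Rabs_pos].
  rewrite <- Rsqr_abs. rewrite !Rsqr_pow2, Cmod_cis_sub.
  replace (y - x) with (2 * ((y - x) / 2)) by field.
  rewrite cos_2a_sin. set (t := (y - x) / 2).
  pose proof (Rabs_sin_le t) as H. apply Rsqr_le_abs_1 in H. unfold Rsqr in H. lra.
Qed.

Lemma cis_surj z : Cmod z = 1 -> exists x, 0 <= x < 2 * PI /\ cis x = z.
Proof.
  intros H. destruct z as [a c].
  assert (E : a ^ 2 + c ^ 2 = 1).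
  { change a with (Re (a, c)) at 1. change c with (Im (a, c)) at 2. rewrite <- Cmod2_alt, H. ring. }
  assert (Ha : -1 <= a <= 1) by nra.
  pose proof (acos_bound a). pose proof PI_RGT_0.
  destruct (Rle_lt_dec 0 c).
  - exists (acos a). split; [lra|]. unfold cis. rewrite cos_acos, sin_acos by auto.
    f_equal. replace (1 - a²) with (c²) by (unfold Rsqr; lra). now apply sqrt_Rsqr.
  - exists (2 * PI - acos a). split.
    { split; [lra|]. destruct (Req_dec (acos a) 0) as [h|h]; [|lra].
      assert (a = 1) by (rewrite <- (cos_acos a), h by auto; apply cos_0). nra. }
    unfold cis. rewrite cos_minus, sin_minus, cos_2PI, sin_2PI, cos_acos, sin_acos by auto.
    f_equal; [ring|]. replace (1 - a²) with ((- c)²) by (unfold Rsqr; lra).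
    rewrite sqrt_Rsqr by lra. ring.
Qed.

Lemma exists_mod (x T : R) : 0 < T -> exists k : Z, 0 <= x - IZR k * T < T.
Proof.
  intros HT. exists (up (x / T) - 1)%Z.
  destruct (archimed (x / T)) as (A1 & A2). rewrite minus_IZR.
  assert (E : x = x / T * T) by (field; lra).
  set (u := IZR (up (x / T))) in *. nra.
Qed.

Lemma cis_local del : 0 < del -> exists eta, 0 < eta /\
  forall x y, Cmod (cis y - cis x) < eta -> exists k : Z, Rabs (y - x - IZR k * (2 * PI)) < del.
Proof.
  intros Hd. pose proof PI_RGT_0.
  set (d := Rmin del PI).
  assert (Hd0 : 0 < d <= PI) by (unfold d; split; [now apply Rmin_glb_lt|apply Rmin_r]).
  assert (Hc : cos d < 1) by (rewrite <- cos_0; apply cos_decreasing_1; lra).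
  (* The length of the chord that subtends the angle [d]; the cap [d <= PI] keeps the cosine
     monotone. *)
  exists (sqrt (2 - 2 * cos d)). split; [apply sqrt_lt_R0; lra|].
  intros x y Hxy.
  destruct (exists_mod (y - x + PI) (2 * PI)) as (k & Hk); [lra|].
  exists k. set (t := y - x - IZR k * (2 * PI)).
  apply Rnot_le_lt. intros Ht.
  assert (Hdt : d <= Rabs t) by (eapply Rle_trans; [apply Rmin_l|exact Ht]).
  assert (Htp : Rabs t <= PI) by (apply Rabs_le; unfold t; lra).
  assert (Ec : cos (y - x) = cos (Rabs t)).
  { transitivity (cos t).
    - assert (A := cis_period t k). unfold t in A at 1.
      replace (y - x - IZR k * (2 * PI) + IZR k * (2 * PI)) with (y - x) in A by ring.
      unfold cis in A. injection A. auto.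
    - unfold Rabs; destruct (Rcase_abs t); auto. now rewrite cos_neg. }
  assert (Cl : cos (Rabs t) <= cos d) by (apply cos_decr_1; lra).
  apply Rlt_not_le in Hxy. apply Hxy.
  apply Rsqr_incr_0_var; [|apply Cmod_ge_0].
  rewrite Rsqr_sqrt by lra. rewrite Rsqr_pow2, Cmod_cis_sub, Ec. lra.
Qed.

Lemma cis_eq_mod x y : cis x = cis y -> exists k : Z, x = y + IZR k * (2 * PI).
Proof.
  intros H. pose proof PI_RGT_0.
  destruct (exists_mod (x - y) (2 * PI)) as (k & Hk); [lra|].
  exists k. set (t := x - y - IZR k * (2 * PI)) in *.
  assert (Ht : cis t = 1).
  { rewrite <- (cis_period t k). unfold t.
    replace (x - y - IZR k * (2 * PI) + IZR k * (2 * PI)) with (x + - y) by ring.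
    rewrite cis_plus, H, <- cis_plus. rewrite Rplus_opp_r. apply cis_0. }
  assert (Hc : cos t = 1) by (unfold cis in Ht; injection Ht; auto).
  assert (Hs : sin (t / 2) = 0).
  { assert (A : cos t = 1 - 2 * sin (t / 2) * sin (t / 2)).
    { rewrite <- cos_2a_sin. f_equal. field. }
    nra. }
  assert (Hz : t / 2 = 0).
  { destruct (Req_dec t 0) as [->|n]; [field|].
    assert (0 < sin (t / 2)) by (apply sin_gt_0; lra). lra. }
  unfold t in Hz. lra.
Qed.

(** Stated with a cluster point instead of an extracted subsequence: every compactness argument
    below needs only one late index close to [t]. *)
Lemma circle_compact (u : nat -> C) : (forall n, Cmod (u n) = 1) ->
  exists t, Cmod t = 1 /\ forall del N, 0 < del -> exists n, (N <= n)%nat /\ Cmod (u n - t) < del.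
Proof.
  intros H.
  assert (Hx : forall n, {x : R | 0 <= x <= 2 * PI /\ cis x = u n}).
  { intros n. apply constructive_indefinite_description.
    destruct (cis_surj (u n) (H n)) as (x & Hx & E). exists x. split; auto; lra. }
  destruct (Bolzano_Weierstrass (fun n => proj1_sig (Hx n)) (fun x => 0 <= x <= 2 * PI)) as (l & Hl).
  { apply compact_P3. }
  { intros n. apply (proj2_sig (Hx n)). }
  exists (cis l). split; [apply Cmod_cis|].
  intros del N Hdel.
  destruct (Hl (fun x => Rabs (x - l) < del) N) as (n & Hn & K).
  { exists (mkposreal _ Hdel). intros x Hx'. exact Hx'. }
  exists n. split; auto. destruct (Hx n) as (x & Hx' & E). simpl in K. rewrite <- E.
  eapply Rle_lt_trans; [apply cis_lip|auto].
Qed.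

(** * The maximum principle on the disc algebra *)

Lemma derivable_pt_lim_eps h x l : derivable_pt_lim h x l ->
  forall eps, 0 < eps -> exists del, 0 < del /\
    forall t, Rabs t < del -> Rabs (h (x + t) - h x - l * t) <= eps * Rabs t.
Proof.
  intros H eps He. destruct (H eps He) as (d & Hd).
  exists d. split; [apply cond_pos|]. intros t Ht.
  destruct (Req_dec t 0) as [->|n].
  { rewrite Rplus_0_r, Rabs_R0. replace (h x - h x - l * 0) with 0 by ring. rewrite Rabs_R0. lra. }
  specialize (Hd t n Ht).
  replace (h (x + t) - h x - l * t) with (((h (x + t) - h x) / t - l) * t) by (field; auto).
  rewrite Rabs_mult. apply Rmult_le_compat_r; [apply Rabs_pos|lra].
Qed.

Definition cexp z : C := (exp (Re z) * cis (Im z))%C.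

Lemma cexp_plus z h : cexp (z + h) = (cexp z * cexp h)%C.
Proof.
  unfold cexp. replace (Re (z + h)) with (Re z + Re h) by reflexivity.
  replace (Im (z + h)) with (Im z + Im h) by reflexivity.
  rewrite exp_plus, cis_plus, RtoC_mult. ring.
Qed.

Lemma Cmod_cexp z : Cmod (cexp z) = exp (Re z).
Proof.
  unfold cexp. rewrite Cmod_mult, Cmod_cis, Cmod_R, Rabs_pos_eq; [ring|].
  left; apply exp_pos.
Qed.

Lemma Cmod_le_Rabs z : Cmod z <= Rabs (Re z) + Rabs (Im z).
Proof.
  apply Rsqr_incr_0_var; [|pose proof (Rabs_pos (Re z)); pose proof (Rabs_pos (Im z)); lra].
  rewrite Rsqr_pow2, Cmod2_alt.
  assert (Re z ^ 2 = Rabs (Re z) * Rabs (Re z)) by (rewrite <- Rabs_mult, Rabs_pos_eq; [ring|nra]).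
  assert (Im z ^ 2 = Rabs (Im z) * Rabs (Im z)) by (rewrite <- Rabs_mult, Rabs_pos_eq; [ring|nra]).
  pose proof (Rabs_pos (Re z)); pose proof (Rabs_pos (Im z)). unfold Rsqr. nra.
Qed.

Lemma Im_le_Cmod z : Rabs (Im z) <= Cmod z.
Proof. eapply Rle_trans; [apply Rmax_r|apply Rmax_Cmod]. Qed.

Lemma cexp_0_approx eps : 0 < eps -> exists del, 0 < del /\
  forall h, Cmod h < del -> Cmod (cexp h - 1 - h) <= eps * Cmod h.
Proof.
  (* The real and the imaginary part will each cost at most [3 * (e * m)], so [8] leaves some
     slack. *)
  intros He. set (e := Rmin 1 (eps / 8)).
  assert (He0 : 0 < e) by (apply Rmin_glb_lt; lra).
  assert (He1 : e <= 1) by apply Rmin_l.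
  assert (He2 : 8 * e <= eps) by (assert (e <= eps / 8) by apply Rmin_r; lra).
  clearbody e.
  destruct (derivable_pt_lim_eps _ _ _ (derivable_pt_lim_exp 0) e He0) as (d1 & H1 & K1).
  destruct (derivable_pt_lim_eps _ _ _ (derivable_pt_lim_cos 0) e He0) as (d2 & H2 & K2).
  destruct (derivable_pt_lim_eps _ _ _ (derivable_pt_lim_sin 0) e He0) as (d3 & H3 & K3).
  exists (Rmin e (Rmin d1 (Rmin d2 d3))).
  split; [repeat apply Rmin_glb_lt; auto|].
  intros h Hh.
  assert (Hhe := Rlt_le_trans _ _ _ Hh (Rmin_l _ _)).
  assert (Hh1 := Rlt_le_trans _ _ _ Hh (Rmin_r _ _)).
  assert (Hh1' := Rlt_le_trans _ _ _ Hh1 (Rmin_l _ _)).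
  assert (Hh2 := Rlt_le_trans _ _ _ Hh1 (Rmin_r _ _)).
  assert (Hh2' := Rlt_le_trans _ _ _ Hh2 (Rmin_l _ _)).
  assert (Hh3 := Rlt_le_trans _ _ _ Hh2 (Rmin_r _ _)).
  assert (Hx := re_le_Cmod h). assert (Hy := Im_le_Cmod h).
  destruct h as [x y]. simpl in Hx, Hy. set (m := Cmod (x, y)) in *.
  assert (Hm : 0 <= m) by apply Cmod_ge_0.
  specialize (K1 x ltac:(lra)). specialize (K2 y ltac:(lra)). specialize (K3 y ltac:(lra)).
  rewrite Rplus_0_l in *. rewrite exp_0 in K1. rewrite cos_0, sin_0 in K2. rewrite sin_0, cos_0 in K3.
  assert (E1 : Rabs (exp x - 1 - x) <= e * m).
  { replace (exp x - 1 - x) with (exp x - 1 - 1 * x) by ring. eapply Rle_trans; [apply K1|].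
    apply Rmult_le_compat_l; lra. }
  assert (E2 : Rabs (cos y - 1) <= e * m).
  { replace (cos y - 1) with (cos y - 1 - - 0 * y) by ring. eapply Rle_trans; [apply K2|].
    apply Rmult_le_compat_l; lra. }
  assert (E3 : Rabs (sin y - y) <= e * m).
  { replace (sin y - y) with (sin y - 0 - 1 * y) by ring. eapply Rle_trans; [apply K3|].
    apply Rmult_le_compat_l; lra. }
  assert (E4 : Rabs (exp x - 1) <= 2 * m).
  { replace (exp x - 1) with ((exp x - 1 - x) + x) by ring.
    eapply Rle_trans; [apply Rabs_triang|]. nra. }
  eapply Rle_trans; [apply Cmod_le_Rabs|].
  replace (Re (cexp (x, y) - 1 - (x, y))) with ((exp x - 1 - x) * cos y + (1 + x) * (cos y - 1))
    by (unfold cexp; simpl; ring).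
  replace (Im (cexp (x, y) - 1 - (x, y))) with ((exp x - 1) * sin y + (sin y - y))
    by (unfold cexp; simpl; ring).
  assert (A1 : Rabs ((exp x - 1 - x) * cos y + (1 + x) * (cos y - 1)) <= 3 * (e * m)).
  { eapply Rle_trans; [apply Rabs_triang|]. rewrite !Rabs_mult.
    assert (Rabs (cos y) <= 1) by (apply Rabs_le; apply COS_bound).
    assert (Rabs (1 + x) <= 2).
    { eapply Rle_trans; [apply Rabs_triang|]. rewrite (Rabs_pos_eq 1); lra. }
    assert (Rabs (exp x - 1 - x) * Rabs (cos y) <= e * m * 1)
      by (apply Rmult_le_compat; auto using Rabs_pos).
    assert (Rabs (1 + x) * Rabs (cos y - 1) <= 2 * (e * m))
      by (apply Rmult_le_compat; auto using Rabs_pos).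
    lra. }
  assert (A2 : Rabs ((exp x - 1) * sin y + (sin y - y)) <= 3 * (e * m)).
  { eapply Rle_trans; [apply Rabs_triang|]. rewrite !Rabs_mult.
    assert (Rabs (sin y) <= e) by (pose proof (Rabs_sin_le y); lra).
    assert (Rabs (exp x - 1) * Rabs (sin y) <= 2 * m * e)
      by (apply Rmult_le_compat; auto using Rabs_pos).
    lra. }
  assert (6 * (e * m) <= eps * m) by (rewrite <- Rmult_assoc; apply Rmult_le_compat_r; lra).
  lra.
Qed.

Lemma cdiff_cexp z : cdiff cexp z.
Proof.
  apply cdiff_iff_eps. exists (cexp z). intros e He.
  assert (Hp : 0 < Cmod (cexp z)) by (rewrite Cmod_cexp; apply exp_pos).
  destruct (cexp_0_approx (e / Cmod (cexp z))) as (d & Hd & K); [now apply Rdiv_lt_0_compat|].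
  exists d; split; auto. intros y Hy. specialize (K _ Hy).
  replace (cexp y) with (cexp z * cexp (y - z))%C by (rewrite <- cexp_plus; f_equal; ring).
  replace (cexp z * cexp (y - z) - cexp z - (y - z) * cexp z)%C
    with (cexp z * (cexp (y - z) - 1 - (y - z)))%C by ring.
  rewrite Cmod_mult.
  replace (e * Cmod (y - z)) with (Cmod (cexp z) * (e / Cmod (cexp z) * Cmod (y - z))) by (field; lra).
  apply Rmult_le_compat_l; lra.
Qed.

Lemma RInt_circle_le (h : R -> R) M :
  ex_RInt h 0 (2 * PI) -> (forall x, h x <= M) -> RInt h 0 (2 * PI) <= M * (2 * PI).
Proof.
  intros Hex H. pose proof PI_RGT_0.
  replace (M * (2 * PI)) with (RInt (fun _ => M) 0 (2 * PI)).
  - apply RInt_le; auto; [lra|apply ex_RInt_const].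
  - rewrite RInt_const. unfold scal; simpl; unfold mult; simpl. ring.
Qed.

(** [f] is differentiable only inside the disc, so the bound on the circle must first be moved to a
    slightly smaller one, where Goursat's lemma applies. Failure for radii tending to [1] would
    contradict continuity at a cluster point on the circle. *)
Lemma near_circle_le f M eps : disc_alg f ->
  (forall z, Cmod z = 1 -> Cmod (f z) <= M) -> 0 < eps ->
  exists s, s < 0 /\ forall x, Cmod (f (exp s * cis x)%C) <= M + eps.
Proof.
  intros (_ & Cf) HM He. apply NNPP. intros N.
  assert (Hx : forall n : nat, {x : R | M + eps < Cmod (f (exp (- / (INR n + 1)) * cis x)%C)}).
  { intros n. apply constructive_indefinite_description. apply NNPP. intros K. apply N.
    exists (- / (INR n + 1)). split.
    - pose proof (pos_INR n). assert (0 < / (INR n + 1)) by (apply Rinv_0_lt_compat; lra). lra.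
    - intros x. apply Rnot_lt_le. intros Q. apply K. eauto. }
  destruct (circle_compact (fun n => cis (proj1_sig (Hx n)))) as (t & Ht & A).
  { intros; apply Cmod_cis. }
  destruct (Cf t ltac:(lra) eps He) as (d & Hd & K).
  assert (Hexp : continuity_pt exp 0) by (apply derivable_continuous_pt, derivable_pt_exp).
  destruct (Hexp (d / 2) ltac:(lra)) as (d1 & Hd1 & K1).
  destruct (archimed_cor1 d1 Hd1) as (N1 & HN1 & HN1').
  destruct (A (d / 2) N1 ltac:(lra)) as (n & Hn & Hnt).
  destruct (Hx n) as (x & Hxx). simpl in Hnt.
  set (s := - / (INR n + 1)) in *.
  assert (Hs0 : 0 < INR N1 <= INR n) by (split; [apply lt_0_INR|apply le_INR]; auto).
  assert (Hs : - d1 < s < 0).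
  { unfold s. assert (0 < / (INR n + 1)) by (apply Rinv_0_lt_compat; lra).
    assert (/ (INR n + 1) < / INR N1) by (apply Rinv_lt_contravar; nra). lra. }
  assert (E1 : exp s < 1) by (rewrite <- exp_0; apply exp_increasing; lra).
  assert (E0 := exp_pos s).
  assert (E2 : 1 - exp s < d / 2).
  { assert (Q : Rabs (exp s - exp 0) < d / 2).
    { apply K1. split; [split; [exact I|lra]|]. simpl. unfold R_dist. rewrite Rminus_0_r. apply Rabs_def1; lra. }
    rewrite exp_0 in Q. apply Rabs_def2 in Q. lra. }
  assert (Cd : Cmod (exp s * cis x)%C <= 1).
  { rewrite Cmod_mult, Cmod_cis, Cmod_R, Rabs_pos_eq; lra. }
  assert (L : Cmod (exp s * cis x - t) < d).
  { eapply Rle_lt_trans; [apply (Cmod_sub_triangle _ (cis x))|].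
    replace (exp s * cis x - cis x)%C with (RtoC (exp s - 1) * cis x)%C
      by (rewrite RtoC_minus; ring).
    rewrite Cmod_mult, Cmod_cis, Cmod_R, Rabs_left; lra. }
  specialize (K _ Cd L). specialize (HM t Ht).
  pose proof (Cmod_le_sub (f (exp s * cis x)%C) (f t)). lra.
Qed.

(** The mean value property in the coordinate [log z]. For [G = f o exp] on the left half-plane,
    [p dx + q dy] is the imaginary part of [G dz]. On a rectangle of height [2 PI] the horizontal
    sides cancel, so the means of [Re f] over the circles of radii [exp s] and [exp a] agree. The
    first is at most [M + e / 2]; the second is close to [Re (f 0)] when [a] is very negative. *)
Lemma re_center_le f M : disc_alg f ->
  (forall z, Cmod z = 1 -> Cmod (f z) <= M) -> Re (f 0) <= M.
Proof.
  intros Hf HM. apply le_epsilon. intros e He.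
  destruct (near_circle_le f M (e / 2) Hf HM ltac:(lra)) as (s & Hs & Ks).
  pose proof PI_RGT_0 as HPI.
  set (G := fun z => f (cexp z)).
  set (p := fun x y => Im (G (x, y))). set (q := fun x y => Re (G (x, y))).
  assert (Cl : forall x y, x < 0 -> exists p1 p2 q2,
    forall eps, 0 < eps -> exists del, 0 < del /\
    forall x' y', Rabs (x' - x) < del -> Rabs (y' - y) < del ->
    Rabs (p x' y' - p x y - p1 * (x' - x) - p2 * (y' - y)) <= eps * (Rabs (x' - x) + Rabs (y' - y)) /\
    Rabs (q x' y' - q x y - p2 * (x' - x) - q2 * (y' - y)) <= eps * (Rabs (x' - x) + Rabs (y' - y))).
  { intros x y Hx.
    assert (D : cdiff G (x, y)).
    { apply (cdiff_comp f cexp); [apply cdiff_cexp|]. apply Hf. rewrite Cmod_cexp. simpl.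
      rewrite <- exp_0. now apply exp_increasing. }
    apply cdiff_iff_eps in D. destruct D as ((al, be) & D).
    (* The Cauchy-Riemann equations for the derivative [al + i be]: here [p] is the imaginary and
       [q] the real part, and both mixed entries equal [al]. *)
    exists be, al, (- be). intros eps Heps.
    destruct (D eps Heps) as (d & Hd & K). exists (d / 2). split; [lra|].
    intros x' y' Hx' Hy'.
    assert (L : Cmod ((x', y') - (x, y)) <= Rabs (x' - x) + Rabs (y' - y))
      by (apply (Cmod_le_Rabs ((x', y') - (x, y)))).
    specialize (K (x', y') ltac:(lra)).
    assert (L' : eps * Cmod ((x', y') - (x, y)) <= eps * (Rabs (x' - x) + Rabs (y' - y)))
      by (apply Rmult_le_compat_l; lra).
    assert (KI := Im_le_Cmod (G (x', y') - G (x, y) - ((x', y') - (x, y)) * (al, be))).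
    assert (KR := re_le_Cmod (G (x', y') - G (x, y) - ((x', y') - (x, y)) * (al, be))).
    split.
    - replace (p x' y' - p x y - be * (x' - x) - al * (y' - y))
        with (Im (G (x', y') - G (x, y) - ((x', y') - (x, y)) * (al, be))).
      + lra.
      + unfold p. generalize (G (x', y')) (G (x, y)). intros (u1, v1) (u2, v2). simpl. ring.
    - replace (q x' y' - q x y - al * (x' - x) - - be * (y' - y))
        with (Re (G (x', y') - G (x, y) - ((x', y') - (x, y)) * (al, be))).
      + lra.
      + unfold q. generalize (G (x', y')) (G (x, y)). intros (u1, v1) (u2, v2). simpl. ring. }
  destruct Hf as (Df & Cf).
  destruct (Cf 0 ltac:(rewrite Cmod_0; lra) (e / 2) ltac:(lra)) as (d & Hd & K0).
  (* a very negative abscissa, where [f (exp (a + i y))] is close to [f 0] *)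
  set (a := Rmin (s - 1) (ln d - 1)).
  assert (Has : a < s) by (unfold a; pose proof (Rmin_l (s - 1) (ln d - 1)); lra).
  assert (Had : exp a < d).
  { rewrite <- (exp_ln d Hd). apply exp_increasing.
    unfold a; pose proof (Rmin_r (s - 1) (ln d - 1)); lra. }
  assert (I0 := goursat p q 0 Cl a s 0 (2 * PI) Has Hs ltac:(lra)).
  unfold rect_int in I0.
  (* The two horizontal sides have the same image under [cexp]. *)
  assert (Ip : RInt (fun x => p x 0 - p x (2 * PI)) a s = 0).
  { transitivity (RInt (fun _ => 0) a s).
    - apply RInt_ext. intros x _. unfold p, G.
      replace (cexp (x, 2 * PI)) with (cexp (x, 0)); [exact (Rminus_diag _)|].
      unfold cexp. simpl. rewrite cis_2PI, cis_0. reflexivity.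
    - rewrite RInt_const. unfold scal; simpl; unfold mult; simpl. ring. }
  rewrite Ip, Rplus_0_l in I0.
  assert (Xq : forall x, x < 0 -> ex_RInt (fun y => q x y) 0 (2 * PI)).
  { intros x Hx. apply (@ex_RInt_continuous R_CompleteNormedModule). intros y _.
    apply (q_continuous_y p q 0 Cl); auto. }
  assert (I1 : RInt (fun y => q s y) 0 (2 * PI) = RInt (fun y => q a y) 0 (2 * PI)).
  { rewrite (RInt_minus (fun y => q s y) (fun y => q a y)) in I0 by (apply Xq; lra).
    unfold minus, plus, opp in I0; simpl in I0. lra. }
  assert (I2 := RInt_circle_le (fun y => q s y) (M + e / 2) (Xq s Hs)).
  lapply I2; clear I2; [intros I2|].
  - assert (I3 : (Re (f 0) - e / 2) * (2 * PI) <= RInt (fun y => q a y) 0 (2 * PI)).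
    { assert (J := RInt_circle_le (fun y => - q a y) (- (Re (f 0) - e / 2))).
      rewrite (RInt_opp (fun y => q a y)) in J by (apply Xq; lra).
      unfold opp in J; simpl in J.
      lapply J; clear J; [intros J|apply (ex_RInt_opp (fun y => q a y)), Xq; lra].
      lapply J; clear J; [intros J; lra|].
      intros y. unfold q, G.
      assert (Q : Cmod (f (cexp (a, y)) - f 0) < e / 2).
      { assert (exp a < 1) by (rewrite <- exp_0; apply exp_increasing; lra).
        apply K0.
        - unfold closed_disc. rewrite Cmod_cexp. simpl. lra.
        - replace (cexp (a, y) - 0)%C with (cexp (a, y)) by ring. rewrite Cmod_cexp. exact Had. }
      assert (Q' := re_le_Cmod (f (cexp (a, y)) - f 0)).
      assert (Q2 : Rabs (Re (f (cexp (a, y)) - f 0)) < e / 2) by lra.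
      apply Rabs_def2 in Q2. unfold Cminus, Cplus, Copp in Q2; simpl in Q2.
      unfold Re in *; simpl in *. lra. }
    apply Rmult_le_reg_r with (2 * PI); [lra|]. lra.
  - intros x. unfold q. eapply Rle_trans; [apply Rle_abs|].
    eapply Rle_trans; [apply re_le_Cmod|]. apply (Ks x).
Qed.

(** * Blaschke factors as automorphisms of the disc *)

Definition bfac (a z : C) : C := ((z - a) / (1 - Cconj a * z))%C.

Lemma bfac_den_neq0 a z : Cmod a < 1 -> Cmod z <= 1 -> (1 - Cconj a * z)%C <> 0.
Proof.
  intros Ha Hz h.
  assert (E : (Cconj a * z = 1)%C) by (replace (Cconj a * z)%C with (1 - (1 - Cconj a * z))%C by ring; rewrite h; ring).
  assert (Cmod (Cconj a * z) = 1) by (rewrite E; apply Cmod_1).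
  rewrite Cmod_mult, Cmod_conj in H. pose proof (Cmod_ge_0 a). pose proof (Cmod_ge_0 z). nra.
Qed.

Lemma bfac_identity a z :
  Cmod (1 - Cconj a * z) ^ 2 - Cmod (z - a) ^ 2 = (1 - Cmod a ^ 2) * (1 - Cmod z ^ 2).
Proof.
  rewrite !Cmod2_alt. destruct a as [a1 a2], z as [x y]. simpl. ring.
Qed.

(** The identity above divided by the squared denominator, which is at most [4]. *)
Lemma bfac_sqr_le a z : Cmod a < 1 -> Cmod z <= 1 ->
  Cmod (bfac a z) ^ 2 <= 1 - (1 - Cmod a ^ 2) * (1 - Cmod z ^ 2) / 4.
Proof.
  intros Ha Hz. assert (Hn := bfac_den_neq0 a z Ha Hz).
  unfold bfac. rewrite Cmod_div by auto.
  assert (Hp : 0 < Cmod (1 - Cconj a * z)) by exact (proj1 (Cmod_gt_0 _) Hn).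
  assert (Hu : Cmod (1 - Cconj a * z) <= 2).
  { eapply Rle_trans; [apply Cmod_sub_le|]. rewrite Cmod_1, Cmod_mult, Cmod_conj.
    pose proof (Cmod_ge_0 a). pose proof (Cmod_ge_0 z). nra. }
  pose proof (bfac_identity a z) as E.
  set (m := Cmod (1 - Cconj a * z)) in *. set (n := Cmod (z - a)) in *.
  pose proof (Cmod_ge_0 a). pose proof (Cmod_ge_0 z).
  set (k := (1 - Cmod a ^ 2) * (1 - Cmod z ^ 2)) in *.
  assert (Hk : 0 <= k) by (unfold k; apply Rmult_le_pos; nra).
  apply Rmult_le_reg_r with (m ^ 2); [apply pow_lt; auto|].
  replace ((n / m) ^ 2 * m ^ 2) with (n ^ 2) by (field; lra).
  assert (m ^ 2 <= 4) by nra.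
  assert (k / 4 * m ^ 2 <= k) by nra.
  lra.
Qed.

Lemma bfac_le_1 a z : Cmod a < 1 -> Cmod z <= 1 -> Cmod (bfac a z) <= 1.
Proof.
  intros Ha Hz. pose proof (bfac_sqr_le a z Ha Hz).
  pose proof (Cmod_ge_0 (bfac a z)). pose proof (Cmod_ge_0 a). pose proof (Cmod_ge_0 z).
  assert (0 <= (1 - Cmod a ^ 2) * (1 - Cmod z ^ 2)) by (apply Rmult_le_pos; nra).
  nra.
Qed.

(** The uniform radius [r'], stronger than a pointwise inequality, is what later makes powers of
    peak functions decay uniformly on smaller discs. *)
Lemma bfac_lt_1 a r : Cmod a < 1 -> 0 <= r < 1 ->
  exists r', 0 <= r' < 1 /\ forall z, Cmod z <= r -> Cmod (bfac a z) <= r'.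
Proof.
  intros Ha Hr.
  set (k := (1 - Cmod a ^ 2) * (1 - r ^ 2)).
  pose proof (Cmod_ge_0 a).
  assert (Hk : 0 < k <= 1).
  { assert (Q : forall t, 0 <= t < 1 -> 0 < 1 - t ^ 2 <= 1) by (intros; split; nra).
    assert (Q1 := Q _ (conj H Ha)). assert (Q2 := Q _ Hr). unfold k. clear k Q.
    destruct Q1, Q2. split; [now apply Rmult_lt_0_compat|].
    apply Rle_trans with (1 * 1); [apply Rmult_le_compat|]; lra. }
  exists (sqrt (1 - k / 4)). split.
  - split; [apply sqrt_pos|].
    assert (Q : sqrt (1 - k / 4) < sqrt 1) by (apply sqrt_lt_1; lra). now rewrite sqrt_1 in Q.
  - intros z Hz. pose proof (Cmod_ge_0 z).
    rewrite <- (sqrt_pow2 (Cmod (bfac a z))) by apply Cmod_ge_0.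
    apply sqrt_le_1; [apply pow2_ge_0|lra|].
    eapply Rle_trans; [apply bfac_sqr_le; lra|].
    assert (k <= (1 - Cmod a ^ 2) * (1 - Cmod z ^ 2)).
    { unfold k. apply Rmult_le_compat_l; nra. }
    lra.
Qed.

Lemma bfac_circle a z : Cmod a < 1 -> Cmod z = 1 -> Cmod (bfac a z) = 1.
Proof.
  intros Ha Hz. assert (Hn := bfac_den_neq0 a z Ha ltac:(lra)).
  assert (Hp : 0 < Cmod (1 - Cconj a * z)) by exact (proj1 (Cmod_gt_0 _) Hn).
  unfold bfac. rewrite Cmod_div by auto.
  pose proof (bfac_identity a z) as E. rewrite Hz in E.
  assert (Cmod (z - a) = Cmod (1 - Cconj a * z)).
  { apply Rsqr_inj; try apply Cmod_ge_0. unfold Rsqr. lra. }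
  rewrite H. field. lra.
Qed.

Lemma bfac_disc_alg a : Cmod a < 1 -> disc_alg (bfac a).
Proof.
  intros Ha. apply (disc_alg_div (fun z => z - a)%C (fun z => 1 - Cconj a * z)%C).
  - intros z Hz. now apply bfac_den_neq0.
  - apply disc_alg_minus; [apply disc_alg_id|apply disc_alg_const].
  - apply disc_alg_minus; [apply disc_alg_const|].
    apply disc_alg_mult; [apply disc_alg_const|apply disc_alg_id].
Qed.

(** A constant of modulus [1] rotates [f 0] onto the positive axis, where real part and modulus
    coincide. *)
Lemma Cmod_center_le f M : disc_alg f ->
  (forall z, Cmod z = 1 -> Cmod (f z) <= M) -> Cmod (f 0) <= M.
Proof.
  intros Hf HM. destruct (Req_dec (Cmod (f 0)) 0) as [E|E].
  { rewrite E. eapply Rle_trans; [apply Cmod_ge_0|apply (HM 1), Cmod_1]. }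
  pose proof (Cmod_ge_0 (f 0)).
  set (c := (Cconj (f 0) / Cmod (f 0))%C).
  assert (Hm0 : RtoC (Cmod (f 0)) <> 0) by (intros h; apply RtoC_inj in h; auto).
  assert (Hc : Cmod c = 1).
  { unfold c. rewrite Cmod_div by auto. rewrite Cmod_conj, Cmod_R, Rabs_pos_eq by auto. field; auto. }
  assert (K := re_center_le (fun z => c * f z)%C M).
  lapply K; clear K; [intros K|apply disc_alg_mult; auto; apply disc_alg_const].
  lapply K; clear K; [intros K|intros z Hz; rewrite Cmod_mult, Hc, Rmult_1_l; auto].
  replace (c * f 0)%C with (RtoC (Cmod (f 0))) in K; [exact K|].
  unfold c. transitivity ((f 0 * Cconj (f 0)) / Cmod (f 0))%C; [|field; auto].
  rewrite <- Cmod2_conj, RtoC_pow. field; auto.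
Qed.

(** Precomposition with the automorphism that sends [0] to [z] and preserves the circle reduces the
    bound at [z] to the bound at the centre. *)
Lemma max_principle f M : disc_alg f ->
  (forall z, Cmod z = 1 -> Cmod (f z) <= M) ->
  forall z, Cmod z <= 1 -> Cmod (f z) <= M.
Proof.
  intros Hf HM z Hz. destruct (Req_dec (Cmod z) 1) as [|E]; [auto|].
  assert (Hz' : Cmod (- z) < 1) by (rewrite Cmod_opp; lra).
  assert (K := Cmod_center_le (fun y => f (bfac (- z) y)) M).
  cbv beta in K. replace (bfac (- z) 0) with z in K.
  - apply K.
    + apply disc_alg_comp; auto.
      * now apply bfac_disc_alg.
      * intros y Hy. destruct (bfac_lt_1 (- z) (Cmod y) Hz') as (r' & Hr' & Q).
        { split; [apply Cmod_ge_0|auto]. }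
        specialize (Q y (Rle_refl _)). lra.
      * intros y Hy. now apply bfac_le_1.
    + intros y Hy. apply HM. now apply bfac_circle.
  - unfold bfac. field.
Qed.

(** The maximum principle moves the search for large values to the circle, where cluster points are
    at hand. *)
Lemma disc_alg_bounded f : disc_alg f -> exists M, forall z, Cmod z <= 1 -> Cmod (f z) <= M.
Proof.
  intros Hf. apply NNPP. intros N.
  assert (Hu : forall n : nat, {u : C | Cmod u = 1 /\ INR n < Cmod (f u)}).
  { intros n. apply constructive_indefinite_description. apply NNPP. intros K. apply N.
    exists (INR n). apply max_principle; auto. intros z Hz. apply Rnot_lt_le. intros Q. apply K. eauto. }
  destruct (circle_compact (fun n => proj1_sig (Hu n))) as (t & Ht & A).
  { intros n. apply (proj2_sig (Hu n)). }
  destruct (proj2 Hf t ltac:(lra) 1 ltac:(lra)) as (d & Hd & K).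
  destruct (INR_archimed 1 (Cmod (f t) + 1)) as (N1 & HN1); [lra|]. rewrite Rmult_1_r in HN1.
  destruct (A d N1 Hd) as (n & Hn & L). destruct (Hu n) as (u & Hu1 & Hu2). simpl in L.
  specialize (K u ltac:(unfold closed_disc; lra) L).
  pose proof (Cmod_le_sub (f u) (f t)). apply le_INR in Hn. lra.
Qed.

Lemma le_supnorm_disc_alg f z : disc_alg f -> Cmod z <= 1 -> Cmod (f z) <= supnorm f.
Proof.
  intros Hf Hz. destruct (disc_alg_bounded f Hf) as (M & HM). now apply (le_supnorm f M).
Qed.

Lemma supnorm_attained f : disc_alg f -> exists t, Cmod t = 1 /\ Cmod (f t) = supnorm f.
Proof.
  intros Hf.
  assert (Hu : forall n : nat, {u : C | Cmod u = 1 /\ supnorm f - / (INR n + 1) < Cmod (f u)}).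
  { intros n. apply constructive_indefinite_description. apply NNPP. intros K.
    assert (0 < / (INR n + 1)) by (apply Rinv_0_lt_compat; pose proof (pos_INR n); lra).
    assert (supnorm f <= supnorm f - / (INR n + 1)); [|lra].
    apply supnorm_le. apply max_principle; auto.
    intros z Hz. apply Rnot_lt_le. intros Q. apply K. eauto. }
  destruct (circle_compact (fun n => proj1_sig (Hu n))) as (t & Ht & A).
  { intros n. apply (proj2_sig (Hu n)). }
  exists t. split; auto. apply Rle_antisym.
  { apply le_supnorm_disc_alg; auto; lra. }
  apply le_epsilon. intros e He.
  destruct (proj2 Hf t ltac:(lra) (e / 2) ltac:(lra)) as (d & Hd & K).
  destruct (archimed_cor1 (e / 2) ltac:(lra)) as (N1 & HN1 & HN1').
  destruct (A d N1 Hd) as (n & Hn & L). destruct (Hu n) as (u & Hu1 & Hu2). simpl in L.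
  specialize (K u ltac:(unfold closed_disc; lra) L).
  pose proof (Cmod_le_sub (f u) (f t)).
  assert (0 < INR N1 <= INR n) by (split; [apply lt_0_INR|apply le_INR]; auto).
  assert (/ (INR n + 1) < / INR N1) by (apply Rinv_lt_contravar; nra). lra.
Qed.

(** * Blaschke products and their circle lifts *)

Section Blaschke.
Variables (theta : R) (a : list C).
Hypothesis Ha : forall c, In c a -> Cmod c < 1.

Lemma blaschke_cons th c l z : blaschke th (c :: l) z = (bfac c z * blaschke th l z)%C.
Proof. unfold blaschke, bfac. simpl. ring. Qed.

Lemma blaschke_nil th z : blaschke th nil z = cis th.
Proof. unfold blaschke, cis. simpl. ring. Qed.

Lemma blaschke_disc_alg : disc_alg (blaschke theta a).
Proof.
  revert Ha. induction a as [|c l IH]; intros Hl.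
  - apply disc_alg_ext with (fun _ => cis theta); [|apply disc_alg_const].
    intros; now rewrite blaschke_nil.
  - apply disc_alg_ext with (fun z => bfac c z * blaschke theta l z)%C.
    { intros; now rewrite blaschke_cons. }
    apply disc_alg_mult; [apply bfac_disc_alg|apply IH]; intros; apply Hl; simpl; auto.
Qed.

Lemma blaschke_circle z : Cmod z = 1 -> Cmod (blaschke theta a z) = 1.
Proof.
  intros Hz. revert Ha. induction a as [|c l IH]; intros Hl.
  - rewrite blaschke_nil. apply Cmod_cis.
  - rewrite blaschke_cons, Cmod_mult, bfac_circle, IH; auto; [ring| |]; intros; apply Hl; simpl; auto.
Qed.

Lemma blaschke_le_1 z : Cmod z <= 1 -> Cmod (blaschke theta a z) <= 1.
Proof.
  apply (max_principle _ 1); [apply blaschke_disc_alg|].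
  intros y Hy. rewrite blaschke_circle; auto; lra.
Qed.

End Blaschke.

Lemma blaschke_lt_1 theta a r : (forall c, In c a -> Cmod c < 1) -> (1 <= length a)%nat ->
  0 <= r < 1 ->
  exists r', 0 <= r' < 1 /\ forall z, Cmod z <= r -> Cmod (blaschke theta a z) <= r'.
Proof.
  intros Ha Hl Hr. destruct a as [|c l]; [simpl in Hl; lia|].
  destruct (bfac_lt_1 c r (Ha c (or_introl eq_refl)) Hr) as (r' & Hr' & K).
  exists r'. split; auto. intros z Hz. rewrite blaschke_cons, Cmod_mult.
  specialize (K z Hz).
  assert (L := blaschke_le_1 theta l (fun y Hy => Ha y (or_intror Hy)) z ltac:(lra)).
  pose proof (Cmod_ge_0 (bfac c z)). pose proof (Cmod_ge_0 (blaschke theta l z)). nra.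
Qed.

(** * Lifting one Blaschke factor to the line *)

Definition qre (a : C) x := 1 - Re a * cos x - Im a * sin x.
Definition qim (a : C) x := - (Re a * sin x - Im a * cos x).
(** Put [q = 1 - conj a * z]. On the circle [z - a = z * conj q], so the factor is [z * conj q / q],
    of argument [x - 2 arg q]. As [Re q > 0], the arctangent is a global continuous branch of
    [arg q]. *)
Definition lift1 (a : C) x := x - 2 * atan (qim a x / qre a x).

Lemma qre_qim a x : (qre a x, qim a x) = (1 - Cconj a * cis x)%C.
Proof.
  destruct a as [u v]. unfold qre, qim, cis, Cconj, Cminus, Cplus, Copp, Cmult. simpl.
  f_equal; ring.
Qed.

Lemma qre_pos a x : Cmod a < 1 -> 0 < qre a x.
Proof.
  intros Ha.
  assert (E : qre a x = 1 - Re (Cconj a * cis x)%C).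
  { change (qre a x) with (Re (qre a x, qim a x)). rewrite qre_qim. reflexivity. }
  rewrite E. assert (K := re_le_Cmod (Cconj a * cis x)).
  rewrite Cmod_mult, Cmod_conj, Cmod_cis in K. pose proof (Rle_abs (Re (Cconj a * cis x))). lra.
Qed.

Lemma lift1_correct a x : Cmod a < 1 -> bfac a (cis x) = cis (lift1 a x).
Proof.
  intros Ha. assert (Hu := qre_pos a x Ha).
  assert (Hq := bfac_den_neq0 a (cis x) Ha ltac:(rewrite Cmod_cis; lra)).
  set (q := (1 - Cconj a * cis x)%C) in *.
  set (A := atan (qim a x / qre a x)).
  assert (E : exists m : R, m <> 0 /\ q = (m * cis A)%C).
  { set (t := qim a x / qre a x) in *. unfold A.
    assert (Hs : 0 < sqrt (1 + t²)) by (apply sqrt_lt_R0; pose proof (Rle_0_sqr t); lra).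
    exists (qre a x * sqrt (1 + t²)). split.
    { apply Rmult_integral_contrapositive; lra. }
    unfold q. rewrite <- qre_qim. unfold cis. rewrite cos_atan, sin_atan.
    assert (Et : qim a x = t * qre a x) by (unfold t; field; lra).
    rewrite Et. set (S := sqrt (1 + t²)) in *. clearbody S t.
    unfold Cmult; simpl. f_equal; field; lra. }
  destruct E as (m & Hm & E).
  assert (Hm' : RtoC m <> 0) by (intros h; apply RtoC_inj in h; auto).
  assert (HA : cis A <> 0).
  { intros h. assert (Cmod (cis A) = 0) by (rewrite h; apply Cmod_0). rewrite Cmod_cis in H. lra. }
  assert (Ec : (cis x - a = cis x * Cconj q)%C).
  { assert (Eq : Cconj q = (1 - a * Cconj (cis x))%C).
    { unfold q. destruct a as [a1 a2], (cis x) as [c1 c2].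
      unfold Cconj, Cminus, Cplus, Copp, Cmult, RtoC; simpl. f_equal; ring. }
    rewrite Eq, <- cis_opp.
    replace (cis x * (1 - a * cis (- x)))%C with (cis x - a * (cis x * cis (- x)))%C by ring.
    rewrite <- cis_plus, Rplus_opp_r, cis_0. ring. }
  unfold bfac. fold q. rewrite Ec.
  assert (Ecq : Cconj q = (m * cis (- A))%C).
  { rewrite E, cis_opp. destruct (cis A) as [c1 c2].
    unfold Cconj, Cmult, RtoC; simpl. f_equal; ring. }
  rewrite Ecq, E. unfold lift1. fold A.
  replace (x - 2 * A) with (x + (- A + - A)) by ring. rewrite !cis_plus.
  assert (Hi : (cis (- A) * cis A = 1)%C) by (rewrite <- cis_plus, Rplus_opp_l; apply cis_0).
  transitivity (cis x * (cis (- A) * (cis (- A) * cis A)) / cis A)%C; [rewrite Hi; field; auto|field; auto].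
Qed.

Lemma lift1_period a x : lift1 a (x + 2 * PI) = lift1 a x + 2 * PI.
Proof.
  unfold lift1, qim, qre. rewrite cos_plus, sin_plus, cos_2PI, sin_2PI.
  rewrite !Rmult_1_r, !Rmult_0_r, Rminus_0_r, Rplus_0_r. ring.
Qed.

(** The derivative is the Poisson kernel of [a] at the point [cis x]; its positivity makes the lift
    increasing. *)
Lemma lift1_derive a x : Cmod a < 1 ->
  is_derive (lift1 a) x ((1 - Cmod a ^ 2) / (qre a x ^ 2 + qim a x ^ 2)).
Proof.
  intros Ha. assert (Hu := qre_pos a x Ha). rewrite Cmod2_alt.
  unfold lift1, qre, qim in *. auto_derive; [lra|].
  pose proof (sin2_cos2 x) as S. unfold Rsqr in S.
  set (c := cos x) in *. set (s := sin x) in *.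
  set (u := 1 - Re a * c - Im a * s) in *.
  set (v := - (Re a * s - Im a * c)).
  replace (1 + - (Re a * c) + - (Im a * s)) with u by (unfold u; ring).
  replace (- (Re a * s + - (Im a * c))) with v by (unfold v; ring).
  assert (0 < u ^ 2) by (apply pow_lt; lra). assert (0 <= v ^ 2) by apply pow2_ge_0.
  assert (E : 2 * u - u ^ 2 - v ^ 2 = 1 - (Re a ^ 2 + Im a ^ 2)).
  { unfold u, v. replace (Re a ^ 2 + Im a ^ 2) with ((Re a ^ 2 + Im a ^ 2) * (s * s + c * c)) by (rewrite S; ring).
    ring. }
  rewrite <- E.
  field_simplify_eq; [|split; nra].
  unfold v, u. nra.
Qed.

Lemma lift1_incr a x y : Cmod a < 1 -> x < y -> lift1 a x < lift1 a y.
Proof.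
  intros Ha Hxy.
  destruct (MVT_gen (lift1 a) x y (fun t => (1 - Cmod a ^ 2) / (qre a t ^ 2 + qim a t ^ 2))) as (c & Hc & E).
  { intros t _. now apply lift1_derive. }
  { intros t _. apply derivable_continuous_pt. exists ((1 - Cmod a ^ 2) / (qre a t ^ 2 + qim a t ^ 2)).
    apply is_derive_Reals. now apply lift1_derive. }
  assert (0 < (1 - Cmod a ^ 2) / (qre a c ^ 2 + qim a c ^ 2)).
  { apply Rdiv_lt_0_compat.
    - pose proof (Cmod_ge_0 a). nra.
    - pose proof (qre_pos a c Ha). pose proof (pow2_ge_0 (qim a c)). nra. }
  assert (0 < y - x) by lra. nra.
Qed.

Lemma lift1_continuity a : Cmod a < 1 -> continuity (lift1 a).
Proof.
  intros Ha x. apply derivable_continuous_pt. eexists. apply is_derive_Reals. now apply lift1_derive.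
Qed.

Lemma blaschke_lift theta a : (forall c, In c a -> Cmod c < 1) -> (1 <= length a)%nat ->
  exists F : R -> R, continuity F /\ (forall x y, x < y -> F x < F y) /\
    (forall x, F (x + 2 * PI) = F x + INR (length a) * (2 * PI)) /\
    (forall x, blaschke theta a (cis x) = cis (F x)).
Proof.
  intros Ha Hl. destruct a as [|c l]; [simpl in Hl; lia|]. clear Hl. revert c Ha.
  (* The induction starts at one factor, since a constant product has no strictly increasing
     lift. *)
  induction l as [|c' l IH]; intros c Ha.
  - exists (fun x => lift1 c x + theta). assert (Hc : Cmod c < 1) by (apply Ha; simpl; auto).
    repeat split.
    + apply continuity_plus; [now apply lift1_continuity|]. apply continuity_const. intros ? ?; auto.
    + intros x y Hxy. apply Rplus_lt_compat_r. now apply lift1_incr.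
    + intros x. rewrite lift1_period. simpl. ring.
    + intros x. rewrite blaschke_cons, blaschke_nil, lift1_correct, cis_plus; auto.
  - destruct (IH c') as (F & F1 & F2 & F3 & F4). { intros y Hy. apply Ha. now right. }
    assert (Hc : Cmod c < 1) by (apply Ha; simpl; auto).
    exists (fun x => lift1 c x + F x). repeat split.
    + apply continuity_plus; auto. now apply lift1_continuity.
    + intros x y Hxy. apply Rplus_lt_compat; auto. now apply lift1_incr.
    + intros x. rewrite lift1_period, F3.
      change (length (c :: c' :: l)) with (S (length (c' :: l))). rewrite S_INR. ring.
    + intros x. rewrite blaschke_cons, F4, lift1_correct, cis_plus; auto.
Qed.

(** * Peaking functions with prescribed zeros on the circle *)

Lemma Re_inv z : z <> 0 -> Re z = Re (/ z)%C * Cmod z ^ 2.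
Proof.
  intros Hz. assert (Hp : 0 < Cmod z) by exact (proj1 (Cmod_gt_0 _) Hz).
  rewrite Cmod2_alt. assert (0 < Re z ^ 2 + Im z ^ 2) by (rewrite <- Cmod2_alt; now apply pow_lt).
  destruct z as [x y]. unfold Cinv; simpl in *. field. lra.
Qed.

Lemma Re_inv_1_sub_ge z : Cmod z <= 1 -> z <> 1 -> 1 / 2 <= Re (/ (1 - z))%C.
Proof.
  intros Hz Hn. assert (Hn' : (1 - z)%C <> 0) by (apply Csub_neq0; auto).
  assert (Hp : 0 < Cmod (1 - z)) by exact (proj1 (Cmod_gt_0 _) Hn').
  assert (E := Re_inv _ Hn').
  assert (Q : Cmod (1 - z) ^ 2 = 1 - 2 * Re z + Cmod z ^ 2).
  { rewrite !Cmod2_alt. destruct z as [x y]; simpl; ring. }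
  assert (E1 : Re (1 - z) = 1 - Re z) by (destruct z; simpl; ring).
  pose proof (Cmod_ge_0 z).
  assert (0 < Cmod (1 - z) ^ 2) by now apply pow_lt.
  apply Rmult_le_reg_r with (Cmod (1 - z) ^ 2); auto. rewrite <- E, E1. nra.
Qed.

Lemma Re_inv_1_sub_circle z : Cmod z = 1 -> z <> 1 -> Re (/ (1 - z))%C = 1 / 2.
Proof.
  intros Hz Hn. assert (Hn' : (1 - z)%C <> 0) by (apply Csub_neq0; auto).
  assert (Hp : 0 < Cmod (1 - z)) by exact (proj1 (Cmod_gt_0 _) Hn').
  assert (E := Re_inv _ Hn').
  assert (Q : Cmod (1 - z) ^ 2 = 1 - 2 * Re z + Cmod z ^ 2).
  { rewrite !Cmod2_alt. destruct z as [x y]; simpl; ring. }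
  assert (E1 : Re (1 - z) = 1 - Re z) by (destruct z; simpl; ring).
  assert (0 < Cmod (1 - z) ^ 2) by now apply pow_lt.
  apply Rmult_eq_reg_r with (Cmod (1 - z) ^ 2); [|lra]. rewrite <- E, E1, Q, Hz. field.
Qed.

Lemma Cconj_mult_circle (k z : C) : Cmod k = 1 -> (Cconj k * z = 1)%C -> z = k.
Proof.
  intros Hk E. assert (K : (k * Cconj k = 1)%C) by (rewrite <- Cmod2_conj, Hk, RtoC_pow; ring).
  transitivity (k * (Cconj k * z))%C.
  - rewrite Cmult_assoc, K. ring.
  - rewrite E. ring.
Qed.

(** The expansion of [|z - k|^2], in which [|z|^2 <= 1]. The quadratic growth away from [k] is what
    produces a peak at [k]. *)
Lemma Re_1_sub_conj_mult (k z : C) : Cmod k = 1 -> Cmod z <= 1 ->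
  Cmod (z - k) ^ 2 / 2 <= Re (1 - Cconj k * z)%C.
Proof.
  intros Hk Hz.
  assert (Q : Cmod (z - k) ^ 2 = Cmod z ^ 2 + Cmod k ^ 2 - 2 * Re (Cconj k * z)%C).
  { rewrite !Cmod2_alt. destruct z as [x y], k as [u v]; simpl; ring. }
  replace (Re (1 - Cconj k * z)%C) with (1 - Re (Cconj k * z)%C) by reflexivity.
  rewrite Hk in Q. pose proof (Cmod_ge_0 z). nra.
Qed.

Lemma Re_pos_neq0 z : 0 < Re z -> z <> 0.
Proof. intros H h. rewrite h in H. simpl in H. lra. Qed.

(* [s] is the reciprocal of
   [1 + (1 - conj kap z) / eps + sum_(o in F) (1 / (1 - conj o z) - 1 / (1 - conj o kap))];
   every summand has nonnegative real part on the disc, those of the last sum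
   because [Re (1 / (1 - y))] is at least [1/2], with equality on the circle. *)
Definition bump_spec (kap : C) (eps : R) (F : list C) (s : C -> C) : Prop :=
  disc_alg s /\ s kap = 1 /\ (forall o, In o F -> s o = 0) /\
  (forall z, Cmod z <= 1 -> s z = 0 -> In z F) /\
  (forall z, Cmod z <= 1 -> s z <> 0 -> 1 + Cmod (z - kap) ^ 2 / (2 * eps) <= Re (/ s z)%C) /\
  (forall r z z', r < 1 -> Cmod z <= r -> Cmod z' <= r ->
     Cmod (/ s z - / s z') <= (/ eps + INR (length F) / (1 - r) ^ 2) * Cmod (z - z')).

Lemma bump_spec_nil kap eps : Cmod kap = 1 -> 0 < eps -> exists s, bump_spec kap eps nil s.
Proof.
  intros Hk He.
  assert (He' : RtoC eps <> 0) by (intros h; apply RtoC_inj in h; lra).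
  set (D := fun z => (1 + / eps * (1 - Cconj kap * z))%C).
  assert (HD : forall z, Cmod z <= 1 -> 1 + Cmod (z - kap) ^ 2 / (2 * eps) <= Re (D z)).
  { intros z Hz. unfold D. rewrite <- RtoC_inv by lra.
    replace (Re (1 + RtoC (/ eps) * (1 - Cconj kap * z))) with (1 + / eps * Re (1 - Cconj kap * z)%C)
      by (destruct kap as [u v], z as [x y]; simpl; ring).
    assert (K := Re_1_sub_conj_mult kap z Hk Hz).
    assert (0 < / eps) by now apply Rinv_0_lt_compat.
    apply Rplus_le_compat_l.
    replace (Cmod (z - kap) ^ 2 / (2 * eps)) with (/ eps * (Cmod (z - kap) ^ 2 / 2)) by (field; lra).
    apply Rmult_le_compat_l; lra. }
  assert (Hn : forall z, Cmod z <= 1 -> D z <> 0).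
  { intros z Hz. apply Re_pos_neq0. eapply Rlt_le_trans; [|apply HD; auto].
    assert (0 <= Cmod (z - kap) ^ 2 / (2 * eps)).
    { apply Rmult_le_pos; [apply pow2_ge_0|]. left; apply Rinv_0_lt_compat; lra. }
    lra. }
  assert (Hi : forall z, Cmod z <= 1 -> (/ (1 / D z) = D z)%C).
  { intros z Hz. assert (Q := Hn z Hz). field. auto. }
  exists (fun z => 1 / D z)%C. repeat split.
  - intros z Hz. apply cdiff_div; [apply Hn; lra|apply cdiff_const|].
    apply cdiff_plus; [apply cdiff_const|]. apply cdiff_mult; [apply cdiff_const|].
    apply cdiff_minus; [apply cdiff_const|]. apply cdiff_mult; [apply cdiff_const|apply cdiff_id].
  - intros z Hz. apply cont_div; [apply Hn; lra|apply cont_const|].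
    apply cont_plus; [apply cont_const|]. apply cont_mult; [apply cont_const|].
    apply cont_minus; [apply cont_const|]. apply cont_mult; [apply cont_const|apply cont_id].
  - assert (K : (kap * Cconj kap = 1)%C) by (rewrite <- Cmod2_conj, Hk, RtoC_pow; ring).
    unfold D. rewrite (Cmult_comm (Cconj kap)), K.
    replace (1 + / eps * (1 - 1))%C with (RtoC 1) by ring. field.
  - intros o Ho; destruct Ho.
  - intros z Hz h. exfalso. apply (Cmult_neq_0 1 (/ D z)).
    + intros h'; apply RtoC_inj in h'; lra.
    + intros h'. assert (Q : (D z * / D z = 1)%C) by (apply Cinv_r; auto).
      rewrite h' in Q. rewrite Cmult_0_r in Q. apply RtoC_inj in Q. lra.
    + exact h.
  - intros z Hz _. rewrite Hi by auto. now apply HD.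
  - intros r z z' Hr Hz Hz'. rewrite !Hi by lra. unfold D.
    replace (1 + / eps * (1 - Cconj kap * z) - (1 + / eps * (1 - Cconj kap * z')))%C
      with (- (/ eps * Cconj kap * (z - z')))%C by ring.
    rewrite Cmod_opp, !Cmod_mult, Cmod_conj, Hk, <- RtoC_inv, Cmod_R by lra.
    rewrite Rabs_pos_eq by (left; now apply Rinv_0_lt_compat).
    simpl length. simpl INR. unfold Rdiv. rewrite Rmult_0_l. lra.
Qed.

(** The new function is [1 / (1 / s + 1 / L - be)] with the denominators cleared to [s * L / N], so
    that it makes sense at the zeros of [s] and of [L]. [N] does not vanish: at a zero of [s] it
    equals [L], at a zero of [L] it equals [s], these zeros being distinct; elsewhere the sum of
    reciprocals has positive real part. Subtracting [be = 1 / L kap] keeps the value [1] at [kap],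
    and costs only the real part [1/2] that [1 / L] supplies. *)
Lemma bump_spec_cons kap eps F s o : Cmod kap = 1 -> 0 < eps ->
  (forall o, In o F -> Cmod o = 1) -> Cmod o = 1 -> ~ In o F -> o <> kap ->
  bump_spec kap eps F s -> exists s', bump_spec kap eps (o :: F) s'.
Proof.
  intros Hk He HF Ho HoF Hok (S1 & S2 & S3 & S4 & S5 & S6).
  set (L := fun z => (1 - Cconj o * z)%C).
  assert (L0 : forall z, L z = 0 -> z = o).
  { intros z h. apply Cconj_mult_circle; auto.
    replace (Cconj o * z)%C with (1 - L z)%C by (unfold L; ring). rewrite h. ring. }
  assert (Lk : L kap <> 0) by (intros h; apply L0 in h; auto).
  assert (Lo : L o = 0).
  { unfold L. rewrite (Cmult_comm (Cconj o)), <- Cmod2_conj, Ho, RtoC_pow. ring. }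
  set (be := (/ L kap)%C).
  assert (Hbe : Re be = 1 / 2).
  { unfold be, L. apply Re_inv_1_sub_circle.
    - rewrite Cmod_mult, Cmod_conj, Ho, Hk. ring.
    - intros h. apply Cconj_mult_circle in h; auto. }
  assert (HL : forall z, Cmod z <= 1 -> L z <> 0 -> 1 / 2 <= Re (/ L z)%C).
  { intros z Hz h. apply Re_inv_1_sub_ge.
    - rewrite Cmod_mult, Cmod_conj, Ho. lra.
    - intros h'. apply h. unfold L. rewrite h'. ring. }
  assert (Hge : forall z, 0 <= Cmod (z - kap) ^ 2 / (2 * eps)).
  { intros z. apply Rmult_le_pos; [apply pow2_ge_0|]. left; apply Rinv_0_lt_compat; lra. }
  set (N := fun z => (L z + s z * (1 - be * L z))%C).
  assert (HR : forall z, Cmod z <= 1 -> s z <> 0 -> L z <> 0 ->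
     1 + Cmod (z - kap) ^ 2 / (2 * eps) <= Re (/ s z + / L z - be)%C).
  { intros z Hz h1 h2. specialize (S5 z Hz h1). specialize (HL z Hz h2).
    replace (Re (/ s z + / L z - be)) with (Re (/ s z) + Re (/ L z) - Re be) by reflexivity. lra. }
  assert (EN : forall z, s z <> 0 -> L z <> 0 -> N z = (s z * L z * (/ s z + / L z - be))%C).
  { intros z h1 h2. unfold N. field. auto. }
  assert (HN : forall z, Cmod z <= 1 -> N z <> 0).
  { intros z Hz. destruct (excluded_middle_informative (s z = 0)) as [h|h].
    - unfold N. rewrite h. replace (L z + 0 * (1 - be * L z))%C with (L z) by ring.
      intros h'. apply L0 in h'. subst z. apply HoF. now apply S4.
    - destruct (excluded_middle_informative (L z = 0)) as [h'|h'].
      + unfold N. rewrite h'. replace (0 + s z * (1 - be * 0))%C with (s z) by ring. auto.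
      + rewrite EN by auto. apply Cmult_neq_0; [now apply Cmult_neq_0|].
        apply Re_pos_neq0. specialize (HR z Hz h h'). specialize (Hge z). lra. }
  set (s' := fun z => (s z * L z / N z)%C).
  assert (E' : forall z, Cmod z <= 1 -> s z <> 0 -> L z <> 0 -> (/ s' z = / s z + / L z - be)%C).
  { intros z Hz h1 h2. unfold s'. rewrite EN by auto.
    assert (h3 := HN z Hz). rewrite EN in h3 by auto.
    assert (h4 : (/ s z + / L z - be)%C <> 0) by (intros h; apply h3; rewrite h; ring).
    set (u := (/ s z + / L z - be)%C) in *. clearbody u. field. auto. }
  assert (Z' : forall z, Cmod z <= 1 -> s' z = 0 -> s z = 0 \/ L z = 0).
  { intros z Hz h. apply NNPP. intros n. apply not_or_and in n. destruct n as (n1 & n2).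
    assert (h3 := HN z Hz).
    assert (Q : (s' z * N z = s z * L z)%C) by (unfold s'; field; auto).
    rewrite h, Cmult_0_l in Q. symmetry in Q. now apply (Cmult_neq_0 _ _ n1 n2). }
  assert (ZL : disc_alg L).
  { apply disc_alg_minus; [apply disc_alg_const|].
    apply disc_alg_mult; [apply disc_alg_const|apply disc_alg_id]. }
  exists s'. split; [|split; [|split; [|split; [|split]]]].
  - apply disc_alg_div; auto.
    + now apply disc_alg_mult.
    + apply disc_alg_plus; auto. apply disc_alg_mult; auto.
      apply disc_alg_minus; [apply disc_alg_const|].
      apply disc_alg_mult; [apply disc_alg_const|auto].
  - unfold s', N, be. rewrite S2. field. auto.
  - intros o' [<-|Ho'].
    + unfold s'. rewrite Lo. unfold Cdiv. ring.
    + unfold s'. rewrite S3 by auto. unfold Cdiv. ring.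
  - intros z Hz h. destruct (Z' z Hz h) as [h'|h'].
    + right. auto.
    + left. symmetry. auto.
  - intros z Hz h.
    assert (h1 : s z <> 0) by (intros h'; apply h; unfold s'; rewrite h'; unfold Cdiv; ring).
    assert (h2 : L z <> 0) by (intros h'; apply h; unfold s'; rewrite h'; unfold Cdiv; ring).
    rewrite E' by auto. auto.
  - intros r z z' Hr Hz Hz'.
    assert (Sn : forall y, Cmod y <= r -> s y <> 0).
    { intros y Hy h. apply S4 in h; [|lra]. apply HF in h. lra. }
    assert (Ln : forall y, Cmod y <= r -> 1 - r <= Cmod (L y)).
    { intros y Hy. unfold L. pose proof (Cmod_le_sub 1 (Cconj o * y)%C) as Q.
      rewrite Cmod_1, Cmod_mult, Cmod_conj, Ho in Q. lra. }
    assert (Ln' : forall y, Cmod y <= r -> L y <> 0).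
    { intros y Hy h. specialize (Ln y Hy). rewrite h, Cmod_0 in Ln. lra. }
    rewrite !E' by (auto; lra).
    replace (/ s z + / L z - be - (/ s z' + / L z' - be))%C
      with ((/ s z - / s z') + (/ L z - / L z'))%C by ring.
    eapply Rle_trans; [apply Cmod_triangle|].
    specialize (S6 r z z' Hr Hz Hz').
    assert (K : Cmod (/ L z - / L z') <= / (1 - r) ^ 2 * Cmod (z - z')).
    { replace (/ L z - / L z')%C with (Cconj o * (z - z') / (L z * L z'))%C.
      2:{ transitivity ((L z' - L z) / (L z * L z'))%C.
          - f_equal. unfold L. ring.
          - field. auto. }
      rewrite Cmod_div by (apply Cmult_neq_0; auto).
      rewrite !Cmod_mult, Cmod_conj, Ho, Rmult_1_l.
      unfold Rdiv. rewrite Rmult_comm. apply Rmult_le_compat_r; [apply Cmod_ge_0|].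
      assert (A1 := Ln z Hz). assert (A2 := Ln z' Hz').
      assert (0 < (1 - r) ^ 2) by (apply pow_lt; lra).
      apply Rinv_le_contravar; auto. nra. }
    change (length (o :: F)) with (S (length F)). rewrite S_INR.
    replace ((/ eps + (INR (length F) + 1) / (1 - r) ^ 2) * Cmod (z - z'))
      with ((/ eps + INR (length F) / (1 - r) ^ 2) * Cmod (z - z') + / (1 - r) ^ 2 * Cmod (z - z'))
      by (field; lra).
    lra.
Qed.

(** Inside the disc [s] has size of order [eps] while [1 / s] has Lipschitz constant of order
    [1 / eps]; by [s - s' = - s s' (1/s - 1/s')] the function [s] has Lipschitz constant of order
    [eps] again. Hence both the size away from [kap] and the variation on smaller discs can be made
    as small as desired. *)
Lemma bump_exists kap (F : list C) eps :
  Cmod kap = 1 -> (forall o, In o F -> Cmod o = 1) -> NoDup F -> ~ In kap F ->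
  0 < eps <= 1 -> eps * INR (length F) <= 1 ->
  exists s, disc_alg s /\ s kap = 1 /\ (forall o, In o F -> s o = 0) /\
    (forall z, Cmod z <= 1 -> 0 <= Re (s z) /\ Cmod (s z) <= 1 /\
       Cmod (s z) * Cmod (z - kap) ^ 2 <= 2 * eps) /\
    (forall r z z', 0 <= r < 1 -> Cmod z <= r -> Cmod z' <= r ->
       Cmod (s z - s z') <= eps * (8 / (1 - r) ^ 6) * Cmod (z - z')).
Proof.
  intros Hk HF ND HkF He HeF.
  assert (E : exists s, bump_spec kap eps F s).
  { clear HeF. induction F as [|o F IH]; [apply bump_spec_nil; auto; lra|].
    inversion ND; subst.
    destruct IH as (s & Hs); auto; [intros; apply HF; now right|intros h; apply HkF; now right|].
    apply bump_spec_cons with s; auto; [lra| |apply HF; now left|].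
    - intros; apply HF; now right.
    - intros ->. apply HkF; now left. }
  destruct E as (s & S1 & S2 & S3 & S4 & S5 & S6). exists s.
  assert (Hb : forall z, Cmod z <= 1 -> 0 <= Re (s z) /\ Cmod (s z) <= 1 /\
       Cmod (s z) * Cmod (z - kap) ^ 2 <= 2 * eps).
  { intros z Hz. destruct (excluded_middle_informative (s z = 0)) as [h|h].
    - rewrite h, Cmod_0. simpl. lra.
    - specialize (S5 z Hz h). set (d := Cmod (z - kap) ^ 2) in *.
      assert (Hd : 0 <= d) by apply pow2_ge_0.
      assert (Hde : 0 <= d / (2 * eps)) by (apply Rmult_le_pos; auto; left; apply Rinv_0_lt_compat; lra).
      assert (Hp : 0 < Cmod (s z)) by exact (proj1 (Cmod_gt_0 _) h).
      assert (Q := Re_inv _ h).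
      assert (Q2 : Re (/ s z)%C <= / Cmod (s z)).
      { rewrite <- Cmod_inv by auto. eapply Rle_trans; [apply Rle_abs|apply re_le_Cmod]. }
      assert (Q3 : (1 + d / (2 * eps)) * Cmod (s z) <= 1).
      { apply Rle_trans with (/ Cmod (s z) * Cmod (s z)).
        - apply Rmult_le_compat_r; lra.
        - rewrite Rinv_l; lra. }
      split; [|split].
      + rewrite Q. apply Rmult_le_pos; [lra|apply pow2_ge_0].
      + nra.
      + assert (Cmod (s z) * d = (d / (2 * eps) * Cmod (s z)) * (2 * eps)) by (field; lra).
        assert (d / (2 * eps) * Cmod (s z) <= 1) by nra. nra. }
  repeat split; try apply S1; auto; try (now apply Hb).
  intros r z z' Hr Hz Hz'.
  assert (Sn : forall y, Cmod y <= r -> s y <> 0).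
  { intros y Hy h. apply S4 in h; [|lra]. apply HF in h. lra. }
  set (D := 1 - r). assert (HD : 0 < D <= 1) by (unfold D; lra).
  assert (Sb : forall y, Cmod y <= r -> Cmod (s y) <= 2 * eps / D ^ 2).
  { intros y Hy. destruct (Hb y ltac:(lra)) as (_ & _ & Q).
    assert (D <= Cmod (y - kap)).
    { pose proof (Cmod_le_sub kap y) as T. rewrite Hk, Cmod_sub_sym in T. unfold D. lra. }
    assert (0 < D ^ 2) by (apply pow_lt; lra).
    apply Rmult_le_reg_r with (D ^ 2); auto.
    replace (2 * eps / D ^ 2 * D ^ 2) with (2 * eps) by (field; lra).
    eapply Rle_trans; [|apply Q]. apply Rmult_le_compat_l; [apply Cmod_ge_0|]. nra. }
  assert (h1 := Sn z Hz). assert (h2 := Sn z' Hz').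
  replace (s z - s z')%C with (- (s z * s z' * (/ s z - / s z')))%C by (field; auto).
  rewrite Cmod_opp, !Cmod_mult.
  specialize (S6 r z z' ltac:(lra) Hz Hz'). fold D in S6.
  set (n := INR (length F)) in *. assert (Hn : 0 <= n) by apply pos_INR.
  assert (Q1 : Cmod (s z) * Cmod (s z') <= 2 * eps / D ^ 2 * (2 * eps / D ^ 2))
    by (apply Rmult_le_compat; auto using Cmod_ge_0).
  eapply Rle_trans.
  { apply Rmult_le_compat; [|apply Cmod_ge_0|apply Q1|apply S6].
    apply Rmult_le_pos; apply Cmod_ge_0. }
  rewrite <- Rmult_assoc. apply Rmult_le_compat_r; [apply Cmod_ge_0|].
  assert (HD6 : 0 < D ^ 6) by (apply pow_lt; lra).
  apply Rmult_le_reg_r with (D ^ 6); auto.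
  replace (2 * eps / D ^ 2 * (2 * eps / D ^ 2) * (/ eps + n / D ^ 2) * D ^ 6)
    with (4 * eps * (D ^ 2 + eps * n)) by (field; lra).
  replace (eps * (8 / D ^ 6) * D ^ 6) with (4 * eps * 2) by (field; lra).
  (* Here [eps * length F <= 1] makes the constant [8] independent of the number of prescribed
     zeros. *)
  apply Rmult_le_compat_l; [lra|].
  assert (D ^ 2 <= 1) by nra. lra.
Qed.

(** * Dominated complex series *)

Fixpoint csum (u : nat -> C) (n : nat) : C :=
  match n with O => 0 | S n => (csum u n + u n)%C end.

Definition cconv (u : nat -> C) (l : C) : Prop :=
  forall e, 0 < e -> exists N, forall n, (N <= n)%nat -> Cmod (u n - l) < e.

Lemma cconv_unique u l l' : cconv u l -> cconv u l' -> l = l'.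
Proof.
  intros H H'. apply Csub_eq_0. apply Rle_antisym; [|apply Cmod_ge_0].
  apply le_epsilon. intros e He.
  destruct (H (e / 2) ltac:(lra)) as (N & K). destruct (H' (e / 2) ltac:(lra)) as (N' & K').
  specialize (K (max N N') ltac:(lia)). specialize (K' (max N N') ltac:(lia)).
  pose proof (Cmod_sub_triangle l (u (max N N')) l').
  rewrite (Cmod_sub_sym l (u _)) in H0. lra.
Qed.

Lemma half_pow_small c e : 0 < e -> exists N, forall n, (N <= n)%nat -> c * (/2) ^ n < e.
Proof.
  intros He.
  set (c' := Rabs c + 1). assert (Hc : 0 < c') by (unfold c'; pose proof (Rabs_pos c); lra).
  destruct (pow_lt_1_zero (/2) ltac:(rewrite Rabs_pos_eq; lra) (e / c')) as (N & HN).
  { now apply Rdiv_lt_0_compat. }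
  exists N. intros n Hn. specialize (HN n Hn). rewrite Rabs_pos_eq in HN by (apply pow_le; lra).
  apply Rmult_lt_compat_r with (r := c') in HN; auto.
  replace (e / c' * c') with e in HN by (field; lra).
  assert (0 < (/2) ^ n) by (apply pow_lt; lra).
  pose proof (Rle_abs c). unfold c' in HN. nra.
Qed.

Lemma csum_diff_le u c K : (forall k, (K <= k)%nat -> Cmod (u k) <= c * (/2) ^ k) ->
  forall n d, (K <= n)%nat ->
    Cmod (csum u (n + d) - csum u n) <= 2 * c * ((/2) ^ n - (/2) ^ (n + d)).
Proof.
  intros H n d Hn. induction d.
  - rewrite Nat.add_0_r, Cmod_sub_self. lra.
  - rewrite Nat.add_succ_r. simpl csum.
    replace (csum u (n + d) + u (n + d)%nat - csum u n)%C
      with ((csum u (n + d) - csum u n) + u (n + d)%nat)%C by ring.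
    eapply Rle_trans; [apply Cmod_triangle|].
    specialize (H (n + d)%nat ltac:(lia)). simpl pow. lra.
Qed.

(** Domination is asked only from the index [K] on, since near an interpolation point the first
    terms of the series are not small. *)
Lemma cseries_dominated u c K : (forall k, (K <= k)%nat -> Cmod (u k) <= c * (/2) ^ k) ->
  exists l, cconv (csum u) l /\ forall n, (K <= n)%nat -> Cmod (l - csum u n) <= 2 * c * (/2) ^ n.
Proof.
  intros H. assert (D := csum_diff_le u c K H).
  assert (Hc : 0 <= c).
  { specialize (H K (le_n _)). pose proof (Cmod_ge_0 (u K)).
    assert (0 < (/2) ^ K) by (apply pow_lt; lra). nra. }
  assert (D' : forall n m, (K <= n)%nat -> (n <= m)%nat -> Cmod (csum u m - csum u n) <= 2 * c * (/2) ^ n).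
  { intros n m Hn Hm. replace m with (n + (m - n))%nat by lia.
    eapply Rle_trans; [apply D; auto|]. assert (0 < (/2) ^ (n + (m - n))) by (apply pow_lt; lra). nra. }
  assert (Cau : forall e, 0 < e -> exists N, forall n m, (N <= n)%nat -> (N <= m)%nat ->
     Cmod (csum u n - csum u m) < e).
  { intros e He. destruct (half_pow_small (2 * c) e He) as (N & HN).
    exists (max N K).
    assert (W : forall n m, (max N K <= n)%nat -> (n <= m)%nat -> Cmod (csum u n - csum u m) < e).
    { intros n m Hn Hm. rewrite Cmod_sub_sym. eapply Rle_lt_trans; [apply D'; lia|]. apply HN. lia. }
    intros n m Hn Hm. destruct (Nat.le_ge_cases n m); [auto|].
    rewrite Cmod_sub_sym. auto. }
  destruct (Rcomplete.R_complete (fun n => Re (csum u n))) as (x & Hx).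
  { intros e He. destruct (Cau e He) as (N & HN). exists N. intros n m Hn Hm.
    unfold Rdist. eapply Rle_lt_trans; [apply (re_le_Cmod (csum u n - csum u m))|]. auto. }
  destruct (Rcomplete.R_complete (fun n => Im (csum u n))) as (y & Hy).
  { intros e He. destruct (Cau e He) as (N & HN). exists N. intros n m Hn Hm.
    unfold Rdist. eapply Rle_lt_trans; [apply (Im_le_Cmod (csum u n - csum u m))|]. auto. }
  assert (Cv : cconv (csum u) (x, y)).
  { intros e He. destruct (Hx (e / 2) ltac:(lra)) as (N1 & K1). destruct (Hy (e / 2) ltac:(lra)) as (N2 & K2).
    exists (max N1 N2). intros n Hn. eapply Rle_lt_trans; [apply Cmod_le_Rabs|].
    specialize (K1 n ltac:(lia)). specialize (K2 n ltac:(lia)). unfold Rdist in *.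
    simpl. unfold Re, Im in *. unfold Rminus in *. lra. }
  exists (x, y). split; auto.
  intros n Hn. apply le_epsilon. intros e He.
  destruct (Cv e He) as (N & HN). specialize (HN (max N n) ltac:(lia)).
  specialize (D' n (max N n) Hn ltac:(lia)).
  pose proof (Cmod_sub_triangle (x, y) (csum u (max N n)) (csum u n)).
  rewrite (Cmod_sub_sym (x, y) (csum u (max N n))) in H0. lra.
Qed.

Lemma csum_ext u v n : (forall k, (k < n)%nat -> u k = v k) -> csum u n = csum v n.
Proof.
  induction n; intros H; simpl; auto. rewrite IHn, H; auto.
Qed.

Lemma csum_minus u v n : csum (fun k => u k - v k)%C n = (csum u n - csum v n)%C.
Proof. induction n; simpl; [ring|]. rewrite IHn. ring. Qed.

Lemma csum_zero (u : nat -> C) n : (forall k, u k = 0) -> csum u n = 0.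
Proof. intros H. induction n; simpl; auto. rewrite IHn, H. ring. Qed.

Lemma csum_Re_le u n d : (forall k, 0 <= Re (u k)) -> Re (csum u n) <= Re (csum u (n + d)).
Proof.
  intros H. induction d; [rewrite Nat.add_0_r; lra|].
  rewrite Nat.add_succ_r. simpl csum.
  replace (Re (csum u (n + d) + u (n + d)%nat)) with (Re (csum u (n + d)) + Re (u (n + d)%nat)) by reflexivity.
  specialize (H (n + d)%nat). lra.
Qed.

Lemma cconv_Re_ge u l n : (forall k, 0 <= Re (u k)) -> cconv (csum u) l -> Re (csum u n) <= Re l.
Proof.
  intros H Hl. apply le_epsilon. intros e He.
  destruct (Hl e He) as (N & HN). specialize (HN (n + N)%nat ltac:(lia)).
  pose proof (csum_Re_le u n N H).
  pose proof (re_le_Cmod (csum u (n + N) - l)).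
  assert (Q : Rabs (Re (csum u (n + N) - l)) < e) by lra. apply Rabs_def2 in Q.
  replace (Re (csum u (n + N) - l)) with (Re (csum u (n + N)) - Re l) in Q by reflexivity. lra.
Qed.

Lemma cconv_eventually_const u l N : (forall n, (N <= n)%nat -> u n = u N) -> cconv u l -> l = u N.
Proof.
  intros H Hl. apply cconv_unique with u; auto.
  intros e He. exists N. intros n Hn. rewrite H by auto. now rewrite Cmod_sub_self.
Qed.

Lemma cdiff_slope_le f z c r : 0 < r ->
  (forall y, Cmod (y - z) < r -> Cmod (f y - f z) <= c * Cmod (y - z)) ->
  forall s, cont_within everywhere s z -> (forall y, (f y - f z = (y - z) * s y)%C) ->
  Cmod (s z) <= c.
Proof.
  intros Hr H s Hs Hf. apply le_epsilon. intros e He.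
  destruct (Hs e He) as (d & Hd & K).
  set (h := Rmin d r / 2). assert (Hh : 0 < h < Rmin d r).
  { assert (0 < Rmin d r) by now apply Rmin_glb_lt. unfold h; lra. }
  assert (Hy : Cmod (z + h - z)%C = h).
  { replace (z + h - z)%C with (RtoC h) by ring. rewrite Cmod_R, Rabs_pos_eq; lra. }
  assert (Hd' := Rmin_l d r). assert (Hr' := Rmin_r d r).
  specialize (H (z + h)%C ltac:(lra)). specialize (K (z + h)%C I ltac:(lra)).
  rewrite Hf, Cmod_mult, Hy in H.
  assert (Cmod (s (z + h)%C) <= c) by (apply Rmult_le_reg_l with h; lra).
  pose proof (Cmod_le_sub (s z) (s (z + h)%C)). rewrite Cmod_sub_sym in H1. lra.
Qed.

(** Lipschitz bounds with summable constants take the place of Cauchy's estimates: they dominate the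
    slopes, so the slope of a long partial sum approximates that of the whole series. This is why
    the bumps come with a Lipschitz clause. *)
Lemma cdiff_series (u : nat -> C -> C) (l : C -> C) z r c : 0 < r ->
  (forall k, cdiff (u k) z) ->
  (forall k y, Cmod (y - z) < r -> Cmod (u k y - u k z) <= c * (/2) ^ k * Cmod (y - z)) ->
  (forall y, Cmod (y - z) < r -> cconv (csum (fun k => u k y)) (l y)) ->
  cdiff l z.
Proof.
  intros Hr Hu HL Hl.
  assert (Hs : forall k, {s : C -> C | cont_within everywhere s z /\
     (forall y, (u k y - u k z = (y - z) * s y)%C)}).
  { intros k. apply constructive_indefinite_description. apply Hu. }
  set (s := fun k => proj1_sig (Hs k)).
  assert (Sc : forall k, cont_within everywhere (s k) z) by (intros k; apply (proj2_sig (Hs k))).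
  assert (Se : forall k y, (u k y - u k z = (y - z) * s k y)%C) by (intros k; apply (proj2_sig (Hs k))).
  assert (Sb : forall k, (0 <= k)%nat -> Cmod (s k z) <= c * (/2) ^ k).
  { intros k _. apply (cdiff_slope_le (u k) z _ r); auto. }
  destruct (cseries_dominated _ _ _ Sb) as (L & CL & BL).
  assert (Hzz : Cmod (z - z) < r) by (rewrite Cmod_sub_self; auto).
  apply cdiff_iff_eps. exists L. intros e He.
  destruct (half_pow_small (2 * c) (e / 3) ltac:(lra)) as (n & Hn). specialize (Hn n (le_n _)).
  assert (Hfin : exists S, cont_within everywhere S z /\
     (forall y, (csum (fun k => u k y) n - csum (fun k => u k z) n = (y - z) * S y)%C) /\
     S z = csum (fun k => s k z) n).
  { exists (fun y => csum (fun k => s k y) n). split; [|split; auto]; clear Hn.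
    - induction n; simpl; [apply cont_const|now apply cont_plus].
    - intros y. induction n; simpl; [ring|].
      replace (csum (fun k => u k y) n + u n y - (csum (fun k => u k z) n + u n z))%C
        with ((csum (fun k => u k y) n - csum (fun k => u k z) n) + (u n y - u n z))%C by ring.
      rewrite IHn, Se. ring. }
  destruct Hfin as (S & CS & ES & SL).
  destruct (CS (e / 3) ltac:(lra)) as (d & Hd & K).
  exists (Rmin d r). split; [now apply Rmin_glb_lt|].
  intros y Hy.
  assert (Hyd := Rlt_le_trans _ _ _ Hy (Rmin_l _ _)).
  assert (Hyr := Rlt_le_trans _ _ _ Hy (Rmin_r _ _)).
  specialize (K y I Hyd).
  set (m := Cmod (y - z)) in *. assert (Hm : 0 <= m) by apply Cmod_ge_0.
  assert (T : Cmod ((l y - l z) - (csum (fun k => u k y) n - csum (fun k => u k z) n)) <= e / 3 * m).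
  { destruct (cseries_dominated (fun k => u k y - u k z)%C (c * m) 0) as (L' & CL' & BL').
    { intros k _. eapply Rle_trans; [apply HL; auto|]. fold m. lra. }
    assert (EL : L' = (l y - l z)%C).
    { apply cconv_unique with (csum (fun k => u k y - u k z)%C); auto.
      intros e' He'. destruct (Hl y Hyr (e' / 2) ltac:(lra)) as (N1 & K1).
      destruct (Hl z Hzz (e' / 2) ltac:(lra)) as (N2 & K2).
      exists (max N1 N2). intros q Hq. rewrite csum_minus.
      specialize (K1 q ltac:(lia)). specialize (K2 q ltac:(lia)).
      replace (csum (fun k => u k y) q - csum (fun k => u k z) q - (l y - l z))%C
        with ((csum (fun k => u k y) q - l y) - (csum (fun k => u k z) q - l z))%C by ring.
      eapply Rle_lt_trans; [apply Cmod_sub_le|]. lra. }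
    specialize (BL' n ltac:(lia)). rewrite EL, csum_minus in BL'. eapply Rle_trans; [apply BL'|].
    nra. }
  specialize (BL n ltac:(lia)). rewrite ES in T.
  replace (l y - l z - (y - z) * L)%C
    with (((l y - l z) - (y - z) * S y) + ((y - z) * (S y - S z) + (y - z) * (S z - L)))%C by ring.
  eapply Rle_trans; [apply Cmod_triangle|].
  assert (A1 : Cmod ((y - z) * (S y - S z) + (y - z) * (S z - L)) <= m * (e / 3) + m * (e / 3)).
  { eapply Rle_trans; [apply Cmod_triangle|]. rewrite !Cmod_mult. fold m.
    rewrite SL in *. rewrite (Cmod_sub_sym _ L).
    apply Rplus_le_compat; apply Rmult_le_compat_l; lra. }
  lra.
Qed.

(** * Interpolation of moduli on a countable subset of the circle *)

Section Interpolation.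
Variables (o z : nat -> C) (rho : nat -> R) (th : R).
Hypothesis o_circle : forall n, Cmod (o n) = 1.
Hypothesis z_circle : forall n, Cmod (z n) = 1.
Hypothesis o_inj : forall n m, o n = o m -> n = m.
Hypothesis o_isolated : forall n, exists d, 0 < d /\
  forall m, (m <> n -> d <= Cmod (o m - o n)) /\ d <= Cmod (z m - o n).
Hypothesis oz_closed : forall t, Cmod t = 1 -> (forall n, t <> o n) -> (forall n, t <> z n) ->
  exists d, 0 < d /\ forall m, d <= Cmod (o m - t) /\ d <= Cmod (z m - t).
Hypothesis z_repeats : forall m K, exists k, (K <= k)%nat /\ z k = z m.
Hypothesis th_pos : 0 < th.
Hypothesis rho_ge : forall m, 1 + th <= rho m.
Hypothesis rho_infty : forall X, exists M, forall m, (M <= m)%nat -> X <= rho m.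

(* [beta j m] bounds the [j]-th term of the series at [o (m + 2)]: a term peaking at a
   zero may be as large as [1] there, but only for the few [j] allowed by [rho m]. *)
Definition beta_ind (j m : nat) : R := if Rlt_dec (rho m) (INR j + 2 + th) then 0 else 1.
Definition beta (j m : nat) : R := beta_ind j m + th * (/2) ^ (j + 1).

Fixpoint beta_sum (k m : nat) : R :=
  match k with O => 0 | S k => beta_sum k m + beta k m end.

(** The value [1] of [beta_ind] is taken for at most [rho m - 1 - th] indices, and the geometric
    parts add up to less than [th]. The remaining margin is what allows the modulus at [o (m + 2)]
    to be raised to exactly [rho m] when its turn comes. *)
Lemma beta_sum_le k m : beta_sum k m <= rho m - 1.
Proof.
  assert (H : exists s, beta_sum k m = s + th * (1 - (/2) ^ k) /\ s <= INR k /\ s <= rho m - 1 - th).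
  { induction k as [|k (s & E & S1 & S2)].
    - exists 0. simpl. pose proof (rho_ge m). lra.
    - exists (s + beta_ind k m). split; [|split].
      + simpl. rewrite E. unfold beta. rewrite Nat.add_1_r. simpl. field.
      + rewrite S_INR. unfold beta_ind. destruct (Rlt_dec _ _); lra.
      + unfold beta_ind. destruct (Rlt_dec _ _); lra. }
  destruct H as (s & -> & _ & H). assert (0 < (/2) ^ k) by (apply pow_lt; lra). nra.
Qed.

Definition partial_ok (k : nat) (R : C -> C) : Prop :=
  (forall y, Cmod y <= 1 -> 0 <= Re (R y)) /\
  forall m, (k <= m)%nat -> Cmod (R (o (m + 2))) <= beta_sum k m.

(** Term [k] settles the modulus of [1 + R] at [o (k + 2)], adds at least [1] at [z k], and vanishes
    at all earlier [o j], so that settled values are never changed. The shift by [2] leaves [o 0]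
    and [o 1] with sum [0]: these two points are to receive modulus [1]. *)
Definition term_ok (k : nat) (R f : C -> C) : Prop :=
  disc_alg f /\
  (forall y, Cmod y <= 1 -> 0 <= Re (f y)) /\
  1 <= Re (f (z k)) /\
  (forall j, (j < k + 2)%nat -> f (o j) = 0) /\
  Cmod (1 + (R (o (k + 2)%nat) + f (o (k + 2)%nat))) = rho k /\
  (forall m, (k < m)%nat -> Cmod (f (o (m + 2))) <= beta k m) /\
  (forall y d, Cmod y <= 1 -> 0 < d -> d <= Cmod (y - o (k + 2)%nat) -> d <= Cmod (y - z k) ->
     Cmod (f y) <= 4 / d ^ 2 * (/2) ^ k) /\
  (forall r y y', 0 <= r < 1 -> Cmod y <= r -> Cmod y' <= r ->
     Cmod (f y - f y') <= 16 / (1 - r) ^ 6 * (/2) ^ k * Cmod (y - y')).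

(** A point of the right half-plane inside the disc of radius [m] is moved horizontally to the right
    until it meets the circle. *)
Lemma exists_real_shift (c : C) (m : R) : 0 <= Re c -> Cmod c <= m ->
  exists b, 0 <= b <= m /\ Cmod (c + b) = m.
Proof.
  intros Hc Hm. pose proof (Cmod_ge_0 c).
  assert (E := Cmod2_alt c). assert (Q : Cmod c ^ 2 <= m ^ 2) by nra.
  set (q := m ^ 2 - Im c ^ 2). assert (Hq : Re c ^ 2 <= q) by (unfold q; lra).
  assert (Hq0 : 0 <= q) by nra.
  exists (sqrt q - Re c).
  assert (S1 : Re c <= sqrt q) by (rewrite <- (sqrt_pow2 (Re c)) by auto; apply sqrt_le_1; nra).
  assert (S2 : sqrt q <= m).
  { rewrite <- (sqrt_pow2 m) by lra. apply sqrt_le_1; auto; unfold q; nra. }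
  split; [lra|]. apply Cmod_sqr_eq; [lra|].
  replace (Re (c + RtoC (sqrt q - Re c))) with (sqrt q) by (destruct c; simpl; ring).
  replace (Im (c + RtoC (sqrt q - Re c))) with (Im c) by (destruct c; simpl; ring).
  rewrite pow2_sqrt by auto. unfold q. ring.
Qed.

Lemma o_list n : (forall c, In c (map o (seq 0 n)) -> exists j, (j < n)%nat /\ c = o j) /\
  NoDup (map o (seq 0 n)) /\ length (map o (seq 0 n)) = n /\
  (forall j, (j < n)%nat -> In (o j) (map o (seq 0 n))).
Proof.
  split; [|split; [|split]].
  - intros c Hc. apply in_map_iff in Hc. destruct Hc as (j & <- & Hj). apply in_seq in Hj.
    exists j; split; auto; lia.
  - apply Injective_map_NoDup; [intros ? ?; apply o_inj|apply seq_NoDup].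
  - now rewrite length_map, length_seq.
  - intros j Hj. apply in_map. apply in_seq. lia.
Qed.

Lemma finite_min_pos (h : nat -> R) n : (forall m, 0 < h m) ->
  exists d, 0 < d /\ forall m, (m < n)%nat -> d <= h m.
Proof.
  intros H. induction n as [|n (d & Hd & K)].
  - exists 1. split; [lra|]. intros; lia.
  - exists (Rmin d (h n)). split; [apply Rmin_glb_lt; auto|].
    intros m Hm. destruct (Nat.eq_dec m n) as [->|]; [apply Rmin_r|].
    eapply Rle_trans; [apply Rmin_l|]. apply K. lia.
Qed.

Lemma small_eps (c1 c2 c3 t : R) : 0 <= c1 -> 0 <= c2 -> 0 <= c3 -> 0 < t ->
  exists e, 0 < e <= 1 /\ e * c1 <= 1 /\ e * c2 <= t /\ e * c3 <= t.
Proof.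
  intros H1 H2 H3 Ht. set (q := 1 + c1 + c2 + c3). set (m := Rmin 1 t).
  assert (Hm : 0 < m) by (apply Rmin_glb_lt; lra). assert (m <= 1) by apply Rmin_l. assert (m <= t) by apply Rmin_r.
  exists (m / q). assert (Hq : 1 <= q) by (unfold q; lra).
  assert (E : m / q * q = m) by (field; lra).
  assert (P : 0 < m / q) by (apply Rdiv_lt_0_compat; lra).
  set (x := m / q) in *. clearbody x. unfold q in E.
  assert (0 <= x * c1) by (apply Rmult_le_pos; lra).
  assert (0 <= x * c2) by (apply Rmult_le_pos; lra).
  assert (0 <= x * c3) by (apply Rmult_le_pos; lra).
  repeat split; lra.
Qed.

(** The term is [b * s1 + s2]. The bump [s1] peaks at [p = o (k + 2)], and the height [b] comes from
    [exists_real_shift], applicable because [partial_ok] bounds [|1 + R p|] by [rho k]. The bump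
    [s2] peaks at [z k] and vanishes at [p]. Both widths are chosen last, small enough for all
    remaining clauses. *)
Lemma next_term k R : partial_ok k R -> exists f, term_ok k R f.
Proof.
  intros (R1 & R2).
  set (p := o (k + 2)). set (h := (/2) ^ k). assert (Hh : 0 < h) by (apply pow_lt; lra).
  assert (Hp1 : Cmod p <= 1) by (unfold p; rewrite o_circle; lra).
  destruct (exists_real_shift (1 + R p)%C (rho k)) as (b & Hb & Eb).
  { replace (Re (1 + R p)) with (1 + Re (R p)) by reflexivity. specialize (R1 p Hp1). lra. }
  { eapply Rle_trans; [apply Cmod_triangle|]. rewrite Cmod_1.
    pose proof (R2 k (le_n _)) as Q. pose proof (beta_sum_le k k). unfold p. lra. }
  destruct (o_isolated (k + 2)) as (d & Hd & Kd).
  (* From [M] on, [beta_ind k m] is [1] and the trivial bound [|s2| <= 1] is affordable. Only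
     finitely many points remain where [s2] must be small, and these keep a distance [d'] from
     [z k]. *)
  destruct (rho_infty (INR k + 2 + th)) as (M & HM).
  destruct (finite_min_pos (fun m => Cmod (o (m + 2) - z k)) M) as (d' & Hd' & Kd').
  { intros m. destruct (o_isolated (m + 2)) as (d0 & H0 & K0). destruct (K0 k) as (_ & K1).
    rewrite Cmod_sub_sym. lra. }
  assert (Hdd : 0 < d ^ 2) by (apply pow_lt; auto). assert (Hdd' : 0 < d' ^ 2) by (apply pow_lt; auto).
  (* The bound [h] serves the convergence of the series; [th * (/2) ^ (k + 2)] is half of the
     geometric share of [beta], one half for each bump. *)
  assert (Ht : 0 < Rmin h (th * (/2) ^ (k + 2))).
  { apply Rmin_glb_lt; auto. apply Rmult_lt_0_compat; auto. apply pow_lt; lra. }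
  set (t := Rmin h (th * (/2) ^ (k + 2))) in *.
  assert (Th : t <= h) by apply Rmin_l. assert (Tt : t <= th * (/2) ^ (k + 2)) by apply Rmin_r.
  clearbody t.
  destruct (small_eps (INR (k + 2)) b (b * 2 / d ^ 2) t) as (e1 & E1 & E1a & E1b & E1c); auto.
  { apply pos_INR. } { lra. } { apply Rmult_le_pos; [lra|]. left; now apply Rinv_0_lt_compat. }
  destruct (small_eps (INR (k + 3)) 1 (2 / d' ^ 2) t) as (e2 & E2 & E2a & E2b & E2c); auto.
  { apply pos_INR. } { lra. } { apply Rmult_le_pos; [lra|]. left; now apply Rinv_0_lt_compat. }
  (* Zeros of [s1]: the points before [p]. The longer list for [s2] contains [p] too, so that [s2]
     leaves the modulus at [p] untouched. *)
  destruct (o_list (k + 2)) as (LA1 & LA2 & LA3 & LA4).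
  destruct (o_list (k + 3)) as (LB1 & LB2 & LB3 & LB4).
  destruct (bump_exists p (map o (seq 0 (k + 2))) e1) as (s1 & A1 & A2 & A3 & A4 & A5); auto.
  { apply o_circle. } { intros c Hc. destruct (LA1 c Hc) as (j & _ & ->). apply o_circle. }
  { intros Hc. destruct (LA1 p Hc) as (j & Hj & E). apply o_inj in E. lia. }
  { now rewrite LA3. }
  destruct (bump_exists (z k) (map o (seq 0 (k + 3))) e2) as (s2 & B1 & B2 & B3 & B4 & B5); auto.
  { intros c Hc. destruct (LB1 c Hc) as (j & _ & ->). apply o_circle. }
  { intros Hc. destruct (LB1 _ Hc) as (j & Hj & E).
    destruct (o_isolated j) as (d0 & H0 & K0). destruct (K0 k) as (_ & K1).
    rewrite E, Cmod_sub_self in K1. lra. }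
  { now rewrite LB3. }
  set (f := fun y => (b * s1 y + s2 y)%C).
  assert (ReF : forall y, Re (f y) = b * Re (s1 y) + Re (s2 y)).
  { intros y. unfold f. destruct (s1 y), (s2 y). simpl. ring. }
  assert (CF : forall y, Cmod (f y) <= b * Cmod (s1 y) + Cmod (s2 y)).
  { intros y. unfold f. eapply Rle_trans; [apply Cmod_triangle|].
    rewrite Cmod_mult, Cmod_R, Rabs_pos_eq by lra. lra. }
  assert (far : forall s kap e, (forall y, Cmod y <= 1 -> 0 <= Re (s y) /\ Cmod (s y) <= 1 /\
       Cmod (s y) * Cmod (y - kap) ^ 2 <= 2 * e) ->
     forall y q, Cmod y <= 1 -> 0 < q -> q <= Cmod (y - kap) -> Cmod (s y) <= 2 * e / q ^ 2).
  { intros s kap e Hs y q Hy Hq Hqy. destruct (Hs y Hy) as (_ & _ & Q).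
    assert (0 < q ^ 2) by (apply pow_lt; auto). apply Rmult_le_reg_r with (q ^ 2); auto.
    replace (2 * e / q ^ 2 * q ^ 2) with (2 * e) by (field; lra).
    eapply Rle_trans; [|apply Q]. apply Rmult_le_compat_l; [apply Cmod_ge_0|nra]. }
  exists f. unfold term_ok.
  split; [|split; [|split; [|split; [|split; [|split; [|split]]]]]].
  - apply disc_alg_plus; auto. apply disc_alg_mult; auto. apply disc_alg_const.
  - intros y Hy. rewrite ReF. destruct (A4 y Hy) as (Q1 & _). destruct (B4 y Hy) as (Q2 & _).
    assert (0 <= b * Re (s1 y)) by (apply Rmult_le_pos; lra). lra.
  - rewrite ReF, B2. simpl. destruct (A4 (z k)) as (Q1 & _); [rewrite z_circle; lra|].
    assert (0 <= b * Re (s1 (z k))) by (apply Rmult_le_pos; lra). lra.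
  - intros j Hj. unfold f. rewrite A3, B3; [ring|apply LB4; lia|apply LA4; lia].
  - fold p. unfold f. rewrite A2, (B3 p) by (apply LB4; lia).
    rewrite <- Eb. f_equal. ring.
  - intros m Hm. eapply Rle_trans; [apply CF|]. unfold beta.
    assert (Ho : Cmod (o (m + 2)) <= 1) by (rewrite o_circle; lra).
    assert (G1 : b * Cmod (s1 (o (m + 2))) <= th * (/2) ^ (k + 2)).
    { destruct (Kd (m + 2)%nat) as (K1 & _). specialize (K1 ltac:(lia)).
      assert (Q := far s1 p e1 A4 (o (m + 2)) d Ho Hd K1).
      apply Rle_trans with (b * (2 * e1 / d ^ 2)); [apply Rmult_le_compat_l; lra|].
      replace (b * (2 * e1 / d ^ 2)) with (e1 * (b * 2 / d ^ 2)) by (field; lra). lra. }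
    assert (G2 : Cmod (s2 (o (m + 2))) <= beta_ind k m + th * (/2) ^ (k + 2)).
    { unfold beta_ind. destruct (Rlt_dec (rho m) (INR k + 2 + th)) as [q|q].
      - assert (m < M)%nat.
        { apply Nat.nle_gt. intros h'. specialize (HM m h'). lra. }
        assert (Q := far s2 (z k) e2 B4 (o (m + 2)) d' Ho Hd' (Kd' m H)).
        replace (2 * e2 / d' ^ 2) with (e2 * (2 / d' ^ 2)) in Q by (field; lra). lra.
      - destruct (B4 (o (m + 2)) Ho) as (_ & Q & _).
        assert (0 < th * (/2) ^ (k + 2)) by (apply Rmult_lt_0_compat; auto; apply pow_lt; lra). lra. }
    replace (th * (/2) ^ (k + 1)) with (th * (/2) ^ (k + 2) + th * (/2) ^ (k + 2)).
    + lra.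
    + replace (k + 2)%nat with (S (k + 1)) by lia. simpl. field.
  - intros y q Hy Hq K1 K2. eapply Rle_trans; [apply CF|].
    assert (Q1 := far s1 p e1 A4 y q Hy Hq K1). assert (Q2 := far s2 (z k) e2 B4 y q Hy Hq K2).
    assert (0 < / q ^ 2) by (apply Rinv_0_lt_compat; apply pow_lt; auto).
    apply Rle_trans with (b * (2 * e1 / q ^ 2) + 2 * e2 / q ^ 2).
    { apply Rplus_le_compat; auto. apply Rmult_le_compat_l; lra. }
    fold h. replace (b * (2 * e1 / q ^ 2) + 2 * e2 / q ^ 2) with (2 / q ^ 2 * (e1 * b + e2 * 1)) by (unfold Rdiv; ring).
    replace (4 / q ^ 2 * h) with (2 / q ^ 2 * (h + h)) by (unfold Rdiv; ring).
    apply Rmult_le_compat_l; [unfold Rdiv; lra|lra].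
  - intros r y y' Hr Hy Hy'. specialize (A5 r y y' Hr Hy Hy'). specialize (B5 r y y' Hr Hy Hy').
    unfold f. replace (b * s1 y + s2 y - (b * s1 y' + s2 y'))%C
      with (b * (s1 y - s1 y') + (s2 y - s2 y'))%C by ring.
    eapply Rle_trans; [apply Cmod_triangle|]. rewrite Cmod_mult, Cmod_R, Rabs_pos_eq by lra.
    fold h. set (D := / (1 - r) ^ 6) in *.
    assert (HD : 0 < D) by (apply Rinv_0_lt_compat; apply pow_lt; lra).
    unfold Rdiv in *. fold D in A5, B5. fold D.
    set (n := Cmod (y - y')) in *. assert (Hn : 0 <= n) by apply Cmod_ge_0.
    apply Rle_trans with (b * (e1 * (8 * D) * n) + e2 * (8 * D) * n).
    { apply Rplus_le_compat; auto. apply Rmult_le_compat_l; lra. }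
    replace (b * (e1 * (8 * D) * n) + e2 * (8 * D) * n) with ((8 * D * n) * (e1 * b + e2 * 1)) by ring.
    replace (16 * D * h * n) with ((8 * D * n) * (h + h)) by ring.
    apply Rmult_le_compat_l; [|lra]. apply Rmult_le_pos; lra.
Qed.

Lemma term_sequence : exists fs : nat -> C -> C,
  forall k, term_ok k (fun y => csum (fun j => fs j y) k) (fs k).
Proof.
  assert (I0 : partial_ok 0 (fun _ => 0)).
  { split; intros; simpl; [lra|]. rewrite Cmod_0; lra. }
  assert (St : forall k R, partial_ok k R ->
    {f | term_ok k R f /\ partial_ok (S k) (fun y => R y + f y)%C}).
  { intros k R HR. apply constructive_indefinite_description.
    destruct (next_term k R HR) as (f & Hf). exists f. split; auto.
    destruct HR as (R1 & R2). destruct Hf as (_ & F2 & _ & _ & _ & F6 & _). split.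
    - intros y Hy. replace (Re (R y + f y)) with (Re (R y) + Re (f y)) by reflexivity.
      specialize (R1 y Hy). specialize (F2 y Hy). lra.
    - intros m Hm. eapply Rle_trans; [apply Cmod_triangle|]. simpl.
      specialize (R2 m ltac:(lia)). specialize (F6 m ltac:(lia)). lra. }
  (* The recursion carries the partial sum with its invariant; the terms are read off afterwards. *)
  set (Rs := nat_rect (fun k => {R | partial_ok k R}) (exist _ _ I0)
    (fun k R => exist _ _ (proj2 (proj2_sig (St k (proj1_sig R) (proj2_sig R)))))).
  set (fs := fun k => proj1_sig (St k (proj1_sig (Rs k)) (proj2_sig (Rs k)))).
  assert (E : forall k, proj1_sig (Rs k) = (fun y => csum (fun j => fs j y) k)).
  { induction k; simpl; [reflexivity|]. fold (fs k). rewrite IHk. reflexivity. }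
  exists fs. intros k. rewrite <- E. unfold fs.
  apply (proj1 (proj2_sig (St k (proj1_sig (Rs k)) (proj2_sig (Rs k))))).
Qed.

Definition on_zero (y : C) : Prop := exists k, y = z k.

(** [w] is [1 / (1 + l)] with [l] the sum of the series, and [0] at the points [z k]. Since
    [Re l >= 0], the denominator never vanishes and [|w| <= 1]. Away from the zeros the series
    converges locally uniformly. At a zero, some partial sum has large real part on a neighbourhood,
    and the later terms can only increase it; so [w] is small there. *)
Lemma interpolation : exists w, disc_alg w /\
  (forall y, Cmod y <= 1 -> Cmod (w y) <= 1) /\
  Cmod (w (o 0)) = 1 /\ Cmod (w (o 1)) = 1 /\
  (forall k, Cmod (w (o (k + 2)%nat)) = / rho k) /\
  (forall k, w (z k) = 0) /\
  (forall y, Cmod y <= 1 -> (forall k, y <> z k) -> w y <> 0).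
Proof.
  destruct term_sequence as (fs & Hfs).
  set (S := fun n y => csum (fun j => fs j y) n).
  assert (HRe : forall y k, Cmod y <= 1 -> 0 <= Re (fs k y)) by (intros; apply Hfs; auto).
  assert (HS : forall n, disc_alg (S n)).
  { induction n; [apply disc_alg_const|]. apply (disc_alg_plus (S n) (fs n)); auto. apply Hfs. }
  assert (Hsep : forall y, Cmod y <= 1 -> ~ on_zero y -> exists d K, 0 < d /\ forall k, (K <= k)%nat ->
     d <= Cmod (o (k + 2) - y) /\ d <= Cmod (z k - y)).
  { intros y Hy Hz. destruct (Req_dec (Cmod y) 1) as [E|E].
    - destruct (classic (exists n, y = o n)) as [(n & ->)|N].
      (* Starting at index [n] excludes the point itself, as [k + 2 > n]. *)
      + destruct (o_isolated n) as (d & Hd & K). exists d, n. split; auto.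
        intros k Hk. destruct (K (k + 2)%nat) as (K1 & _). destruct (K k) as (_ & K2).
        split; auto. apply K1. lia.
      + destruct (oz_closed y E) as (d & Hd & K).
        { intros n h. apply N. eauto. } { intros n h. apply Hz. exists n; auto. }
        exists d, 0%nat. split; auto. intros k _. split; apply K.
    - exists (1 - Cmod y), 0%nat. split; [lra|]. intros k _. split.
      + pose proof (Cmod_le_sub (o (k + 2)) y). rewrite o_circle in H. lra.
      + pose proof (Cmod_le_sub (z k) y). rewrite z_circle in H. lra. }
  assert (Hloc : forall y, Cmod y <= 1 -> ~ on_zero y -> exists d c K, 0 < d /\
     forall y', Cmod y' <= 1 -> Cmod (y' - y) < d -> ~ on_zero y' /\
       forall k, (K <= k)%nat -> Cmod (fs k y') <= c * (/2) ^ k).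
  { intros y Hy Hz. destruct (Hsep y Hy Hz) as (d & K & Hd & HK).
    exists (d / 2), (4 / (d / 2) ^ 2), K. split; [lra|]. intros y' Hy' Hyy'.
    assert (Q : forall p, d <= Cmod (p - y) -> d / 2 <= Cmod (y' - p)).
    { intros p Hp. pose proof (Cmod_sub_triangle p y' y). rewrite (Cmod_sub_sym p y') in H. lra. }
    split.
    (* A zero close to [y] would occur again with index at least [K], against the separation. *)
    - intros (m & ->). destruct (z_repeats m K) as (k & Hk & Ek).
      destruct (HK k Hk) as (_ & K2). apply Q in K2. rewrite Ek, Cmod_sub_self in K2. lra.
    - intros k Hk. destruct (HK k Hk) as (K1 & K2).
      destruct (Hfs k) as (_ & _ & _ & _ & _ & _ & F & _). apply F; auto. lra. }
  set (l := fun y => epsilon (inhabits (RtoC 0)) (cconv (fun n => S n y))).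
  assert (Hl : forall y, Cmod y <= 1 -> ~ on_zero y -> cconv (fun n => S n y) (l y)).
  { intros y Hy Hz. unfold l. apply epsilon_spec.
    destruct (Hloc y Hy Hz) as (d & c & K & Hd & HK).
    destruct (HK y Hy ltac:(rewrite Cmod_sub_self; auto)) as (_ & H).
    destruct (cseries_dominated _ _ _ H) as (l0 & C0 & _). exists l0. exact C0. }
  assert (HlRe : forall y n, Cmod y <= 1 -> ~ on_zero y -> Re (S n y) <= Re (l y)).
  { intros y n Hy Hz. apply (cconv_Re_ge (fun j => fs j y)); auto. apply Hl; auto. }
  assert (HlRe0 : forall y, Cmod y <= 1 -> ~ on_zero y -> 1 <= Re (1 + l y)%C).
  { intros y Hy Hz. specialize (HlRe y 0%nat Hy Hz). simpl in *. unfold Re in *. lra. }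
  assert (Hl1 : forall y, Cmod y <= 1 -> ~ on_zero y -> (1 + l y)%C <> 0).
  { intros y Hy Hz. apply Re_pos_neq0. specialize (HlRe0 y Hy Hz). lra. }
  set (w := fun y => if excluded_middle_informative (on_zero y) then RtoC 0 else (/ (1 + l y))%C).
  assert (w0 : forall y, on_zero y -> w y = 0).
  { intros y Hy. unfold w. destruct (excluded_middle_informative (on_zero y)); tauto. }
  assert (w1 : forall y, ~ on_zero y -> w y = (/ (1 + l y))%C).
  { intros y Hy. unfold w. destruct (excluded_middle_informative (on_zero y)); tauto. }
  assert (o_nz : forall n, ~ on_zero (o n)).
  { intros n (k & E). destruct (o_isolated n) as (d & Hd & K). destruct (K k) as (_ & K2).
    rewrite E, Cmod_sub_self in K2. lra. }
  assert (o_le : forall n, Cmod (o n) <= 1) by (intros n; rewrite o_circle; lra).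
  assert (Hwle : forall y, Cmod y <= 1 -> ~ on_zero y -> forall n, Cmod (w y) * (1 + Re (S n y)) <= 1).
  { intros y Hy Hz n. rewrite w1 by auto. assert (N := Hl1 y Hy Hz).
    assert (P : 0 < Cmod (1 + l y)) by exact (proj1 (Cmod_gt_0 _) N).
    rewrite Cmod_inv by auto.
    apply Rmult_le_reg_l with (Cmod (1 + l y)); auto.
    rewrite <- Rmult_assoc, Rinv_r by lra. rewrite Rmult_1_l, Rmult_1_r.
    specialize (HlRe y n Hy Hz).
    apply Rle_trans with (Re (1 + l y)%C).
    - replace (Re (1 + l y)) with (1 + Re (l y)) by reflexivity. lra.
    - eapply Rle_trans; [apply Rle_abs|apply re_le_Cmod]. }
  assert (w_o0 : forall j, (j < 2)%nat -> Cmod (w (o j)) = 1).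
  { intros j Hj. rewrite w1 by auto.
    assert (E : l (o j) = 0).
    { apply cconv_unique with (fun n => S n (o j)); [now apply Hl|].
      assert (E : forall n, S n (o j) = 0) by (intros n; apply csum_zero; intros k; apply Hfs; lia).
      intros e He. exists 0%nat. intros n _. rewrite E, Cmod_sub_self; auto. }
    rewrite E. replace (/ (1 + 0))%C with (RtoC 1) by (field).
    apply Cmod_1. }
  exists w. split; [split|split; [|split; [|split; [|split; [|split]]]]].
  - intros y Hy.
    assert (nz : forall y', Cmod y' < 1 -> ~ on_zero y').
    { intros y' Hy' (k & ->). rewrite z_circle in Hy'. lra. }
    set (r := (1 + Cmod y) / 2). pose proof (Cmod_ge_0 y).
    assert (near : forall y', Cmod (y' - y) < (1 - Cmod y) / 2 -> Cmod y' <= r).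
    { intros y' Hy'. pose proof (Cmod_le_sub y' y). unfold r. lra. }
    apply cdiff_local with (fun y => / (1 + l y))%C ((1 - Cmod y) / 2); [lra| |].
    { intros y' Hy'. rewrite w1; auto. apply nz. specialize (near y' Hy'). unfold r in near. lra. }
    apply cdiff_inv; [apply Hl1; auto; lra|]. apply cdiff_plus; [apply cdiff_const|].
    apply cdiff_series with fs ((1 - Cmod y) / 2) (16 / (1 - r) ^ 6); [lra| | |].
    + intros k. apply Hfs. auto.
    + intros k y' Hy'. apply Hfs; [unfold r; lra| |unfold r; lra]. auto.
    + intros y' Hy'. specialize (near y' Hy'). unfold r in near. apply Hl; [lra|]. apply nz. lra.
  - intros y Hy e He. destruct (classic (on_zero y)) as [Hz|Hz].
    + rewrite (w0 y Hz). destruct Hz as (m & ->).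
      (* Each of the infinitely many occurrences of [z m] in the enumeration adds at least [1] to
         the real part. *)
      assert (Hbig : forall N : nat, exists n, INR N <= Re (S n (z m))).
      { induction N as [|N (n & Hn)]; [exists 0%nat; simpl; lra|].
        destruct (z_repeats m n) as (k & Hk & Ek).
        exists (k + 1)%nat. rewrite S_INR.
        assert (Q := csum_Re_le (fun j => fs j (z m)) n (k - n) (fun j => HRe _ j Hy)).
        replace (n + (k - n))%nat with k in Q by lia.
        rewrite Nat.add_1_r. unfold S in *. simpl csum.
        replace (Re (csum (fun j => fs j (z m)) k + fs k (z m)))
          with (Re (csum (fun j => fs j (z m)) k) + Re (fs k (z m))) by reflexivity.
        assert (1 <= Re (fs k (z m))) by (rewrite <- Ek; apply Hfs). lra. }
      destruct (INR_archimed 1 (/ e + 1)) as (N & HN); [lra|]. rewrite Rmult_1_r in HN.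
      destruct (Hbig N) as (n & Hn).
      destruct (proj2 (HS n) (z m) Hy 1 ltac:(lra)) as (d & Hd & K).
      exists d. split; auto. intros y' Hy' Hyy'. specialize (K y' Hy' Hyy').
      replace (w y' - 0)%C with (w y') by ring.
      destruct (classic (on_zero y')) as [Hz'|Hz']; [rewrite w0, Cmod_0; auto|].
      specialize (Hwle y' Hy' Hz' n).
      assert (Q := re_le_Cmod (S n y' - S n (z m))).
      assert (Q' : Rabs (Re (S n y' - S n (z m))) < 1) by lra. apply Rabs_def2 in Q'.
      replace (Re (S n y' - S n (z m))) with (Re (S n y') - Re (S n (z m))) in Q' by reflexivity.
      assert (Hie : 0 < / e) by now apply Rinv_0_lt_compat.
      assert (P : / e < 1 + Re (S n y')) by lra.
      apply Rmult_lt_reg_r with (1 + Re (S n y')); [lra|].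
      eapply Rle_lt_trans; [apply Hwle|].
      apply Rmult_lt_compat_l with (r := e) in P; auto. rewrite Rinv_r in P; lra.
    + destruct (Hloc y Hy Hz) as (d & c & K & Hd & HK).
      assert (Cl : cont_within (fun y' => Cmod y' <= 1 /\ Cmod (y' - y) < d) l y).
      { intros e' He'. destruct (half_pow_small (2 * c) (e' / 3) ltac:(lra)) as (N & HN).
        set (n := max N K). specialize (HN n ltac:(unfold n; lia)).
        assert (T : forall y', Cmod y' <= 1 -> Cmod (y' - y) < d -> Cmod (l y' - S n y') < e' / 3).
        { intros y' Hy' Hyy'. destruct (HK y' Hy' Hyy') as (Z' & B').
          destruct (cseries_dominated _ _ _ B') as (l0 & C0 & B0).
          assert (E : l y' = l0) by (apply cconv_unique with (fun n => S n y'); [apply Hl; auto|exact C0]).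
          rewrite E. eapply Rle_lt_trans; [apply B0; unfold n; lia|]. exact HN. }
        destruct (proj2 (HS n) y Hy (e' / 3) ltac:(lra)) as (d' & Hd' & K').
        exists d'. split; auto. intros y' (Hy' & Hyy') Hyd'.
        assert (T1 := T y' Hy' Hyy'). assert (T2 := T y Hy ltac:(rewrite Cmod_sub_self; auto)).
        specialize (K' y' Hy' Hyd').
        replace (l y' - l y)%C with ((l y' - S n y') + ((S n y' - S n y) - (l y - S n y)))%C by ring.
        eapply Rle_lt_trans; [apply Cmod_triangle|].
        pose proof (Cmod_sub_le (S n y' - S n y) (l y - S n y)). lra. }
      assert (Cw : cont_within (fun y' => Cmod y' <= 1 /\ Cmod (y' - y) < d) (fun y => / (1 + l y))%C y).
      { apply cont_inv; [now apply Hl1|]. apply cont_plus; [apply cont_const|exact Cl]. }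
      destruct (Cw e He) as (d' & Hd' & K').
      exists (Rmin d d'). split; [now apply Rmin_glb_lt|]. intros y' Hy' Hyy'.
      assert (Q1 := Rlt_le_trans _ _ _ Hyy' (Rmin_l _ _)). assert (Q2 := Rlt_le_trans _ _ _ Hyy' (Rmin_r _ _)).
      rewrite !w1 by (auto; apply (HK y' Hy' Q1)). apply K'; auto.
  - intros y Hy. destruct (classic (on_zero y)) as [Hz|Hz]; [rewrite w0, Cmod_0; auto; lra|].
    specialize (Hwle y Hy Hz 0%nat). simpl in Hwle. lra.
  - apply w_o0; lia.
  - apply w_o0; lia.
  - intros k. rewrite w1 by auto.
    assert (E : l (o (k + 2)) = S (k + 1)%nat (o (k + 2))).
    { apply (cconv_eventually_const (fun n => S n (o (k + 2)))); [|now apply Hl].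
      intros n Hn. replace n with (k + 1 + (n - (k + 1)))%nat by lia.
      induction (n - (k + 1))%nat as [|q IH]; [now rewrite Nat.add_0_r|].
      rewrite Nat.add_succ_r. unfold S in *. simpl csum. rewrite IH.
      destruct (Hfs (k + 1 + q)%nat) as (_ & _ & _ & F & _). rewrite F by lia. ring. }
    assert (N := Hl1 (o (k + 2)) (o_le _) (o_nz _)).
    rewrite Cmod_inv by auto. f_equal. rewrite E. rewrite Nat.add_1_r. unfold S. simpl csum. apply Hfs.
  - intros k. apply w0. exists k; auto.
  - intros y Hy Hz h.
    assert (Hz' : ~ on_zero y) by (intros (k & E); apply (Hz k E)).
    rewrite w1 in h by auto. assert (N := Hl1 y Hy Hz').
    assert (Q : ((1 + l y) * / (1 + l y) = 1)%C) by (apply Cinv_r; auto).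
    rewrite h, Cmult_0_r in Q. apply RtoC_inj in Q. lra.
Qed.

End Interpolation.

(** * Weighted composition operators on the disc algebra *)

Definition Bn (B : C -> C) (n : nat) : C -> C := Nat.iter n B.

Lemma Bn_add B n m z : Bn B (n + m) z = Bn B n (Bn B m z).
Proof. unfold Bn. now rewrite Nat.iter_add. Qed.

Section WeightedComposition.
Variables (B w : C -> C).
Hypothesis B_alg : disc_alg B.
Hypothesis B_contr : forall r, 0 <= r < 1 -> exists r', 0 <= r' < 1 /\ forall z, Cmod z <= r -> Cmod (B z) <= r'.
Hypothesis B_circ : forall z, Cmod z = 1 -> Cmod (B z) = 1.
Hypothesis w_alg : disc_alg w.

Lemma B_disc z : Cmod z <= 1 -> Cmod (B z) <= 1.
Proof. apply (max_principle B 1 B_alg). intros y Hy. rewrite B_circ; auto; lra. Qed.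

Lemma B_open_disc z : Cmod z < 1 -> Cmod (B z) < 1.
Proof.
  intros Hz. destruct (B_contr (Cmod z)) as (r' & Hr' & K).
  { split; [apply Cmod_ge_0|auto]. }
  specialize (K z (Rle_refl _)). lra.
Qed.

Lemma Bn_disc n z : Cmod z <= 1 -> Cmod (Bn B n z) <= 1.
Proof. intros Hz. induction n; simpl; auto. apply B_disc; auto. Qed.

Lemma Bn_circ n z : Cmod z = 1 -> Cmod (Bn B n z) = 1.
Proof. intros Hz. induction n; simpl; auto. Qed.

Lemma Bn_open_disc n z : Cmod z < 1 -> Cmod (Bn B n z) < 1.
Proof. intros Hz. induction n; simpl; auto. apply B_open_disc; auto. Qed.

Lemma Bn_S_r n z : Bn B (S n) z = Bn B n (B z).
Proof. rewrite <- Nat.add_1_r. now rewrite Bn_add. Qed.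

Lemma Bn_alg n : disc_alg (Bn B n).
Proof.
  induction n; [apply disc_alg_id|]. apply (disc_alg_comp B (Bn B n)); auto.
  - intros z. apply Bn_open_disc.
  - intros z. apply Bn_disc.
Qed.

Lemma Bn_contr n r : 0 <= r < 1 -> exists r', 0 <= r' < 1 /\ forall z, Cmod z <= r -> Cmod (Bn B n z) <= r'.
Proof.
  intros Hr. induction n as [|n (r' & Hr' & K)]; [exists r; auto|].
  destruct (B_contr r' Hr') as (r2 & Hr2 & K2). exists r2. split; auto.
  intros z Hz. apply K2, K, Hz.
Qed.

Fixpoint wn (n : nat) (z : C) : C := match n with O => 1 | S n => (w z * wn n (B z))%C end.

Lemma wn_S_r n z : wn (S n) z = (wn n z * w (Bn B n z))%C.
Proof.
  revert z. induction n; intros z; [simpl; ring|].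
  change (wn (S (S n)) z) with (w z * wn (S n) (B z))%C. rewrite IHn, <- Bn_S_r. simpl. ring.
Qed.

Lemma wn_alg n : disc_alg (wn n).
Proof.
  induction n; [apply disc_alg_const|]. apply (disc_alg_mult w (fun z => wn n (B z))); auto.
  apply disc_alg_comp; auto using B_open_disc, B_disc.
Qed.

Lemma wco_minus_alg f mu : disc_alg f -> disc_alg (fun z => wco w B f z - mu * f z)%C.
Proof.
  intros Hf. apply disc_alg_minus.
  - apply disc_alg_mult; auto. apply disc_alg_comp; auto using B_open_disc, B_disc.
  - apply disc_alg_mult; auto. apply disc_alg_const.
Qed.

(** The factorisation of [T^m - mu^m] through [T - mu]; the point is that [c] does not depend on
    [f]. *)
Lemma iterate_estimate mu m : exists c, 0 <= c /\ forall f e,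
  (forall z, Cmod z <= 1 -> Cmod (wco w B f z - mu * f z) <= e) ->
  forall z, Cmod z <= 1 -> Cmod (wn m z * f (Bn B m z) - mu ^ m * f z) <= c * e.
Proof.
  induction m as [|m (c & Hc & K)].
  - exists 0. split; [lra|]. intros f e H z Hz. simpl.
    replace (1 * f z - 1 * f z)%C with (RtoC 0) by ring. rewrite Cmod_0. lra.
  - destruct (disc_alg_bounded w w_alg) as (W & HW).
    assert (HW0 : 0 <= W).
    { eapply Rle_trans; [apply (Cmod_ge_0 (w 0))|]. apply HW. rewrite Cmod_0; lra. }
    exists (W * c + Cmod mu ^ m). split.
    { pose proof (pow_le (Cmod mu) m (Cmod_ge_0 mu)). nra. }
    intros f e H z Hz. assert (HBz := B_disc z Hz).
    specialize (K f e H (B z) HBz). specialize (H z Hz). specialize (HW z Hz). unfold wco in H.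
    rewrite Bn_S_r. simpl wn.
    replace (w z * wn m (B z) * f (Bn B m (B z)) - mu ^ (S m) * f z)%C
      with (w z * (wn m (B z) * f (Bn B m (B z)) - mu ^ m * f (B z)) +
            mu ^ m * (w z * f (B z) - mu * f z))%C by (simpl; ring).
    eapply Rle_trans; [apply Cmod_triangle|]. rewrite !Cmod_mult, Cmod_pow.
    rewrite Rmult_plus_distr_r, Rmult_assoc. apply Rplus_le_compat.
    + apply Rmult_le_compat; auto using Cmod_ge_0.
    + apply Rmult_le_compat_l; auto. apply pow_le, Cmod_ge_0.
Qed.

(** Let [x n] attain its norm [1] at [tn] on the circle, and let [t] be a cluster point of the [tn].
    An approximate eigenvector satisfies [w_m * x(B^m) = mu^m * x] up to a small error. Read at
    [tn], this contradicts [|w_m(t)| < |mu|^m]; read at a preimage of [tn] close to [u], it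
    contradicts [|w_m(u)| > |mu|^m]. *)
Lemma not_usf_of_growth mu :
  (forall m u e, Cmod u = 1 -> 0 < e -> exists del, 0 < del /\ forall t, Cmod t = 1 ->
     Cmod (t - Bn B m u) < del -> exists u', Cmod u' = 1 /\ Cmod (u' - u) < e /\ Bn B m u' = t) ->
  (forall t, Cmod t = 1 -> (exists m, Cmod (wn m t) < Cmod mu ^ m) \/
     (exists m u, Cmod u = 1 /\ Bn B m u = t /\ Cmod mu ^ m < Cmod (wn m u))) ->
  ~ in_sigma_usf (wco w B) mu.
Proof.
  intros Hop Hgr (x & X1 & X2 & X3 & _).
  assert (X1' : forall n, disc_alg (x n)) by (intros n; apply in_disc_algebra_iff; auto).
  assert (Ht : forall n, {t : C | Cmod t = 1 /\ Cmod (x n t) = 1}).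
  { intros n. apply constructive_indefinite_description.
    destruct (supnorm_attained (x n) (X1' n)) as (t & Ht & E). exists t. rewrite E. auto. }
  destruct (circle_compact (fun n => proj1_sig (Ht n))) as (t & Ht1 & A).
  { intros n. apply (proj2_sig (Ht n)). }
  set (e := fun n => supnorm (fun z => wco w B (x n) z - mu * x n z)%C).
  assert (He : forall n z, Cmod z <= 1 -> Cmod (wco w B (x n) z - mu * x n z) <= e n).
  { intros n z Hz. apply (le_supnorm_disc_alg (fun z => wco w B (x n) z - mu * x n z)%C); auto.
    now apply wco_minus_alg. }
  assert (Hx1 : forall n z, Cmod z <= 1 -> Cmod (x n z) <= 1).
  { intros n z Hz. rewrite <- (X2 n). now apply le_supnorm_disc_alg. }
  assert (Hsmall : forall c del, 0 < c -> exists N, forall n, (N <= n)%nat -> del * e n < c).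
  { intros c del Hc. set (D := Rabs del + 1). assert (HD : 0 < D) by (unfold D; pose proof (Rabs_pos del); lra).
    assert (Hcd : 0 < c / D) by now apply Rdiv_lt_0_compat.
    apply is_lim_seq_spec in X3. destruct (X3 (mkposreal _ Hcd)) as (N & HN).
    exists N. intros n Hn. specialize (HN n Hn). simpl in HN. fold (e n) in HN.
    rewrite Rminus_0_r in HN. apply Rmult_lt_compat_r with (r := D) in HN; auto.
    replace (c / D * D) with c in HN by (field; lra).
    eapply Rle_lt_trans; [apply Rle_abs|]. rewrite Rabs_mult.
    pose proof (Rabs_pos (e n)). unfold D in HN. nra. }
  destruct (Hgr t Ht1) as [(m & Hm)|(m & u & Hu & Eu & Hm)];
    destruct (iterate_estimate mu m) as (c & Hc & K).
  - set (q := Cmod mu ^ m - Cmod (wn m t)). assert (Hq : 0 < q) by (unfold q; lra).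
    destruct (proj2 (wn_alg m) t ltac:(lra) (q / 2) ltac:(lra)) as (d & Hd & Kd).
    destruct (Hsmall (q / 2) c ltac:(lra)) as (N & HN).
    destruct (A d N Hd) as (n & Hn & Hnt). destruct (Ht n) as (tn & T1 & T2). simpl in Hnt.
    specialize (HN n Hn). assert (T1' : Cmod tn <= 1) by lra.
    specialize (K (x n) (e n) (He n) tn T1'). specialize (Kd tn T1' Hnt).
    pose proof (Cmod_le_sub (wn m tn) (wn m t)).
    pose proof (Cmod_le_sub (mu ^ m * x n tn) (wn m tn * x n (Bn B m tn))) as Q.
    rewrite Cmod_sub_sym in Q. rewrite !Cmod_mult, Cmod_pow, T2 in Q.
    assert (Q2 := Hx1 n (Bn B m tn) (Bn_disc m tn T1')).
    pose proof (Cmod_ge_0 (wn m tn)). pose proof (Cmod_ge_0 (x n (Bn B m tn))).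
    assert (Cmod (wn m tn) * Cmod (x n (Bn B m tn)) <= Cmod (wn m tn) * 1) by (apply Rmult_le_compat_l; auto).
    unfold q in *. lra.
  - set (q := Cmod (wn m u) - Cmod mu ^ m). assert (Hq : 0 < q) by (unfold q; lra).
    destruct (proj2 (wn_alg m) u ltac:(lra) (q / 2) ltac:(lra)) as (d & Hd & Kd).
    (* Openness of [B^m] replaces [u] by a nearby preimage of [tn] itself, the point where [x n] is
       known to have modulus [1]. *)
    destruct (Hop m u d Hu Hd) as (d' & Hd' & Kd').
    destruct (Hsmall (q / 2) c ltac:(lra)) as (N & HN).
    destruct (A d' N Hd') as (n & Hn & Hnt). destruct (Ht n) as (tn & T1 & T2). simpl in Hnt.
    specialize (HN n Hn). rewrite <- Eu in Hnt.
    destruct (Kd' tn T1 Hnt) as (u' & U1 & U2 & U3).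
    assert (U1' : Cmod u' <= 1) by lra.
    specialize (K (x n) (e n) (He n) u' U1'). specialize (Kd u' U1' U2).
    rewrite U3 in K.
    pose proof (Cmod_le_sub (wn m u) (wn m u')) as Q0. rewrite (Cmod_sub_sym (wn m u)) in Q0.
    pose proof (Cmod_le_sub (wn m u' * x n tn) (mu ^ m * x n u')) as Q.
    rewrite !Cmod_mult, Cmod_pow, T2 in Q.
    assert (Q2 := Hx1 n u' U1').
    assert (0 <= Cmod mu ^ m) by (apply pow_le, Cmod_ge_0).
    assert (Cmod mu ^ m * Cmod (x n u') <= Cmod mu ^ m * 1) by (apply Rmult_le_compat_l; auto).
    unfold q in *. lra.
Qed.

(** The last clause excludes convergent subsequences: a uniform limit would vanish in the open disc,
    hence by continuity on the closed one, although the functions have norm [1]. *)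
Definition approx_eigen (mu : C) : Prop := forall eps, 0 < eps -> exists x, disc_alg x /\ supnorm x = 1 /\
  (forall z, Cmod z <= 1 -> Cmod (wco w B x z - mu * x z) <= eps) /\
  (forall z, Cmod z <= 1 - eps -> Cmod (x z) <= eps).

Lemma usf_of_approx_eigen mu : approx_eigen mu -> in_sigma_usf (wco w B) mu.
Proof.
  intros H.
  assert (Hp : forall n, 0 < / (INR n + 1)) by (intros n; apply Rinv_0_lt_compat; pose proof (pos_INR n); lra).
  assert (Hx : forall n : nat, {x | disc_alg x /\ supnorm x = 1 /\
     (forall z, Cmod z <= 1 -> Cmod (wco w B x z - mu * x z) <= / (INR n + 1)) /\
     (forall z, Cmod z <= 1 - / (INR n + 1) -> Cmod (x z) <= / (INR n + 1))}).
  { intros n. apply constructive_indefinite_description. apply H. apply Hp. }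
  set (x := fun n => proj1_sig (Hx n)).
  assert (X1 : forall n, disc_alg (x n)) by (intros n; apply (proj2_sig (Hx n))).
  assert (X2 : forall n, supnorm (x n) = 1) by (intros n; apply (proj2_sig (Hx n))).
  assert (X3 : forall n z, Cmod z <= 1 -> Cmod (wco w B (x n) z - mu * x n z) <= / (INR n + 1))
    by (intros n; apply (proj2_sig (Hx n))).
  assert (X4 : forall n z, Cmod z <= 1 - / (INR n + 1) -> Cmod (x n z) <= / (INR n + 1))
    by (intros n; apply (proj2_sig (Hx n))).
  assert (Hsm : forall e, 0 < e -> exists N, forall n, (N <= n)%nat -> / (INR n + 1) < e).
  { intros e He. destruct (archimed_cor1 e He) as (N & HN & HN').
    exists N. intros n Hn. apply le_INR in Hn. apply lt_0_INR in HN'.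
    eapply Rlt_trans; [|apply HN]. apply Rinv_lt_contravar; nra. }
  exists x. split; [|split; [|split]].
  - intros n. now apply in_disc_algebra_iff.
  - auto.
  - apply is_lim_seq_spec. intros e. destruct (Hsm e (cond_pos e)) as (N & HN).
    exists N. intros n Hn. specialize (HN n Hn). rewrite Rminus_0_r.
    assert (S1 : supnorm (fun z => wco w B (x n) z - mu * x n z)%C <= / (INR n + 1)) by (apply supnorm_le; auto).
    assert (S0 : 0 <= supnorm (fun z => wco w B (x n) z - mu * x n z)%C).
    { eapply Rle_trans; [apply (Cmod_ge_0 (wco w B (x n) 0 - mu * x n 0))|].
      apply (le_supnorm_disc_alg (fun z => wco w B (x n) z - mu * x n z)%C); [now apply wco_minus_alg|].
      rewrite Cmod_0; lra. }
    rewrite Rabs_pos_eq by auto. lra.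
  - intros (phi & g & Hphi & Hg & Hlim). apply in_disc_algebra_iff in Hg.
    assert (Pn : forall n, (n <= phi n)%nat).
    { induction n; [lia|]. specialize (Hphi n). lia. }
    assert (Hd : forall n, disc_alg (fun z => x (phi n) z - g z)%C) by (intros; now apply disc_alg_minus).
    apply is_lim_seq_spec in Hlim.
    assert (Hcl : forall e, 0 < e -> exists N, forall n, (N <= n)%nat -> forall z, Cmod z <= 1 -> Cmod (x (phi n) z - g z) < e).
    { intros e He. destruct (Hlim (mkposreal _ He)) as (N & HN). exists N. intros n Hn z Hz.
      specialize (HN n Hn). simpl in HN. rewrite Rminus_0_r in HN.
      eapply Rle_lt_trans; [apply (le_supnorm_disc_alg _ z (Hd n) Hz)|].
      eapply Rle_lt_trans; [apply Rle_abs|apply HN]. }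
    assert (G0 : forall z, Cmod z < 1 -> g z = 0).
    { intros z Hz. apply Cmod_eq_0. apply Rle_antisym; [|apply Cmod_ge_0].
      apply le_epsilon. intros e He.
      destruct (Hcl (e / 2) ltac:(lra)) as (N1 & K1).
      destruct (Hsm (Rmin (e / 2) (1 - Cmod z))) as (N2 & K2); [apply Rmin_glb_lt; lra|].
      set (n := max N1 N2). specialize (K1 n ltac:(lia) z ltac:(lra)).
      specialize (K2 (phi n) ltac:(specialize (Pn n); lia)).
      assert (Q1 := Rlt_le_trans _ _ _ K2 (Rmin_l _ _)). assert (Q2 := Rlt_le_trans _ _ _ K2 (Rmin_r _ _)).
      specialize (X4 (phi n) z ltac:(lra)).
      pose proof (Cmod_le_sub (g z) (x (phi n) z)) as Q. rewrite (Cmod_sub_sym (g z)) in Q. lra. }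
    assert (G1 : forall z, Cmod z <= 1 -> g z = 0).
    { intros z Hz. apply Cmod_eq_0. apply Rle_antisym; [|apply Cmod_ge_0].
      apply le_epsilon. intros e He.
      destruct (proj2 Hg z Hz e He) as (d & Hd' & K).
      set (r := Rmin (d / 2) (1 / 2)). assert (Hr : 0 < r) by (apply Rmin_glb_lt; lra).
      assert (r <= d / 2) by apply Rmin_l. assert (r <= 1 / 2) by apply Rmin_r.
      assert (E : Cmod (RtoC (1 - r) * z) = (1 - r) * Cmod z) by (rewrite Cmod_mult, Cmod_R, Rabs_pos_eq; lra).
      pose proof (Cmod_ge_0 z).
      assert (Hlt : Cmod (RtoC (1 - r) * z) < 1) by (rewrite E; nra).
      specialize (K (RtoC (1 - r) * z)%C ltac:(unfold closed_disc; lra)).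
      rewrite (G0 _ Hlt) in K. replace (0 - g z)%C with (- g z)%C in K by ring. rewrite Cmod_opp in K.
      rewrite Rplus_0_l. left. apply K.
      replace (RtoC (1 - r) * z - z)%C with (- (r * z))%C by (rewrite RtoC_minus; ring).
      rewrite Cmod_opp, Cmod_mult, Cmod_R, Rabs_pos_eq by lra. nra. }
    destruct (Hcl (1 / 2) ltac:(lra)) as (N & HN).
    destruct (supnorm_attained (x (phi N)) (X1 _)) as (t & Ht & Et).
    specialize (HN N (le_n _) t ltac:(lra)). rewrite G1 in HN by lra.
    replace (x (phi N) t - 0)%C with (x (phi N) t) in HN by ring. rewrite Et, X2 in HN. lra.
Qed.

(** * Approximate eigenvectors from powers of peak functions *)

Definition peak (v z : C) : C := ((1 + Cconj v * z) / 2)%C.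

Lemma C2_neq0 : RtoC 2 <> 0.
Proof. intros h. apply RtoC_inj in h. lra. Qed.

Lemma peak_at v : Cmod v = 1 -> peak v v = 1.
Proof.
  intros Hv. unfold peak. rewrite (Cmult_comm (Cconj v)), <- Cmod2_conj, Hv, RtoC_pow.
  field.
Qed.

Lemma Cmod_peak v z : Cmod (peak v z) = Cmod (1 + Cconj v * z) / 2.
Proof.
  unfold peak. rewrite Cmod_div by apply C2_neq0. rewrite Cmod_R, Rabs_pos_eq; lra.
Qed.

Lemma peak_le v z : Cmod v = 1 -> Cmod (peak v z) <= (1 + Cmod z) / 2.
Proof.
  intros Hv. rewrite Cmod_peak.
  pose proof (Cmod_triangle 1 (Cconj v * z)) as H. rewrite Cmod_1, Cmod_mult, Cmod_conj, Hv in H. lra.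
Qed.

Lemma peak_lt v z : Cmod v = 1 -> Cmod z <= 1 -> z <> v -> Cmod (peak v z) < 1.
Proof.
  intros Hv Hz Hn. rewrite Cmod_peak.
  set (y := (Cconj v * z)%C).
  assert (Hy : Cmod y <= 1) by (unfold y; rewrite Cmod_mult, Cmod_conj, Hv; lra).
  assert (Hy1 : y <> 1) by (intros h; apply Hn; apply Cconj_mult_circle; auto).
  assert (HR : Re y < 1).
  { pose proof (re_le_Cmod y). pose proof (Rle_abs (Re y)).
    destruct (Req_dec (Re y) 1) as [E|]; [|lra].
    exfalso. apply Hy1. assert (E2 := Cmod2_alt y). rewrite E in E2.
    assert (Cmod y ^ 2 <= 1) by (pose proof (Cmod_ge_0 y); nra).
    assert (Im y = 0) by nra. destruct y as [a b]; simpl in *. subst. reflexivity. }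
  assert (E : Cmod (1 + y) ^ 2 = 1 + 2 * Re y + Cmod y ^ 2).
  { rewrite !Cmod2_alt. destruct y; simpl; ring. }
  pose proof (Cmod_ge_0 (1 + y)). pose proof (Cmod_ge_0 y).
  assert (Cmod (1 + y) < 2) by nra. lra.
Qed.

Lemma peak_alg v : disc_alg (peak v).
Proof.
  apply (disc_alg_div (fun z => 1 + Cconj v * z)%C (fun _ => 2)).
  - intros; apply C2_neq0.
  - apply disc_alg_plus; [apply disc_alg_const|].
    apply disc_alg_mult; [apply disc_alg_const|apply disc_alg_id].
  - apply disc_alg_const.
Qed.

Section Eigen.
Variables (mu v : C).
Hypothesis mu_neq0 : mu <> 0.
Hypothesis v_circ : Cmod v = 1.

(* [elem K j] is [mu^-j T^j] applied to the [K]-th power of the peak function at [v]. *)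
Definition elem (K j : nat) (z : C) : C := (/ mu ^ j * wn j z * peak v (Bn B j z) ^ K)%C.

Definition psum (c : nat -> C) (J K : nat) (z : C) : C := csum (fun j => c j * elem K j z)%C J.

Lemma elem_alg K j : disc_alg (elem K j).
Proof.
  apply disc_alg_mult.
  - apply disc_alg_mult; [apply disc_alg_const|apply wn_alg].
  - apply (disc_alg_pow (fun z => peak v (Bn B j z))).
    apply disc_alg_comp; auto using peak_alg, Bn_alg, Bn_open_disc, Bn_disc.
Qed.

Lemma psum_alg c J K : disc_alg (psum c J K).
Proof.
  induction J; [apply disc_alg_const|].
  apply (disc_alg_plus (psum c J K) (fun z => c J * elem K J z)%C); auto.
  apply disc_alg_mult; [apply disc_alg_const|apply elem_alg].
Qed.

Lemma mu_pow_neq0 j : (mu ^ j)%C <> 0.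
Proof.
  induction j; simpl; [intros h; apply RtoC_inj in h; lra|]. now apply Cmult_neq_0.
Qed.

Lemma elem_shift K j z : (w z * elem K j (B z) = mu * elem K (S j) z)%C.
Proof.
  unfold elem. rewrite Bn_S_r. simpl. assert (H := mu_pow_neq0 j). field. auto.
Qed.

Lemma pow_small M rho e : 0 <= rho < 1 -> 0 < e -> exists K0, forall K, (K0 <= K)%nat -> M * rho ^ K < e.
Proof.
  intros Hr He. set (M' := Rabs M + 1). assert (HM : 0 < M') by (unfold M'; pose proof (Rabs_pos M); lra).
  destruct (pow_lt_1_zero rho ltac:(rewrite Rabs_pos_eq; lra) (e / M')) as (K0 & HK).
  { now apply Rdiv_lt_0_compat. }
  exists K0. intros K HK0. specialize (HK K HK0).
  rewrite Rabs_pos_eq in HK by (apply pow_le; lra).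
  apply Rmult_lt_compat_r with (r := M') in HK; auto.
  replace (e / M' * M') with e in HK by (field; lra).
  pose proof (pow_le rho K (proj1 Hr)). pose proof (Rle_abs M). unfold M' in HK. nra.
Qed.

Lemma elem_small_on (D : C -> Prop) rho j :
  (forall z, D z -> Cmod z <= 1) -> 0 <= rho < 1 ->
  (forall z, D z -> Cmod (peak v (Bn B j z)) <= rho) ->
  forall (c : C) eta, 0 < eta -> exists K0, forall K z, (K0 <= K)%nat -> D z -> Cmod (c * elem K j z) <= eta.
Proof.
  intros HD Hr HG c eta He.
  destruct (disc_alg_bounded _ (disc_alg_mult (fun _ => c * / mu ^ j)%C (wn j) (disc_alg_const _) (wn_alg j))) as (M & HM).
  destruct (pow_small M rho eta Hr He) as (K0 & HK). exists K0. intros K z HK0 Hz.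
  specialize (HK K HK0). specialize (HM z (HD z Hz)). specialize (HG z Hz).
  unfold elem. replace (c * (/ mu ^ j * wn j z * peak v (Bn B j z) ^ K))%C
    with (c * / mu ^ j * wn j z * peak v (Bn B j z) ^ K)%C by ring.
  rewrite (Cmod_mult (c * / mu ^ j * wn j z)), Cmod_pow.
  eapply Rle_trans; [|left; apply HK].
  apply Rmult_le_compat; auto using Cmod_ge_0.
  - apply pow_le, Cmod_ge_0.
  - apply pow_incr. split; auto using Cmod_ge_0.
Qed.

(** [B^J] keeps the disc of radius [r] in one of radius [r' < 1], where the peak function is at most
    [(1 + r') / 2]. *)
Lemma psum_small_inside c J r eta : 0 <= r < 1 -> 0 < eta ->
  exists K0, forall K z, (K0 <= K)%nat -> Cmod z <= r -> Cmod (psum c J K z) <= eta.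
Proof.
  intros Hr. revert eta. induction J; intros eta He.
  - exists 0%nat. intros. unfold psum. simpl. rewrite Cmod_0. lra.
  - destruct (IHJ (eta / 2) ltac:(lra)) as (K1 & H1).
    destruct (Bn_contr J r Hr) as (r' & Hr' & Kr').
    destruct (elem_small_on (fun z => Cmod z <= r) ((1 + r') / 2) J) with (c := c J) (eta := eta / 2) as (K2 & H2).
    + intros; lra.
    + lra.
    + intros z Hz. eapply Rle_trans; [now apply peak_le|]. specialize (Kr' z Hz). lra.
    + lra.
    + exists (max K1 K2). intros K z HK Hz. specialize (H1 K z ltac:(lia) Hz). specialize (H2 K z ltac:(lia) Hz).
      unfold psum in *. simpl csum. eapply Rle_trans; [apply Cmod_triangle|]. lra.
Qed.

Lemma elem_local_no_hit (c : C) t j eta : Cmod t <= 1 -> Bn B j t <> v -> 0 < eta ->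
  exists del K0, 0 < del /\ forall K z, (K0 <= K)%nat -> Cmod z <= 1 -> Cmod (z - t) < del ->
    Cmod (c * elem K j z) <= eta.
Proof.
  intros Ht Hn He.
  assert (Hlt := peak_lt v (Bn B j t) v_circ (Bn_disc j t Ht) Hn).
  set (p := Cmod (peak v (Bn B j t))) in *. assert (Hp : 0 <= p) by apply Cmod_ge_0.
  assert (Cg : disc_alg (fun z => peak v (Bn B j z)))
    by (apply disc_alg_comp; auto using peak_alg, Bn_alg, Bn_open_disc, Bn_disc).
  destruct (proj2 Cg t Ht ((1 - p) / 2) ltac:(lra)) as (del & Hdel & Kd).
  destruct (elem_small_on (fun z => Cmod z <= 1 /\ Cmod (z - t) < del) ((1 + p) / 2) j) with (c := c) (eta := eta) as (K0 & H0).
  - intros z Hz; apply Hz.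
  - lra.
  - intros z (Hz & Hzt). specialize (Kd z Hz Hzt).
    pose proof (Cmod_le_sub (peak v (Bn B j z)) (peak v (Bn B j t))). fold p in H. lra.
  - auto.
  - exists del, K0. split; auto.
Qed.

Lemma psum_local_no_hit c J t eta : Cmod t <= 1 -> (forall j, (j < J)%nat -> Bn B j t <> v) -> 0 < eta ->
  exists del K0, 0 < del /\ forall K z, (K0 <= K)%nat -> Cmod z <= 1 -> Cmod (z - t) < del ->
    Cmod (psum c J K z) <= eta.
Proof.
  intros Ht. revert eta. induction J; intros eta Hn He.
  - exists 1, 0%nat. split; [lra|]. intros. unfold psum. simpl. rewrite Cmod_0. lra.
  - destruct (IHJ (eta / 2)) as (d1 & K1 & Hd1 & H1); [auto|lra|].
    destruct (elem_local_no_hit (c J) t J (eta / 2) Ht (Hn J ltac:(lia)) ltac:(lra)) as (d2 & K2 & Hd2 & H2).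
    exists (Rmin d1 d2), (max K1 K2). split; [now apply Rmin_glb_lt|]. intros K z HK Hz Hzt.
    specialize (H1 K z ltac:(lia) Hz (Rlt_le_trans _ _ _ Hzt (Rmin_l _ _))).
    specialize (H2 K z ltac:(lia) Hz (Rlt_le_trans _ _ _ Hzt (Rmin_r _ _))).
    unfold psum in *. simpl csum. eapply Rle_trans; [apply Cmod_triangle|]. lra.
Qed.

(** The forward orbit of [t] meets [v] for at most one index below [J]. Near [t] every other term
    decays as [K] grows, and the exceptional term is bounded by its coefficient because the peak
    function has modulus at most [1]. So the sum behaves like a maximum rather than a sum of its
    terms. *)
Lemma psum_local c J t A eta : Cmod t <= 1 -> 0 <= A ->
  (forall j, (j < J)%nat -> Bn B j t = v -> Cmod (c j * / mu ^ j * wn j t) <= A) ->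
  (forall i j, (i < j < J)%nat -> Bn B i t = v -> Bn B j t <> v) -> 0 < eta ->
  exists del K0, 0 < del /\ forall K z, (K0 <= K)%nat -> Cmod z <= 1 -> Cmod (z - t) < del ->
    Cmod (psum c J K z) <= A + eta.
Proof.
  intros Ht HA. revert eta. induction J; intros eta Hc Hu He.
  - exists 1, 0%nat. split; [lra|]. intros. unfold psum. simpl. rewrite Cmod_0. lra.
  - destruct (classic (Bn B J t = v)) as [Hit|Hit].
    + destruct (psum_local_no_hit c J t (eta / 2) Ht) as (d1 & K1 & Hd1 & H1); [|lra|].
      { intros j Hj h. apply (Hu j J ltac:(lia) h Hit). }
      assert (Cg : disc_alg (fun z => c J * / mu ^ J * wn J z)%C)
        by (apply disc_alg_mult; [apply disc_alg_const|apply wn_alg]).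
      destruct (proj2 Cg t Ht (eta / 2) ltac:(lra)) as (d2 & Hd2 & H2).
      exists (Rmin d1 d2), K1. split; [now apply Rmin_glb_lt|]. intros K z HK Hz Hzt.
      specialize (H1 K z HK Hz (Rlt_le_trans _ _ _ Hzt (Rmin_l _ _))).
      specialize (H2 z Hz (Rlt_le_trans _ _ _ Hzt (Rmin_r _ _))).
      specialize (Hc J ltac:(lia) Hit).
      pose proof (Cmod_le_sub (c J * / mu ^ J * wn J z) (c J * / mu ^ J * wn J t)) as Q.
      assert (E : Cmod (c J * elem K J z) <= A + eta / 2).
      { unfold elem. replace (c J * (/ mu ^ J * wn J z * peak v (Bn B J z) ^ K))%C
          with (c J * / mu ^ J * wn J z * peak v (Bn B J z) ^ K)%C by ring.
        rewrite (Cmod_mult (c J * / mu ^ J * wn J z)), Cmod_pow.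
        assert (P := peak_le v (Bn B J z) v_circ). assert (P2 := Bn_disc J z Hz).
        assert (P3 : Cmod (peak v (Bn B J z)) ^ K <= 1).
        { rewrite <- (pow1 K). apply pow_incr. split; [apply Cmod_ge_0|lra]. }
        pose proof (Cmod_ge_0 (c J * / mu ^ J * wn J z)).
        assert (P4 : Cmod (c J * / mu ^ J * wn J z) * Cmod (peak v (Bn B J z)) ^ K
           <= Cmod (c J * / mu ^ J * wn J z) * 1) by (apply Rmult_le_compat_l; auto).
        lra. }
      unfold psum in *. simpl csum. eapply Rle_trans; [apply Cmod_triangle|]. lra.
    + destruct (IHJ (eta / 2)) as (d1 & K1 & Hd1 & H1); [auto| |lra|].
      { intros i j Hij. apply Hu. lia. }
      destruct (elem_local_no_hit (c J) t J (eta / 2) Ht Hit ltac:(lra)) as (d2 & K2 & Hd2 & H2).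
      exists (Rmin d1 d2), (max K1 K2). split; [now apply Rmin_glb_lt|]. intros K z HK Hz Hzt.
      specialize (H1 K z ltac:(lia) Hz (Rlt_le_trans _ _ _ Hzt (Rmin_l _ _))).
      specialize (H2 K z ltac:(lia) Hz (Rlt_le_trans _ _ _ Hzt (Rmin_r _ _))).
      unfold psum in *. simpl csum. eapply Rle_trans; [apply Cmod_triangle|]. lra.
Qed.

(** Compactness turns the local bounds on the circle into one threshold [K0], and the maximum
    principle extends the bound to the disc. *)
Lemma psum_global c J A eta : 0 <= A ->
  (forall t j, Cmod t = 1 -> (j < J)%nat -> Bn B j t = v -> Cmod (c j * / mu ^ j * wn j t) <= A) ->
  (forall t i j, Cmod t = 1 -> (i < j < J)%nat -> Bn B i t = v -> Bn B j t <> v) -> 0 < eta ->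
  exists K0, forall K z, (K0 <= K)%nat -> Cmod z <= 1 -> Cmod (psum c J K z) <= A + eta.
Proof.
  intros HA Hc Hu He. apply NNPP. intros N.
  assert (Hz : forall n : nat, {z : C | Cmod z = 1 /\ exists K, (n <= K)%nat /\ A + eta < Cmod (psum c J K z)}).
  { intros n. apply constructive_indefinite_description. apply NNPP. intros Q. apply N. exists n.
    intros K z HK. apply max_principle; [apply psum_alg|].
    intros y Hy. apply Rnot_lt_le. intros h. apply Q. eauto. }
  destruct (circle_compact (fun n => proj1_sig (Hz n))) as (t & Ht & Ad).
  { intros n. apply (proj2_sig (Hz n)). }
  destruct (psum_local c J t A eta) as (del & K0 & Hdel & H0); auto; [lra|intros i j Hij; apply (Hu t i j); auto|].
  destruct (Ad del K0 Hdel) as (n & Hn & Hnt). destruct (Hz n) as (z & Z1 & K & HK & Z2). simpl in Hnt.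
  specialize (H0 K z ltac:(lia) ltac:(lra) Hnt). lra.
Qed.

(** Backward differences of the coefficients, with [0] understood before index [0]. *)
Definition dcoef (c : nat -> C) (j : nat) : C := match j with O => (- c O)%C | S i => (c i - c (S i))%C end.

(* Summation by parts: this is why slowly varying coefficients give approximate eigenvectors. *)
Lemma wco_psum c J K z :
  (wco w B (psum c (S J) K) z - mu * psum c (S J) K z =
   mu * psum (dcoef c) (S J) K z + mu * c J * elem K (S J) z)%C.
Proof.
  unfold wco, psum. induction J.
  - simpl csum. simpl dcoef.
    replace (w z * (0 + c O * elem K 0 (B z)))%C with (c O * (w z * elem K 0 (B z)))%C by ring.
    rewrite elem_shift. ring.
  - change (csum (fun j => c j * elem K j (B z))%C (S (S J)))
      with (csum (fun j => c j * elem K j (B z)) (S J) + c (S J) * elem K (S J) (B z))%C.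
    change (csum (fun j => c j * elem K j z)%C (S (S J)))
      with (csum (fun j => c j * elem K j z) (S J) + c (S J) * elem K (S J) z)%C.
    change (csum (fun j => dcoef c j * elem K j z)%C (S (S J)))
      with (csum (fun j => dcoef c j * elem K j z) (S J) + (c J - c (S J)) * elem K (S J) z)%C.
    set (s1 := csum (fun j => c j * elem K j (B z))%C (S J)) in *.
    set (s2 := csum (fun j => c j * elem K j z)%C (S J)) in *.
    set (s3 := csum (fun j => dcoef c j * elem K j z)%C (S J)) in *.
    replace (w z * (s1 + c (S J) * elem K (S J) (B z)) - mu * (s2 + c (S J) * elem K (S J) z))%C
      with ((w z * s1 - mu * s2) + c (S J) * (w z * elem K (S J) (B z)) - mu * c (S J) * elem K (S J) z)%C by ring.
    rewrite elem_shift, IHJ. ring.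
Qed.

End Eigen.

Lemma csum_single (u : nat -> C) M J : (M < J)%nat -> (forall j, j <> M -> u j = 0) -> csum u J = u M.
Proof.
  intros HM Hu. induction J; [lia|]. simpl. destruct (Nat.eq_dec M J) as [->|n].
  - assert (E : csum u J = 0).
    { rewrite (csum_ext u (fun _ => 0) J); [now apply csum_zero|]. intros k Hk. apply Hu. lia. }
    rewrite E. ring.
  - rewrite IHJ, (Hu J) by lia. ring.
Qed.

(** Height [1] at [M], zero at [0] and [2 * M], slope [1 / M]: the values at the ends remove the
    boundary terms of the summation by parts, and the slope makes the residual of order [1 / M]. *)
Definition tent (M j : nat) : R := 1 - Rabs (INR j - INR M) / INR M.

Lemma tent_step M j : (1 <= M)%nat -> Rabs (tent M j - tent M (S j)) <= / INR M.
Proof.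
  intros HM. assert (HM' : 0 < INR M) by (apply lt_0_INR; lia).
  unfold tent. rewrite S_INR.
  replace (1 - Rabs (INR j - INR M) / INR M - (1 - Rabs (INR j + 1 - INR M) / INR M))
    with ((Rabs (INR j + 1 - INR M) - Rabs (INR j - INR M)) * / INR M) by (field; lra).
  rewrite Rabs_mult, (Rabs_pos_eq (/ INR M)) by (left; now apply Rinv_0_lt_compat).
  rewrite <- (Rmult_1_l (/ INR M)) at 2. apply Rmult_le_compat_r; [left; now apply Rinv_0_lt_compat|].
  eapply Rle_trans; [apply Rabs_triang_inv2|].
  replace (INR j + 1 - INR M - (INR j - INR M)) with 1 by ring. rewrite Rabs_pos_eq; lra.
Qed.

Lemma tent_ends M : (1 <= M)%nat -> tent M 0 = 0 /\ tent M M = 1 /\ tent M (2 * M) = 0.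
Proof.
  intros HM. assert (HM' : 0 < INR M) by (apply lt_0_INR; lia).
  unfold tent. rewrite mult_INR. simpl INR. repeat split.
  - rewrite Rminus_0_l, Rabs_Ropp, Rabs_pos_eq by lra. field. lra.
  - rewrite Rminus_diag, Rabs_R0. field. lra.
  - replace ((1 + 1) * INR M - INR M) with (INR M) by ring. rewrite Rabs_pos_eq by lra. field. lra.
Qed.

Lemma supnorm_eq f m : (forall z, Cmod z <= 1 -> Cmod (f z) <= m) ->
  (exists t, Cmod t <= 1 /\ Cmod (f t) = m) -> supnorm f = m.
Proof.
  intros H (t & Ht & E). apply Rle_antisym; [now apply supnorm_le|].
  rewrite <- E. now apply (le_supnorm f m).
Qed.

(** The upper bound, over all preimages of [v], controls the residual; the lower bound at the single
    point [u] keeps the norm of the sum away from [0]. As [v] is not periodic, no forward orbit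
    meets it twice. *)
Lemma approx_eigen_of_orbits (mu : C) : mu <> 0 ->
  (forall M0, exists M u v, (M0 <= M)%nat /\ Cmod u = 1 /\ Bn B M u = v /\
     (forall k, (1 <= k)%nat -> Bn B k v <> v) /\
     (forall j t, (j <= 2 * M)%nat -> Cmod t = 1 -> Bn B j t = v -> Cmod (wn j t) <= 2 * Cmod mu ^ j) /\
     Cmod mu ^ M / 2 <= Cmod (wn M u)) ->
  approx_eigen mu.
Proof.
  intros Hmu H eps He.
  assert (Hm : 0 < Cmod mu) by exact (proj1 (Cmod_gt_0 _) Hmu).
  (* The residual will be at most [3 * |mu| / M] and the norm at least [1 / 4], whence [12]. *)
  destruct (INR_archimed eps (12 * Cmod mu) He) as (M1 & HM1).
  destruct (H (S M1)) as (M & u & v & HM & Hu & Euv & Hnp & Hup & Hlow).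
  assert (HM0 : (1 <= M)%nat) by lia.
  assert (HMp : 0 < INR M) by (apply lt_0_INR; lia).
  assert (HMe : 12 * Cmod mu * / INR M <= eps).
  { apply Rmult_le_reg_r with (INR M); auto. rewrite Rmult_assoc, Rinv_l, Rmult_1_r by lra.
    assert (INR M1 <= INR M) by (apply le_INR; lia). nra. }
  assert (Hv : Cmod v = 1) by (rewrite <- Euv; now apply Bn_circ).
  destruct (tent_ends M HM0) as (Te0 & TeM & Te2).
  assert (Hpj : forall j, 0 < Cmod mu ^ j) by (intros; now apply pow_lt).
  assert (Hinv : forall j, Cmod (/ mu ^ j) = / Cmod mu ^ j).
  { intros j. rewrite Cmod_inv, Cmod_pow; auto. now apply mu_pow_neq0. }
  assert (Huniq : forall t i j, (i < j)%nat -> Bn B i t = v -> Bn B j t <> v).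
  { intros t i j Hij Ei Ej. apply (Hnp (j - i)%nat); [lia|].
    rewrite <- Ei at 1. rewrite <- Bn_add. replace (j - i + i)%nat with j by lia. auto. }
  set (c := fun j => RtoC (tent M j)).
  set (J := S (2 * M)).
  assert (HiM : 0 < / INR M) by now apply Rinv_0_lt_compat.
  destruct (psum_global mu v Hv (dcoef c) J (2 * / INR M) (/ INR M)) as (K1 & HK1).
  { lra. }
  { intros t j Ht Hj Et.
    assert (Hd : Cmod (dcoef c j) <= / INR M).
    { destruct j as [|j]; simpl; unfold c.
      - rewrite Te0. replace (- 0)%C with (RtoC 0) by ring. rewrite Cmod_0. lra.
      - rewrite <- RtoC_minus, Cmod_R. now apply tent_step. }
    rewrite !Cmod_mult, Hinv. specialize (Hup j t ltac:(unfold J in Hj; lia) Ht Et).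
    assert (/ Cmod mu ^ j * Cmod (wn j t) <= 2).
    { apply Rle_trans with (/ Cmod mu ^ j * (2 * Cmod mu ^ j)).
      - apply Rmult_le_compat_l; auto. left. now apply Rinv_0_lt_compat.
      - right. field. specialize (Hpj j). lra. }
    rewrite Rmult_assoc, (Rmult_comm 2). apply Rmult_le_compat; auto using Cmod_ge_0.
    apply Rmult_le_pos; [left; now apply Rinv_0_lt_compat|apply Cmod_ge_0]. }
  { intros t i j _ Hij. apply Huniq. lia. }
  { auto. }
  (* At [u] only the term with index [M] meets [v]. Without it the sum is at most [1 / 4] there,
     while the term itself has modulus at least [1 / 2]. *)
  set (c' := fun j => if Nat.eq_dec j M then RtoC 0 else c j).
  destruct (psum_local mu v Hv c' J u 0 (1 / 4)) as (del & K2 & Hdel & HK2); try lra.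
  { intros j Hj Ej. assert (j = M).
    { destruct (Nat.lt_total j M) as [h|[h|h]]; auto; exfalso.
      - apply (Huniq u j M h Ej Euv). - apply (Huniq u M j h Euv Ej). }
    subst j. unfold c'. destruct (Nat.eq_dec M M); [|contradiction].
    replace (0 * / mu ^ M * wn M u)%C with (RtoC 0) by ring. rewrite Cmod_0. lra. }
  { intros i j Hij. apply Huniq. lia. }
  set (r := Rmax 0 (1 - eps)).
  assert (Hr : 0 <= r < 1) by (unfold r; split; [apply Rmax_l|apply Rmax_lub_lt; lra]).
  destruct (psum_small_inside mu v Hv c J r (eps / 4) Hr ltac:(lra)) as (K3 & HK3).
  set (K := max K1 (max K2 K3)).
  specialize (HK1 K). specialize (HK2 K u ltac:(unfold K; lia) ltac:(lra) ltac:(rewrite Cmod_sub_self; auto)).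
  specialize (HK3 K).
  set (y := psum mu v c J K).
  assert (Hy : disc_alg y) by apply psum_alg.
  set (N := supnorm y).
  assert (HN : 1 / 4 <= N).
  { apply Rle_trans with (Cmod (y u)); [|apply le_supnorm_disc_alg; auto; lra].
    assert (E : (y u = psum mu v c' J K u + elem mu v K M u)%C).
    { assert (E1 : (y u - psum mu v c' J K u = elem mu v K M u)%C).
      { unfold y, psum. rewrite <- csum_minus.
        rewrite (csum_single _ M); [|unfold J; lia|].
        - unfold c', c. destruct (Nat.eq_dec M M); [|contradiction]. rewrite TeM. ring.
        - intros j Hj. unfold c'. destruct (Nat.eq_dec j M); [contradiction|]. ring. }
      rewrite <- E1. ring. }
    assert (El : 1 / 2 <= Cmod (elem mu v K M u)).
    { unfold elem. rewrite Euv, peak_at by auto.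
      replace (1 ^ K)%C with (RtoC 1) by (rewrite <- RtoC_pow, pow1; auto).
      rewrite Cmult_1_r, Cmod_mult, Hinv.
      apply Rmult_le_reg_l with (Cmod mu ^ M); auto. rewrite <- Rmult_assoc, Rinv_r; [lra|].
      specialize (Hpj M). lra. }
    pose proof (Cmod_le_sub (elem mu v K M u) (y u)) as Q.
    replace (elem mu v K M u - y u)%C with (- psum mu v c' J K u)%C in Q by (rewrite E; ring).
    rewrite Cmod_opp in Q. lra. }
  assert (HN0 : RtoC N <> 0) by (intros h; apply RtoC_inj in h; lra).
  assert (HiN : Cmod (/ N) <= 4).
  { rewrite <- RtoC_inv by lra. rewrite Cmod_R, Rabs_pos_eq by (left; apply Rinv_0_lt_compat; lra).
    replace 4 with (/ (1 / 4)) by field. apply Rinv_le_contravar; lra. }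
  exists (fun z => / N * y z)%C. split; [|split; [|split]].
  - apply disc_alg_mult; auto. apply disc_alg_const.
  - assert (HiN' : Cmod (/ N) * N = 1).
    { rewrite <- RtoC_inv by lra. rewrite Cmod_R, Rabs_pos_eq by (left; apply Rinv_0_lt_compat; lra). field. lra. }
    apply supnorm_eq.
    + intros z Hz. rewrite Cmod_mult. rewrite <- HiN'. apply Rmult_le_compat_l; [apply Cmod_ge_0|].
      now apply le_supnorm_disc_alg.
    + destruct (supnorm_attained y Hy) as (t & Ht & Et). exists t. split; [lra|].
      rewrite Cmod_mult, Et. exact HiN'.
  - intros z Hz. specialize (HK1 z ltac:(unfold K; lia) Hz).
    assert (E := wco_psum mu v Hmu c (2 * M) K z).
    replace (c (2 * M)%nat) with (RtoC 0) in E by (unfold c; rewrite Te2; auto).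
    unfold wco in *. fold J in E. fold y in E.
    replace (w z * (/ N * y (B z)) - mu * (/ N * y z))%C
      with (/ N * (w z * y (B z) - mu * y z))%C by ring.
    rewrite E. replace (mu * psum mu v (dcoef c) J K z + mu * 0 * elem mu v K J z)%C
      with (mu * psum mu v (dcoef c) J K z)%C by ring.
    rewrite !Cmod_mult.
    apply Rle_trans with (4 * (Cmod mu * (3 * / INR M))).
    + apply Rmult_le_compat; auto using Cmod_ge_0.
      * apply Rmult_le_pos; apply Cmod_ge_0.
      * apply Rmult_le_compat_l; lra.
    + lra.
  - intros z Hz. rewrite Cmod_mult.
    specialize (HK3 z ltac:(unfold K; lia) ltac:(unfold r; eapply Rle_trans; [apply Hz|apply Rmax_r])).
    fold y in HK3. pose proof (Cmod_ge_0 (/ N)). pose proof (Cmod_ge_0 (y z)).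
    apply Rle_trans with (4 * (eps / 4)); [apply Rmult_le_compat; auto|lra].
Qed.

End WeightedComposition.

(** * Periodic orbits of a circle covering *)

Lemma continuity_eps h x : continuity h -> forall e, 0 < e -> exists d, 0 < d /\
  forall y, Rabs (y - x) < d -> Rabs (h y - h x) < e.
Proof.
  intros H e He. destruct (H x e He) as (d & Hd & K). exists d. split; auto.
  intros y Hy. destruct (Req_dec y x) as [->|n]; [rewrite Rminus_diag, Rabs_R0; auto|].
  apply K. split; [split; [exact I|auto]|exact Hy].
Qed.

(** [F x - x] gains [(d - 1) T] over each period, so [F x <= x] holds somewhere but not far to the
    right. The supremum of such points is fixed by continuity. The inequality beyond it supplies the
    order structure for all later dynamics. *)
Lemma lift_last_fixed_point F (d : nat) T : 0 < T -> (2 <= d)%nat -> continuity F ->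
  (forall x y, x < y -> F x < F y) -> (forall x, F (x + T) = F x + INR d * T) ->
  exists x0, F x0 = x0 /\ forall x, x0 < x -> x < F x.
Proof.
  intros HT Hd CF IF PF.
  assert (Hd2 : 2 <= INR d) by (change 2 with (INR 2); now apply le_INR).
  assert (PN : forall n x, F (x + INR n * T) = F x + INR n * INR d * T).
  { induction n; intros x.
    - simpl. replace (x + 0 * T) with x by ring. ring.
    - rewrite S_INR. replace (x + (INR n + 1) * T) with ((x + INR n * T) + T) by ring.
      rewrite PF, IHn. ring. }
  destruct (INR_archimed T (Rabs (F 0) + T) HT) as (N & HN).
  pose proof (Rle_abs (F 0)). pose proof (Rle_abs (- F 0)). rewrite Rabs_Ropp in H0.
  pose proof (pos_INR N).
  destruct (completeness (fun x => F x <= x)) as (x0 & U & L).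
  { exists (INR N * T). intros x Hx. apply Rnot_lt_le. intros Hlt.
    destruct (exists_mod x T HT) as (k & Hk).
    assert (HkN : IZR (Z.of_nat N) <= IZR k).
    { rewrite <- INR_IZR_INZ. apply Rnot_lt_le. intros h.
      rewrite INR_IZR_INZ in h. apply lt_IZR in h.
      assert (IZR k + 1 <= INR N) by (rewrite INR_IZR_INZ, <- plus_IZR; apply IZR_le; lia). nra. }
    apply le_IZR in HkN.
    assert (Ek : IZR k = INR (Z.to_nat k)) by (rewrite INR_IZR_INZ, Z2Nat.id; auto; lia).
    rewrite Ek in Hk. set (n := Z.to_nat k) in *.
    assert (HnN : INR N <= INR n) by (apply le_INR; unfold n; lia).
    assert (Q := PN n 0). rewrite Rplus_0_l in Q.
    assert (F (INR n * T) <= F x) by (destruct (Req_dec (INR n * T) x) as [->|ne]; [lra|left; apply IF; lra]).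
    assert (INR n * T * 2 <= INR n * INR d * T) by nra. nra. }
  { exists (0 - INR N * T).
    assert (Q := PN N (0 - INR N * T)). replace (0 - INR N * T + INR N * T) with 0 in Q by ring.
    assert (INR N * T * 2 <= INR N * INR d * T) by nra. lra. }
  assert (Up : forall x, x0 < x -> x < F x).
  { intros x Hx. apply Rnot_le_lt. intros h. specialize (U x h). lra. }
  exists x0. split; auto.
  destruct (Rtotal_order (F x0) x0) as [h|[h|h]]; auto; exfalso.
  - destruct (continuity_eps F x0 CF (x0 - F x0) ltac:(lra)) as (e & He & K).
    specialize (K (x0 + e / 2)). specialize (Up (x0 + e / 2) ltac:(lra)).
    replace (x0 + e / 2 - x0) with (e / 2) in K by ring.
    rewrite (Rabs_pos_eq (e / 2)) in K by lra. specialize (K ltac:(lra)). apply Rabs_def2 in K. lra.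
  - destruct (continuity_eps F x0 CF (F x0 - x0) ltac:(lra)) as (e & He & K).
    assert (x0 <= x0 - e); [|lra]. apply L. intros x Hx. apply Rnot_lt_le. intros h'.
    assert (x <= x0) by (apply U; auto).
    specialize (K x ltac:(apply Rabs_def1; lra)). apply Rabs_def2 in K. lra.
Qed.

Definition tau : R := 2 * PI.

Section Dynamics.
Variables (B : C -> C) (F : R -> R) (d : nat) (x0 : R).

Definition pt (x : R) : C := cis (x + x0).

Hypothesis d_ge2 : (2 <= d)%nat.
Hypothesis F_cont : continuity F.
Hypothesis F_incr : forall x y, x < y -> F x < F y.
Hypothesis F_period : forall x, F (x + tau) = F x + INR d * tau.
Hypothesis F_0 : F 0 = 0.
Hypothesis F_gt : forall x, 0 < x -> x < F x.
Hypothesis B_pt : forall x, B (pt x) = pt (F x).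

Lemma tau_pos : 0 < tau.
Proof. unfold tau. pose proof PI_RGT_0. lra. Qed.

Lemma pt_circle x : Cmod (pt x) = 1.
Proof. apply Cmod_cis. Qed.

Lemma pt_period x (k : Z) : pt (x + IZR k * tau) = pt x.
Proof.
  unfold pt, tau. replace (x + IZR k * (2 * PI) + x0) with (x + x0 + IZR k * (2 * PI)) by ring.
  apply cis_period.
Qed.

Lemma pt_tau x : pt (x + tau) = pt x.
Proof. rewrite <- (pt_period x 1). f_equal. simpl. ring. Qed.

Lemma pt_surj t : Cmod t = 1 -> exists x, 0 <= x < tau /\ pt x = t.
Proof.
  intros Ht. destruct (cis_surj t Ht) as (y & _ & E).
  destruct (exists_mod (y - x0) tau tau_pos) as (k & Hk).
  exists (y - x0 - IZR k * tau). split; auto.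
  rewrite <- (pt_period _ k). rewrite <- E. unfold pt. f_equal. ring.
Qed.

Lemma pt_eq_mod x y : pt x = pt y -> exists k : Z, x = y + IZR k * tau.
Proof.
  intros H. apply cis_eq_mod in H. destruct H as (k & H). exists k. unfold tau. lra.
Qed.

Lemma pt_inj x y : 0 <= x < tau -> 0 <= y < tau -> pt x = pt y -> x = y.
Proof.
  intros Hx Hy H. apply pt_eq_mod in H. destruct H as (k & H).
  assert (k = 0)%Z; [|subst; lra].
  assert (-1 < IZR k < 1) by nra. destruct H0 as (H1 & H2).
  apply lt_IZR in H1. apply lt_IZR in H2. lia.
Qed.

Lemma pt_lip x y : Cmod (pt y - pt x) <= Rabs (y - x).
Proof. unfold pt. eapply Rle_trans; [apply cis_lip|]. right. f_equal. ring. Qed.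

Lemma pt_local del : 0 < del -> exists eta, 0 < eta /\
  forall x y, Cmod (pt y - pt x) < eta -> exists k : Z, Rabs (y - x - IZR k * tau) < del.
Proof.
  intros Hd. destruct (cis_local del Hd) as (eta & He & K). exists eta. split; auto.
  intros x y H. destruct (K _ _ H) as (k & Hk). exists k. unfold tau.
  replace (y - x - IZR k * (2 * PI)) with (y + x0 - (x + x0) - IZR k * (2 * PI)) by ring. auto.
Qed.

Lemma pt_seq_cv (u : nat -> R) x : Un_cv u x ->
  forall e, 0 < e -> exists N, forall n, (N <= n)%nat -> Cmod (pt (u n) - pt x) < e.
Proof.
  intros H e He. destruct (H e He) as (N & K). exists N. intros n Hn.
  eapply Rle_lt_trans; [apply pt_lip|]. apply K. auto.
Qed.

(** * Iterates of the lift, their inverses, and periodic points *)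

Definition Fn (n : nat) : R -> R := Nat.iter n F.

Lemma Fn_add n m x : Fn (n + m) x = Fn n (Fn m x).
Proof. unfold Fn. now rewrite Nat.iter_add. Qed.

Lemma Fn_S_r n x : Fn (S n) x = Fn n (F x).
Proof. rewrite <- Nat.add_1_r, Fn_add. reflexivity. Qed.

Lemma Bn_pt n x : Bn B n (pt x) = pt (Fn n x).
Proof. induction n; simpl; auto. unfold Bn in *. simpl. rewrite IHn. apply B_pt. Qed.

Lemma Fn_cont n : continuity (Fn n).
Proof.
  induction n; simpl.
  - apply derivable_continuous, derivable_id.
  - apply (continuity_comp (Fn n) F); auto.
Qed.

Lemma Fn_incr n x y : x < y -> Fn n x < Fn n y.
Proof. intros H. induction n; simpl; auto. Qed.

Lemma Fn_le n x y : x <= y -> Fn n x <= Fn n y.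
Proof. intros [H| ->]; [left; now apply Fn_incr|lra]. Qed.

Lemma Fn_lt_inv n x y : Fn n x < Fn n y -> x < y.
Proof. intros H. apply Rnot_le_lt. intros h. apply (Fn_le n) in h. lra. Qed.

Lemma Fn_inj n x y : Fn n x = Fn n y -> x = y.
Proof.
  intros H. destruct (Rtotal_order x y) as [h|[h|h]]; auto; apply (Fn_incr n) in h; lra.
Qed.

Lemma Fn_0 n : Fn n 0 = 0.
Proof. induction n; simpl; auto. rewrite IHn; auto. Qed.

Lemma Fn_pos n x : 0 < x -> 0 < Fn n x.
Proof. intros H. rewrite <- (Fn_0 n). now apply Fn_incr. Qed.

Lemma Fn_grow n m x : 0 < x -> (n < m)%nat -> Fn n x < Fn m x.
Proof.
  intros Hx H. induction H; simpl.
  - apply F_gt. now apply Fn_pos.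
  - eapply Rlt_trans; [apply IHle|]. apply F_gt. now apply Fn_pos.
Qed.

Lemma F_tau : 2 * tau <= F tau.
Proof.
  assert (E := F_period 0). rewrite Rplus_0_l, F_0 in E. rewrite E.
  assert (2 <= INR d) by (change 2 with (INR 2); now apply le_INR).
  pose proof tau_pos. nra.
Qed.

Lemma F_surj y : exists x, F x = y.
Proof.
  assert (PN : forall n x, F (x + INR n * tau) = F x + INR n * INR d * tau).
  { induction n; intros x.
    - simpl. replace (x + 0 * tau) with x by ring. ring.
    - rewrite S_INR. replace (x + (INR n + 1) * tau) with ((x + INR n * tau) + tau) by ring.
      rewrite F_period, IHn. ring. }
  pose proof tau_pos as HT.
  destruct (INR_archimed tau (Rabs y) HT) as (N & HN).
  assert (Hd : 2 <= INR d) by (change 2 with (INR 2); now apply le_INR).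
  pose proof (pos_INR N).
  assert (E1 := PN N 0). rewrite Rplus_0_l, F_0, Rplus_0_l in E1.
  assert (E2 := PN N (- (INR N * tau))). rewrite Rplus_opp_l, F_0 in E2.
  assert (INR N * tau <= INR N * INR d * tau).
  { assert (0 <= (INR N * tau) * (INR d - 1)) by (apply Rmult_le_pos; [apply Rmult_le_pos|]; lra). lra. }
  pose proof (Rle_abs y). pose proof (Rle_abs (- y)). rewrite Rabs_Ropp in H2.
  set (q := INR N * INR d * tau) in *. set (p := INR N * tau) in *.
  destruct (IVT_gen F (- p) p y F_cont) as (x & _ & Hx); eauto.
  rewrite E1. replace (F (- p)) with (- q) by lra.
  rewrite Rmin_left, Rmax_right; lra.
Qed.

Lemma Fn_surj n y : exists x, Fn n x = y.
Proof.
  revert y. induction n; intros y; [exists y; auto|].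
  destruct (F_surj y) as (u & <-). destruct (IHn u) as (x & <-). exists x. auto.
Qed.

Definition Gn (n : nat) (y : R) : R := proj1_sig (constructive_indefinite_description _ (Fn_surj n y)).

Lemma Fn_Gn n y : Fn n (Gn n y) = y.
Proof. unfold Gn. destruct (constructive_indefinite_description _ _); auto. Qed.

Lemma Fn_open n x e : 0 < e -> exists del, 0 < del /\
  forall y, Rabs (y - Fn n x) < del -> exists x', Rabs (x' - x) < e /\ Fn n x' = y.
Proof.
  intros He.
  assert (H1 := Fn_incr n x (x + e) ltac:(lra)). assert (H2 := Fn_incr n (x - e) x ltac:(lra)).
  exists (Rmin (Fn n (x + e) - Fn n x) (Fn n x - Fn n (x - e))).
  split; [apply Rmin_glb_lt; lra|]. intros y Hy.
  assert (A1 := Rlt_le_trans _ _ _ Hy (Rmin_l _ _)). assert (A2 := Rlt_le_trans _ _ _ Hy (Rmin_r _ _)).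
  apply Rabs_def2 in A1. apply Rabs_def2 in A2.
  exists (Gn n y). split; [|apply Fn_Gn].
  assert (Gn n y < x + e) by (apply (Fn_lt_inv n); rewrite Fn_Gn; lra).
  assert (x - e < Gn n y) by (apply (Fn_lt_inv n); rewrite Fn_Gn; lra).
  apply Rabs_def1; lra.
Qed.

Lemma Un_cv_Fn n u x : Un_cv u x -> Un_cv (fun k => Fn n (u k)) (Fn n x).
Proof.
  intros H e He. destruct (continuity_eps _ x (Fn_cont n) e He) as (del & Hdel & K).
  destruct (H del Hdel) as (N & HN). exists N. intros k Hk. apply K, HN, Hk.
Qed.

(* Backward iteration of the branch [y |-> Fn m^-1 (y + tau)], starting from the
   fixed point, decreases to a point of period [m]. *)
Fixpoint hseq (m n : nat) : R := match n with O => tau | S n => Gn m (hseq m n + tau) end.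

Lemma hseq_S m n : Fn m (hseq m (S n)) = hseq m n + tau.
Proof. simpl. apply Fn_Gn. Qed.

Lemma hseq_pos m n : 0 < hseq m n.
Proof.
  pose proof tau_pos. induction n; [auto|].
  apply (Fn_lt_inv m). rewrite hseq_S, Fn_0. lra.
Qed.

Lemma hseq_decr m n : (2 <= m)%nat -> hseq m (S n) < hseq m n.
Proof.
  intros Hm. induction n; apply (Fn_lt_inv m); rewrite !hseq_S.
  - simpl hseq. assert (H := Fn_grow 1 m tau tau_pos ltac:(lia)). simpl in H. pose proof F_tau. lra.
  - lra.
Qed.

(** The limit of the decreasing backward iteration satisfies the limiting equation. The convergence
    is exported as well: the points of [hseq] are preimages of the fixed point that approach the
    periodic orbit, and later provide the nonperiodic [v]. *)
Lemma periodic_point m : (2 <= m)%nat -> exists x, 0 < x < tau /\ Fn m x = x + tau /\ Un_cv (hseq m) x /\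
  forall n, x <= hseq m n.
Proof.
  intros Hm.
  destruct (decreasing_cv (hseq m)) as (x & Hx).
  { intros n. left. now apply hseq_decr. }
  { exists 0. intros y (n & ->). unfold opp_seq. pose proof (hseq_pos m n). lra. }
  assert (Hle : forall n, x <= hseq m n).
  { apply (decreasing_ineq (hseq m)); auto. intros n. left. now apply hseq_decr. }
  assert (E : Fn m x = x + tau).
  { apply (UL_sequence (fun n => Fn m (hseq m (S n)))).
    - apply (Un_cv_Fn m (fun n => hseq m (S n))). intros e He. destruct (Hx e He) as (N & K). exists N. intros n Hn. apply K. lia.
    - intros e He. destruct (Hx e He) as (N & K). exists N. intros n Hn. rewrite hseq_S.
      specialize (K n Hn). unfold Rdist in *. replace (hseq m n + tau - (x + tau)) with (hseq m n - x) by ring. auto. }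
  assert (x < tau) by (specialize (Hle 1%nat); pose proof (hseq_decr m 0 Hm); simpl hseq in *; lra).
  assert (0 <= x).
  { apply Rnot_lt_le. intros h. destruct (Hx (- x) ltac:(lra)) as (N & K).
    specialize (K N (le_n _)). unfold Rdist in K. apply Rabs_def2 in K. pose proof (hseq_pos m N). lra. }
  exists x. repeat split; auto. destruct H0; auto. subst x. rewrite Fn_0 in E. pose proof tau_pos. lra.
Qed.

(** The shift by [2] meets the requirement [2 <= m], under which [hseq m] decreases strictly. *)
Definition xs (i : nat) : R :=
  proj1_sig (constructive_indefinite_description _ (periodic_point (i + 2) ltac:(lia))).

Lemma xs_spec i : 0 < xs i < tau /\ Fn (i + 2) (xs i) = xs i + tau /\ Un_cv (hseq (i + 2)) (xs i) /\
  forall n, xs i <= hseq (i + 2) n.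
Proof. unfold xs. destruct (constructive_indefinite_description _ _); auto. Qed.

Lemma xs_inj i i' : xs i = xs i' -> i = i'.
Proof.
  intros H. destruct (xs_spec i) as (H1 & E1 & _). destruct (xs_spec i') as (H2 & E2 & _).
  destruct (Nat.lt_total i i') as [h|[h|h]]; auto; exfalso.
  - pose proof (Fn_grow (i + 2) (i' + 2) (xs i) ltac:(lra) ltac:(lia)). rewrite H in *. lra.
  - pose proof (Fn_grow (i' + 2) (i + 2) (xs i) ltac:(lra) ltac:(lia)). rewrite H in *. lra.
Qed.

(* The points [gs l] form the orbit homoclinic to the fixed point on which the
   periodic orbits accumulate. *)
Definition gs (l : nat) : R := Gn l tau.

Lemma Fn_gs l : Fn l (gs l) = tau.
Proof. apply Fn_Gn. Qed.

Lemma gs_0 : gs 0 = tau.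
Proof. exact (Fn_gs 0). Qed.

Lemma gs_pos l : 0 < gs l.
Proof. apply (Fn_lt_inv l). rewrite Fn_gs, Fn_0. apply tau_pos. Qed.

Lemma F_gs l : F (gs (S l)) = gs l.
Proof. apply (Fn_inj l). rewrite <- Fn_S_r, !Fn_gs. reflexivity. Qed.

Lemma gs_decr l l' : (l < l')%nat -> gs l' < gs l.
Proof.
  intros H. induction H.
  - rewrite <- (F_gs l). apply F_gt, gs_pos.
  - eapply Rlt_trans; [|apply IHle]. rewrite <- (F_gs m). apply F_gt, gs_pos.
Qed.

Lemma gs_cv : Un_cv gs 0.
Proof.
  destruct (decreasing_cv gs) as (x & Hx).
  { intros n. left. apply gs_decr. lia. }
  { exists 0. intros y (n & ->). unfold opp_seq. pose proof (gs_pos n). lra. }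
  assert (E : F x = x).
  { apply (UL_sequence (fun n => F (gs (S n)))).
    - apply (Un_cv_Fn 1 (fun n => gs (S n))). intros e He. destruct (Hx e He) as (N & K). exists N. intros n Hn. apply K. lia.
    - intros e He. destruct (Hx e He) as (N & K). exists N. intros n Hn. rewrite F_gs. apply K; auto. }
  assert (0 <= x).
  { apply Rnot_lt_le. intros h. destruct (Hx (- x) ltac:(lra)) as (N & K).
    specialize (K N (le_n _)). unfold Rdist in K. apply Rabs_def2 in K. pose proof (gs_pos N). lra. }
  destruct H as [H|H]; [apply F_gt in H; lra|]. now subst x.
Qed.

Lemma xs_lt_gs i : xs i < gs (i + 1).
Proof.
  apply (Fn_lt_inv (i + 2)). destruct (xs_spec i) as (H & E & _). rewrite E.
  replace (i + 2)%nat with (1 + (i + 1))%nat by lia. rewrite Fn_add, Fn_gs. simpl.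
  pose proof F_tau. lra.
Qed.

Lemma xs_small e : 0 < e -> exists I, forall i, (I <= i)%nat -> xs i < e.
Proof.
  intros He. destruct (gs_cv e He) as (N & K). exists N. intros i Hi.
  specialize (K (i + 1)%nat ltac:(lia)). unfold Rdist in K. apply Rabs_def2 in K.
  pose proof (xs_lt_gs i). lra.
Qed.

(** After [i + 2 - j] further steps the orbit point has reached [xs i + tau], which lies between
    [tau] and [F tau]; pulling back places it in the fundamental interval with index [i + 1 - j]. *)
Lemma orbit_between i j : (j < i + 2)%nat ->
  gs (i + 2 - j) < Fn j (xs i) < gs (i + 1 - j) /\ Fn (i + 2 - j) (Fn j (xs i)) = xs i + tau.
Proof.
  intros Hj. destruct (xs_spec i) as (H & E & _).
  assert (E' : Fn (i + 2 - j) (Fn j (xs i)) = xs i + tau).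
  { rewrite <- Fn_add. replace (i + 2 - j + j)%nat with (i + 2)%nat by lia. auto. }
  split; auto. split.
  - apply (Fn_lt_inv (i + 2 - j)). rewrite E', Fn_gs. lra.
  - apply (Fn_lt_inv (i + 2 - j)). rewrite E'.
    replace (i + 2 - j)%nat with (1 + (i + 1 - j))%nat by lia. rewrite Fn_add, Fn_gs. simpl.
    pose proof F_tau. lra.
Qed.

Lemma orbit_range i j : (j < i + 2)%nat -> 0 < Fn j (xs i) < tau.
Proof.
  intros Hj. destruct (orbit_between i j Hj) as ((H1 & H2) & _). split.
  - pose proof (gs_pos (i + 2 - j)). lra.
  - destruct (Nat.eq_dec (i + 1 - j) 0) as [e|e]; [rewrite e, gs_0 in H2; auto|].
    pose proof (gs_decr 0 (i + 1 - j) ltac:(lia)). rewrite gs_0 in H. lra.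
Qed.

Lemma gs_interval l l' y : gs (S l) < y < gs l -> gs (S l') < y < gs l' -> l = l'.
Proof.
  intros H H'. destruct (Nat.lt_total l l') as [h|[h|h]]; auto; exfalso.
  - destruct (Nat.eq_dec (S l) l') as [<-|n]; [lra|]. pose proof (gs_decr (S l) l' ltac:(lia)). lra.
  - destruct (Nat.eq_dec (S l') l) as [<-|n]; [lra|]. pose proof (gs_decr (S l') l ltac:(lia)). lra.
Qed.

(** The fundamental interval determines [i - j], hence the number of steps to [xs i + tau]; that
    value then determines [i]. *)
Lemma orbit_inj i j i' j' : (j < i + 2)%nat -> (j' < i' + 2)%nat ->
  Fn j (xs i) = Fn j' (xs i') -> i = i' /\ j = j'.
Proof.
  intros Hj Hj' H.
  destruct (orbit_between i j Hj) as (H1 & E1). destruct (orbit_between i' j' Hj') as (H2 & E2).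
  assert (L : (i + 1 - j = i' + 1 - j')%nat).
  { apply gs_interval with (Fn j (xs i)).
    - replace (S (i + 1 - j)) with (i + 2 - j)%nat by lia. auto.
    - rewrite H. replace (S (i' + 1 - j')) with (i' + 2 - j')%nat by lia. auto. }
  assert (xs i = xs i').
  { replace (i + 2 - j)%nat with (i' + 2 - j')%nat in E1 by lia. rewrite H in E1. lra. }
  apply xs_inj in H0. subst. split; lia.
Qed.

(** * The closed invariant set [E] *)

Definition in_orbit (i : nat) (t : C) : Prop := exists j, (j < i + 2)%nat /\ t = pt (Fn j (xs i)).
(** The index starts at [S l] because [gs 0 = tau] represents the fixed point again. *)
Definition in_L (t : C) : Prop := t = pt 0 \/ exists l, t = pt (gs (S l)).
Definition in_E (t : C) : Prop := in_L t \/ exists i, in_orbit i t.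

Lemma gs_range l : 0 <= gs (S l) < tau.
Proof.
  pose proof (gs_pos (S l)). pose proof (gs_decr 0 (S l) ltac:(lia)). rewrite gs_0 in *. lra.
Qed.

Lemma orbit_not_L i t : in_orbit i t -> ~ in_L t.
Proof.
  intros (j & Hj & ->) [H|(l & H)].
  - pose proof (orbit_range i j Hj). apply pt_inj in H; [lra|lra|]. pose proof tau_pos; lra.
  - pose proof (orbit_range i j Hj). apply pt_inj in H; [|lra|apply gs_range].
    destruct (orbit_between i j Hj) as (H1 & _). rewrite H in H1.
    assert (L : (i + 1 - j < S l)%nat).
    { apply Nat.nle_gt. intros h. destruct (Nat.eq_dec (S l) (i + 1 - j)) as [e|e]; [rewrite e in H1; lra|].
      pose proof (gs_decr (S l) (i + 1 - j) ltac:(lia)). lra. }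
    destruct (Nat.eq_dec (S l) (i + 2 - j)) as [e|e]; [rewrite e in H1; lra|].
    pose proof (gs_decr (i + 2 - j) (S l) ltac:(lia)). lra.
Qed.

Lemma orbit_disjoint i i' t : in_orbit i t -> in_orbit i' t -> i = i'.
Proof.
  intros (j & Hj & ->) (j' & Hj' & E).
  pose proof (orbit_range i j Hj). pose proof (orbit_range i' j' Hj').
  apply pt_inj in E; try lra. apply orbit_inj in E; tauto.
Qed.

Lemma orbit_forward i t : in_orbit i t -> in_orbit i (B t).
Proof.
  intros (j & Hj & ->). rewrite B_pt. destruct (Nat.eq_dec (S j) (i + 2)) as [e|e].
  - exists 0%nat. split; [lia|]. change (F (Fn j (xs i))) with (Fn (S j) (xs i)).
    rewrite e. destruct (xs_spec i) as (_ & -> & _). apply pt_tau.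
  - exists (S j). split; [lia|auto].
Qed.

Lemma orbit_backward i t : in_orbit i t -> exists u, in_orbit i u /\ B u = t.
Proof.
  intros (j & Hj & ->). destruct j as [|j].
  - exists (pt (Fn (i + 1) (xs i))). split; [exists (i + 1)%nat; split; auto; lia|].
    rewrite B_pt. change (F (Fn (i + 1) (xs i))) with (Fn (S (i + 1)) (xs i)).
    replace (S (i + 1)) with (i + 2)%nat by lia.
    destruct (xs_spec i) as (_ & -> & _). apply pt_tau.
  - exists (pt (Fn j (xs i))). split; [exists j; split; auto; lia|]. apply B_pt.
Qed.

Lemma E_forward t : in_E t -> in_E (B t).
Proof.
  intros [[->|(l & ->)]|(i & H)].
  - left; left. rewrite B_pt, F_0; auto.
  - left. rewrite B_pt, F_gs. destruct l; [left|right; eauto].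
    rewrite gs_0. rewrite <- (Rplus_0_l tau). apply pt_tau.
  - right. exists i. now apply orbit_forward.
Qed.

Lemma E_circle t : in_E t -> Cmod t = 1.
Proof. intros [[->|(l & ->)]|(i & j & _ & ->)]; apply pt_circle. Qed.

(** Separation on the line passes to the circle because [x] is interior to the period interval, so
    no translate of [X] by a period comes near it. *)
Lemma pt_separated (X : R -> Prop) x e : 0 < x < tau -> 0 < e ->
  (forall y, X y -> 0 <= y < tau) -> (forall y, X y -> y <> x -> e <= Rabs (y - x)) ->
  exists eta, 0 < eta /\ forall y, X y -> y <> x -> eta <= Cmod (pt y - pt x).
Proof.
  intros Hx He HX HS.
  set (e' := Rmin e (Rmin x (tau - x))).
  assert (He' : 0 < e') by (repeat apply Rmin_glb_lt; lra).
  destruct (pt_local e' He') as (eta & Heta & K). exists eta. split; auto.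
  intros y Hy Hne. apply Rnot_lt_le. intros h.
  destruct (K _ _ h) as (k & Hk). specialize (HX y Hy).
  assert (A1 := Rlt_le_trans _ _ _ Hk (Rmin_l _ _)).
  assert (A2 := Rlt_le_trans _ _ _ Hk (Rmin_r _ _)).
  assert (A3 := Rlt_le_trans _ _ _ A2 (Rmin_l _ _)).
  assert (A4 := Rlt_le_trans _ _ _ A2 (Rmin_r _ _)).
  apply Rabs_def2 in A3. apply Rabs_def2 in A4.
  assert (k = 0)%Z.
  { assert (HT := tau_pos).
    destruct (Z.lt_trichotomy k 0) as [q|[q|q]]; auto; exfalso.
    - assert (IZR k <= -1) by (apply IZR_le; lia). nra.
    - assert (1 <= IZR k) by (apply IZR_le; lia). nra. }
  subst k. specialize (HS y Hy Hne). replace (y - x - 0 * tau) with (y - x) in A1 by ring. lra.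
Qed.

Definition E_lift (y : R) : Prop :=
  y = 0 \/ (exists l, y = gs (S l)) \/ exists i j, (j < i + 2)%nat /\ y = Fn j (xs i).

Lemma E_lift_range y : E_lift y -> 0 <= y < tau.
Proof.
  intros [->|[(l & ->)|(i & j & Hj & ->)]].
  - pose proof tau_pos; lra.
  - apply gs_range.
  - pose proof (orbit_range i j Hj); lra.
Qed.

Lemma in_E_lift t : in_E t <-> exists y, E_lift y /\ t = pt y.
Proof.
  split.
  - intros [[->|(l & ->)]|(i & j & Hj & ->)]; eexists; (split; [|reflexivity]); unfold E_lift; eauto 10.
  - intros (y & [->|[(l & ->)|(i & j & Hj & ->)]] & ->).
    + left; left; auto.
    + left; right; eauto.
    + right. exists i, j; auto.
Qed.

Lemma gs_bracket x : 0 < x < tau -> (forall l, x <> gs (S l)) -> exists l, gs (S l) < x < gs l.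
Proof.
  intros Hx Hn. destruct (gs_cv x ltac:(lra)) as (N & K).
  assert (HN : gs N < x).
  { specialize (K N (le_n _)). unfold Rdist in K. apply Rabs_def2 in K. lra. }
  clear K. induction N as [|N IH]; [rewrite gs_0 in HN; lra|].
  destruct (Rtotal_order (gs N) x) as [h|[h|h]]; auto.
  - exfalso. destruct N; [rewrite gs_0 in h; lra|]. apply (Hn N). auto.
  - exists N. lra.
Qed.

(** [t] lies in the interior of one fundamental interval, which contains no point of [L] and at most
    one point of each [O_i]. [F^(l+1)] maps that point to [xs i + tau], which tends to [tau],
    whereas it maps [x] strictly beyond [tau]; so only finitely many [O_i] come near. Since [t] need
    not belong to [E], this also expresses closedness away from [L]. *)
Lemma E_isolated t : Cmod t = 1 -> ~ in_L t ->
  exists eta, 0 < eta /\ forall e, in_E e -> e <> t -> eta <= Cmod (e - t).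
Proof.
  intros Ht HL. destruct (pt_surj t Ht) as (x & Hx & <-).
  assert (Hx0 : 0 < x).
  { destruct (Req_dec x 0) as [->|]; [|lra]. elim HL. left; auto. }
  destruct (gs_bracket x) as (l & Hl); [lra|intros l ->; apply HL; right; eauto|].
  set (c := Fn (S l) x - tau).
  assert (Hc : 0 < c).
  { unfold c. rewrite <- (Fn_gs (S l)). assert (Q := Fn_incr (S l) (gs (S l)) x ltac:(lra)). lra. }
  destruct (xs_small (c / 2) ltac:(lra)) as (N & HN).
  destruct (continuity_eps _ x (Fn_cont (S l)) (c / 2) ltac:(lra)) as (d1 & Hd1 & K1).
  (* For [j = i + 1 - l] the point of [O_i] in the interval of [x]; [1] is a dummy distance when
     that point is [x] itself. *)
  destruct (finite_min_pos (fun i => if Req_EM_T (Fn (i + 1 - l) (xs i)) x then 1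
     else Rabs (Fn (i + 1 - l) (xs i) - x)) N) as (d2 & Hd2 & K2).
  { intros i. destruct (Req_EM_T _ _); [lra|]. apply Rabs_pos_lt. lra. }
  destruct (pt_separated E_lift x (Rmin (Rmin d1 d2) (Rmin (x - gs (S l)) (gs l - x)))) as (eta & He & K).
  - lra.
  - repeat apply Rmin_glb_lt; lra.
  - apply E_lift_range.
  - intros y Hy Hne. apply Rnot_lt_le. intros h.
    assert (A1 := Rlt_le_trans _ _ _ h (Rmin_l _ _)). assert (A2 := Rlt_le_trans _ _ _ h (Rmin_r _ _)).
    assert (A3 := Rlt_le_trans _ _ _ A1 (Rmin_l _ _)). assert (A4 := Rlt_le_trans _ _ _ A1 (Rmin_r _ _)).
    assert (A5 := Rlt_le_trans _ _ _ A2 (Rmin_l _ _)). assert (A6 := Rlt_le_trans _ _ _ A2 (Rmin_r _ _)).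
    apply Rabs_def2 in A5. apply Rabs_def2 in A6.
    assert (Hb : gs (S l) < y < gs l) by lra.
    destruct Hy as [->|[(l' & ->)|(i & j & Hj & ->)]].
    + pose proof (gs_pos (S l)). lra.
    + destruct (Nat.lt_total l' l) as [q|[q|q]].
      * destruct (Nat.eq_dec (S l') l) as [<-|]; [lra|]. pose proof (gs_decr (S l') l ltac:(lia)). lra.
      * subst. lra.
      * pose proof (gs_decr (S l) (S l') ltac:(lia)). lra.
    + destruct (orbit_between i j Hj) as (Hij & E).
      assert (L : (l = i + 1 - j)%nat).
      { apply gs_interval with (Fn j (xs i)); auto. replace (S (i + 1 - j)) with (i + 2 - j)%nat by lia. auto. }
      assert (Hi : (i < N)%nat).
      { apply Nat.nle_gt. intros q. specialize (HN i q). specialize (K1 _ A3).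
        apply Rabs_def2 in K1. replace (i + 2 - j)%nat with (S l) in E by lia. rewrite E in K1.
        unfold c in *. lra. }
      specialize (K2 i Hi). cbv beta in K2. replace (i + 1 - l)%nat with j in K2 by lia.
      destruct (Req_EM_T _ _); [contradiction|]. lra.
  - exists eta. split; auto. intros e HE Hne. apply in_E_lift in HE. destruct HE as (y & Hy & ->).
    apply K; auto. intros ->. auto.
Qed.

Lemma countable_union (e : nat -> nat -> C) : exists u : nat -> C, forall i j, exists n, u n = e i j.
Proof.
  exists (fun n => let (i, j) := Cantor.of_nat n in e i j).
  intros i j. exists (Cantor.to_nat (i, j)). now rewrite Cantor.cancel_of_to.
Qed.

Lemma preimage_E_countable : exists u : nat -> C, forall t, Cmod t = 1 -> in_E (B t) -> exists n, u n = t.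
Proof.
  assert (EE : exists v : nat -> R, forall y, E_lift y -> exists n, v n = y).
  { exists (fun n => match n with O => 0 | S n =>
       let (i, j) := Cantor.of_nat n in match i with O => gs (S j) | S i => Fn j (xs i) end end).
    intros y [->|[(l & ->)|(i & j & _ & ->)]].
    - exists 0%nat. auto.
    - exists (S (Cantor.to_nat (0%nat, l))). now rewrite Cantor.cancel_of_to.
    - exists (S (Cantor.to_nat (S i, j))). now rewrite Cantor.cancel_of_to. }
  destruct EE as (v & Hv).
  destruct (countable_union (fun i k => pt (Gn 1 (v i + INR k * tau)))) as (u & Hu).
  exists u. intros t Ht HE. destruct (pt_surj t Ht) as (x & Hx & <-).
  rewrite B_pt in HE. apply in_E_lift in HE. destruct HE as (y & Hy & E).
  assert (Hr := E_lift_range y Hy). apply pt_eq_mod in E. destruct E as (k & E).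
  assert (HT := tau_pos).
  (* Natural multiples of [tau] suffice in the enumeration, since [F x >= 0] for [x] in the period
     interval. *)
  assert (Hk : (0 <= k)%Z).
  { assert (0 <= F x).
    { rewrite <- F_0. destruct (proj1 Hx) as [h| <-]; [left; auto|lra]. }
    assert (-1 < IZR k) by nra. apply lt_IZR in H0. lia. }
  destruct (Hv y Hy) as (i & Ei). destruct (Hu i (Z.to_nat k)) as (n & En).
  exists n. rewrite En. f_equal. apply (Fn_inj 1). rewrite Fn_Gn. simpl.
  rewrite INR_IZR_INZ, Z2Nat.id, Ei by auto. auto.
Qed.

Lemma B_circle t : Cmod t = 1 -> Cmod (B t) = 1.
Proof. intros Ht. destruct (pt_surj t Ht) as (x & _ & <-). rewrite B_pt. apply pt_circle. Qed.

Lemma B_locally_inj t : Cmod t = 1 -> exists eta, 0 < eta /\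
  forall u, Cmod u = 1 -> Cmod (u - t) < eta -> B u = B t -> u = t.
Proof.
  intros Ht. destruct (pt_surj t Ht) as (x & Hx & <-). assert (HT := tau_pos).
  destruct (continuity_eps F x F_cont tau HT) as (e & He & K).
  destruct (pt_local e He) as (eta & Heta & Q). exists eta. split; auto.
  intros u Hu Hut HB. destruct (pt_surj u Hu) as (y & Hy & <-).
  destruct (Q _ _ Hut) as (k & Hk).
  set (y' := y + IZR (- k) * tau). assert (Ey : pt y = pt y') by (unfold y'; now rewrite pt_period).
  rewrite Ey in *. specialize (K y').
  replace (y' - x) with (y - x - IZR k * tau) in K by (unfold y'; rewrite opp_IZR; ring).
  specialize (K Hk). rewrite !B_pt in HB. apply pt_eq_mod in HB. destruct HB as (m & Em).
  rewrite Em in K. replace (F x + IZR m * tau - F x) with (IZR m * tau) in K by ring.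
  apply Rabs_def2 in K.
  assert (m = 0)%Z.
  { assert (-1 < IZR m < 1) by nra. destruct H as (H1 & H2). apply lt_IZR in H1. apply lt_IZR in H2. lia. }
  subst m. f_equal. apply (Fn_inj 1). simpl. lra.
Qed.

Lemma B_continuous t e : Cmod t = 1 -> 0 < e -> exists del, 0 < del /\
  forall u, Cmod u = 1 -> Cmod (u - t) < del -> Cmod (B u - B t) < e.
Proof.
  intros Ht He. destruct (pt_surj t Ht) as (x & Hx & <-).
  destruct (continuity_eps F x F_cont e He) as (e' & He' & K).
  destruct (pt_local e' He') as (eta & Heta & Q). exists eta. split; auto.
  intros u Hu Hut. destruct (pt_surj u Hu) as (y & Hy & <-).
  destruct (Q _ _ Hut) as (k & Hk).
  set (y' := y + IZR (- k) * tau). assert (Ey : pt y = pt y') by (unfold y'; now rewrite pt_period).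
  rewrite Ey. specialize (K y').
  replace (y' - x) with (y - x - IZR k * tau) in K by (unfold y'; rewrite opp_IZR; ring).
  rewrite !B_pt. eapply Rle_lt_trans; [apply pt_lip|]. auto.
Qed.

(** After one preimage, the inverse branch [y |-> F^-2 (y + tau)] is iterated. Its fixed point is
    [xs 0], and monotonicity squeezes the iterates between [xs 0] and the sequence [hseq 2]. Thus
    every point of the circle has a backward orbit attracted by [O_0]. *)
Lemma backward_path t : Cmod t = 1 -> exists y : nat -> R,
  B (pt (y O)) = t /\ (forall n, Bn B 2 (pt (y (S n))) = pt (y n)) /\ Un_cv y (xs 0).
Proof.
  intros Ht. destruct (pt_surj t Ht) as (x & Hx & <-).
  set (y := nat_rect (fun _ => R) (Gn 1 (x + tau)) (fun _ u => Gn 2 (u + tau))).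
  destruct (xs_spec 0) as (X1 & X2 & X3 & X4). simpl Nat.add in *.
  assert (Y0 : F (y O) = x + tau) by exact (Fn_Gn 1 (x + tau)).
  assert (YS : forall n, Fn 2 (y (S n)) = y n + tau) by (intros n; exact (Fn_Gn 2 (y n + tau))).
  exists y. split; [|split].
  - rewrite B_pt, Y0. apply pt_tau.
  - intros n. rewrite Bn_pt, YS. apply pt_tau.
  - assert (Hb : forall n, xs 0 <= y n <= hseq 2 n).
    { induction n.
      - split; apply Rnot_lt_le; intros h.
        + apply F_incr in h. rewrite Y0 in h.
          destruct (orbit_range 0 1 ltac:(lia)) as (_ & R1). simpl in R1. lra.
        + simpl hseq in h. apply F_incr in h. rewrite Y0 in h. pose proof F_tau. lra.
      - split; apply Rnot_lt_le; intros h; apply (Fn_incr 2) in h; rewrite YS in h.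
        + lra.
        + rewrite hseq_S in h. lra. }
    intros e He. destruct (X3 e He) as (N & K). exists N. intros n Hn. specialize (K n Hn).
    specialize (Hb n). unfold Rdist in *. apply Rabs_def2 in K. apply Rabs_def1; lra.
Qed.

(** * The weight *)

(** The number of points in the orbits before [O_i], so that [O_i] occupies the indices from [tri i]
    to [tri i + i + 1]; in particular [O_0] receives [0] and [1]. *)
Fixpoint tri (i : nat) : nat := match i with O => O | S i => (tri i + (i + 2))%nat end.

Lemma tri_decomp n : exists ij : nat * nat, (snd ij < fst ij + 2)%nat /\ n = (tri (fst ij) + snd ij)%nat.
Proof.
  induction n as [|n ((i, j) & Hj & E)]; [exists (0, 0)%nat; simpl; lia|].
  simpl in *. destruct (Nat.eq_dec (S j) (i + 2)) as [h|h].
  - exists (S i, 0)%nat. simpl. lia.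
  - exists (i, S j). simpl. lia.
Qed.

Lemma tri_le i i' : (i <= i')%nat -> (tri i <= tri i')%nat.
Proof. intros H. induction H; simpl; lia. Qed.

Lemma tri_inj i j i' j' : (j < i + 2)%nat -> (j' < i' + 2)%nat ->
  (tri i + j = tri i' + j')%nat -> i = i' /\ j = j'.
Proof.
  intros Hj Hj' E. assert (i = i').
  { destruct (Nat.lt_total i i') as [h|[h|h]]; auto; exfalso;
      apply tri_le in h; simpl in h; lia. }
  subst. lia.
Qed.

Definition orbit_index (n : nat) : nat * nat := proj1_sig (constructive_indefinite_description _ (tri_decomp n)).

Lemma orbit_index_spec n : (snd (orbit_index n) < fst (orbit_index n) + 2)%nat /\
  n = (tri (fst (orbit_index n)) + snd (orbit_index n))%nat.
Proof. unfold orbit_index. destruct (constructive_indefinite_description _ _); auto. Qed.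

Lemma orbit_index_tri i j : (j < i + 2)%nat -> orbit_index (tri i + j) = (i, j).
Proof.
  intros Hj. destruct (orbit_index_spec (tri i + j)) as (H & E).
  destruct (orbit_index (tri i + j)) as (i', j'). simpl in *.
  destruct (tri_inj i j i' j'); auto.
Qed.

Lemma orbit_index_ge I n : (tri I <= n)%nat -> (I <= fst (orbit_index n))%nat.
Proof.
  intros H. destruct (orbit_index_spec n) as (H1 & E). apply Nat.nlt_ge. intros h.
  apply tri_le in h. simpl in h. lia.
Qed.

Definition opt (n : nat) : C := pt (Fn (snd (orbit_index n)) (xs (fst (orbit_index n)))).

Lemma opt_orbit n : in_orbit (fst (orbit_index n)) (opt n).
Proof. exists (snd (orbit_index n)). split; auto. apply orbit_index_spec. Qed.

Lemma orbit_opt i t : in_orbit i t -> exists n, fst (orbit_index n) = i /\ t = opt n.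
Proof.
  intros (j & Hj & ->). exists (tri i + j)%nat. unfold opt. rewrite orbit_index_tri by auto. auto.
Qed.

Lemma opt_inj n m : opt n = opt m -> n = m.
Proof.
  intros H. destruct (orbit_index_spec n) as (H1 & E1). destruct (orbit_index_spec m) as (H2 & E2).
  unfold opt in H.
  pose proof (orbit_range _ _ H1). pose proof (orbit_range _ _ H2).
  apply pt_inj in H; try lra. apply orbit_inj in H; auto.
  destruct H as (Hi & Hj). rewrite Hi, Hj in E1. now rewrite <- E2 in E1.
Qed.

(** It contains [L], which is forward invariant and disjoint from the periodic orbits, and all
    preimages of [E] that leave [E] unvisited until the next step. *)
Definition zset (t : C) : Prop := Cmod t = 1 /\ in_E (B t) /\ forall i, ~ in_orbit i t.

Lemma zset_fixed : zset (pt 0).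
Proof.
  split; [apply pt_circle|split].
  - left; left. rewrite B_pt, F_0. auto.
  - intros i H. apply orbit_not_L in H. apply H. left; auto.
Qed.

(** The second Cantor coordinate is a dummy that makes every zero occur infinitely often; codes of
    other points fall back on the fixed point, itself a zero. *)
Lemma zset_enum : exists z : nat -> C, (forall n, zset (z n)) /\
  forall t, zset t -> forall K, exists k, (K <= k)%nat /\ z k = t.
Proof.
  destruct preimage_E_countable as (u & Hu).
  exists (fun k => let a := u (fst (Cantor.of_nat k)) in
    if excluded_middle_informative (zset a) then a else pt 0).
  split.
  - intros n. cbv zeta. destruct (excluded_middle_informative _); auto. apply zset_fixed.
  - intros t Ht K. destruct (Hu t) as (a & Ea); [apply Ht|apply Ht|].
    exists (Cantor.to_nat (a, K)). split.
    + pose proof (Cantor.to_nat_non_decreasing a K). lia.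
    + cbv zeta. rewrite Cantor.cancel_of_to. simpl. rewrite Ea.
      destruct (excluded_middle_informative _); tauto.
Qed.

(** Isolation at [B t] handles points with another image, local injectivity of [B] those with the
    same image. Both separation hypotheses of [interpolation] come from here. *)
Lemma preimage_E_isolated t : Cmod t = 1 -> ~ in_L (B t) -> exists del, 0 < del /\
  forall u, Cmod u = 1 -> in_E (B u) -> u <> t -> del <= Cmod (u - t).
Proof.
  intros Ht HL. destruct (E_isolated (B t) (B_circle t Ht) HL) as (eta & Heta & K).
  destruct (B_continuous t eta Ht Heta) as (d1 & Hd1 & K1).
  destruct (B_locally_inj t Ht) as (d2 & Hd2 & K2).
  exists (Rmin d1 d2). split; [now apply Rmin_glb_lt|]. intros u Hu HE Hne.
  apply Rnot_lt_le. intros h. apply Hne. apply K2; auto.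
  - eapply Rlt_le_trans; [apply h|apply Rmin_r].
  - apply NNPP. intros Hn. specialize (K (B u) HE Hn).
    specialize (K1 u Hu (Rlt_le_trans _ _ _ h (Rmin_l _ _))). lra.
Qed.

Variable lam : nat -> R.
Hypothesis lam_pos : forall i, 0 < lam i.
Hypothesis lam_decr : forall i, lam (S i) < lam i.
Hypothesis lam_lim : is_lim_seq lam 0.

Lemma lam_le i j : (i <= j)%nat -> lam j <= lam i.
Proof. intros H. induction H; [lra|]. specialize (lam_decr m). lra. Qed.

Lemma lam_small e : 0 < e -> exists I, forall i, (I <= i)%nat -> lam i < e.
Proof.
  intros He. apply is_lim_seq_spec in lam_lim. destruct (lam_lim (mkposreal _ He)) as (I & K).
  exists I. intros i Hi. specialize (K i Hi). simpl in K. rewrite Rminus_0_r in K.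
  eapply Rle_lt_trans; [apply Rle_abs|apply K].
Qed.

Definition good_weight (w : C -> C) : Prop :=
  disc_alg w /\ (forall t, Cmod t <= 1 -> Cmod (w t) <= lam 0) /\
  (forall i t, in_orbit i t -> Cmod (w t) = lam i) /\
  (forall t, zset t -> w t = 0) /\
  (forall t, Cmod t = 1 -> ~ in_E (B t) -> w t <> 0).

(** [interpolation] gives modulus [1] on [O_0] and [lam i / lam 0] on [O_i], and the result is
    scaled by [lam 0]. All points numbered from [2] on belong to orbits with [i >= 1], so
    [lam 0 / lam 1 - 1] is a valid gap [th], positive by strict decrease. *)
Lemma good_weight_exists : exists w, good_weight w.
Proof.
  destruct zset_enum as (z & Z1 & Z2).
  set (rho := fun k => lam 0 / lam (fst (orbit_index (k + 2)))).
  assert (Hi1 : forall k, (1 <= fst (orbit_index (k + 2)))%nat) by (intros k; apply orbit_index_ge; simpl; lia).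
  assert (Hth : 1 < lam 0 / lam 1).
  { apply Rmult_lt_reg_r with (lam 1); auto. unfold Rdiv. rewrite Rmult_assoc, Rinv_l.
    - specialize (lam_decr 0). lra. - specialize (lam_pos 1). lra. }
  destruct (interpolation opt z rho (lam 0 / lam 1 - 1)) as (w & W1 & W2 & W3 & W4 & W5 & W6 & W7).
  - intros n. apply pt_circle.
  - intros n. apply Z1.
  - apply opt_inj.
  - intros n.
    assert (On := opt_orbit n).
    destruct (preimage_E_isolated (opt n)) as (del & Hdel & K).
    { apply pt_circle. } { apply (orbit_not_L (fst (orbit_index n))). now apply orbit_forward. }
    exists del. split; auto. intros m. split.
    + intros Hm. apply K; [apply pt_circle| |].
      * right. exists (fst (orbit_index m)). apply orbit_forward, opt_orbit.
      * intros h. apply opt_inj in h. auto.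
    + apply K; [apply Z1|apply Z1|]. intros h. apply (proj2 (proj2 (Z1 m)) (fst (orbit_index n))).
      rewrite h. auto.
  - intros t Ht H1 H2.
    assert (HE : ~ in_E (B t)).
    { intros h. destruct (classic (exists i, in_orbit i t)) as [(i & Hi)|Hn].
      - destruct (orbit_opt i t Hi) as (n & _ & E). apply (H1 n E).
      - destruct (Z2 t) with (K := 0%nat) as (k & _ & E).
        + split; [auto|split; [auto|]]. intros i Hi. apply Hn. eauto.
        + apply (H2 k). auto. }
    destruct (preimage_E_isolated t Ht) as (del & Hdel & K).
    { intros h. apply HE. left; auto. }
    exists del. split; auto. intros m. split; apply K; auto.
    + apply pt_circle.
    + right. exists (fst (orbit_index m)). apply orbit_forward, opt_orbit.
    + apply Z1.
    + apply Z1.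
  - intros m K. apply Z2. apply Z1.
  - lra.
  - intros m. unfold rho. replace (1 + (lam 0 / lam 1 - 1)) with (lam 0 / lam 1) by ring.
    apply Rmult_le_compat_l; [left; auto|]. apply Rinv_le_contravar; auto. apply lam_le, Hi1.
  - intros X. set (X' := Rmax 1 X). assert (HX : 0 < X') by (eapply Rlt_le_trans; [|apply Rmax_l]; lra).
    destruct (lam_small (lam 0 / X')) as (I & HI); [now apply Rdiv_lt_0_compat|].
    exists (tri I). intros m Hm. apply Rle_trans with X'; [apply Rmax_r|].
    assert (Q := HI (fst (orbit_index (m + 2))) (orbit_index_ge I (m + 2) ltac:(lia))).
    unfold rho. set (l := lam (fst (orbit_index (m + 2)))) in *.
    assert (Hl : 0 < l) by apply lam_pos.
    apply Rmult_le_reg_r with l; auto. replace (lam 0 / l * l) with (lam 0) by (field; lra).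
    apply Rmult_lt_compat_r with (r := X') in Q; auto.
    replace (lam 0 / X' * X') with (lam 0) in Q by (field; lra). lra.
  - assert (L0 := lam_pos 0).
    assert (L0' : RtoC (lam 0) <> 0) by (intros h; apply RtoC_inj in h; lra).
    assert (CM : forall t, Cmod (lam 0 * w t) = lam 0 * Cmod (w t)).
    { intros t. rewrite Cmod_mult, Cmod_R, Rabs_pos_eq; lra. }
    exists (fun t => lam 0 * w t)%C. split; [|split; [|split; [|split]]].
    + apply disc_alg_mult; auto. apply disc_alg_const.
    + intros t Ht. rewrite CM. specialize (W2 t Ht). nra.
    + intros i t Hi. destruct (orbit_opt i t Hi) as (n & En & ->). rewrite CM.
      destruct n as [|[|n]].
      * rewrite W3. assert (Q := orbit_index_tri 0 0 ltac:(lia)). simpl in Q. rewrite Q in En. simpl in En. subst. ring.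
      * rewrite W4. assert (Q := orbit_index_tri 0 1 ltac:(lia)). simpl in Q. rewrite Q in En. simpl in En. subst. ring.
      * replace (S (S n)) with (n + 2)%nat in * by lia. rewrite W5. unfold rho. rewrite En.
        specialize (lam_pos i). field. lra.
    + intros t Ht. destruct (Z2 t Ht 0%nat) as (k & _ & <-). rewrite W6. ring.
    + intros t Ht HE. apply Cmult_neq_0; auto. apply W7; [lra|].
      intros k ->. apply HE. apply Z1.
Qed.

(** * The spectrum *)

Lemma Bn_open m u e : Cmod u = 1 -> 0 < e -> exists del, 0 < del /\ forall t, Cmod t = 1 ->
  Cmod (t - Bn B m u) < del -> exists u', Cmod u' = 1 /\ Cmod (u' - u) < e /\ Bn B m u' = t.
Proof.
  intros Hu He. destruct (pt_surj u Hu) as (x & _ & <-).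
  destruct (Fn_open m x e He) as (d1 & Hd1 & K1).
  destruct (pt_local d1 Hd1) as (eta & Heta & K2).
  exists eta. split; auto. intros t Ht Hlt. destruct (pt_surj t Ht) as (y & _ & <-).
  rewrite Bn_pt in Hlt. destruct (K2 _ _ Hlt) as (k & Hk).
  destruct (K1 (y + IZR (- k) * tau)) as (x' & Hx' & E).
  { rewrite opp_IZR. replace (y + - IZR k * tau - Fn m x) with (y - Fn m x - IZR k * tau) by ring. auto. }
  exists (pt x'). split; [apply pt_circle|split].
  - eapply Rle_lt_trans; [apply pt_lip|auto].
  - rewrite Bn_pt, E. apply pt_period.
Qed.

Hypothesis B_alg : disc_alg B.
Hypothesis B_contr : forall r, 0 <= r < 1 -> exists r', 0 <= r' < 1 /\ forall z, Cmod z <= r -> Cmod (B z) <= r'.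

Section Spectrum.
Variable w : C -> C.
Hypothesis w_good : good_weight w.

(** * Values of [mu] whose modulus is none of the [lam i] *)

Lemma growth_unbounded (a : nat -> R) N q : 0 < a N -> 1 < q ->
  (forall n, (N <= n)%nat -> q * a n <= a (S n)) -> exists n, 1 < a n.
Proof.
  intros Ha Hq H.
  assert (P : forall k, q ^ k * a N <= a (N + k)%nat).
  { induction k; [rewrite Nat.add_0_r; simpl; lra|]. rewrite Nat.add_succ_r.
    eapply Rle_trans; [|apply H; lia]. simpl. rewrite Rmult_assoc. apply Rmult_le_compat_l; lra. }
  destruct (Pow_x_infinity q ltac:(rewrite Rabs_pos_eq; lra) (2 / a N)) as (k & Hk).
  specialize (Hk k (le_n _)). rewrite Rabs_pos_eq in Hk by (apply pow_le; lra).
  exists (N + k)%nat. eapply Rlt_le_trans; [|apply P].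
  apply Rge_le in Hk. apply Rmult_le_compat_r with (r := a N) in Hk; [|lra].
  replace (2 / a N * a N) with 2 in Hk by (field; lra). lra.
Qed.

Lemma not_E_back u : ~ in_E (B u) -> ~ in_E u.
Proof. intros H h. apply H. now apply E_forward. Qed.

(** Along the backward path the weights never vanish, because no preimage of a point off [E] is in
    [E], and their moduli tend to [lam 0 > s] as the path approaches [O_0]. So the product of
    weights eventually outgrows [s^m], whatever its initial size. *)
Lemma growth_off_E t s : Cmod t = 1 -> ~ in_E t -> 0 < s < lam 0 ->
  exists m u, Cmod u = 1 /\ Bn B m u = t /\ s ^ m < Cmod (wn B w m u).
Proof.
  intros Ht HE Hs. destruct w_good as (W1 & W2 & W3 & W4 & W5).
  destruct (backward_path t Ht) as (y & Y0 & YS & Yc).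
  (* One step leads from [y 0] to [t], and two more from each [y (S n)] to [y n]: hence the exponent
     [2 * n + 1]. *)
  set (a := fun n => Cmod (wn B w (2 * n + 1) (pt (y n))) / s ^ (2 * n + 1)).
  assert (YE : forall n, ~ in_E (B (pt (y n)))).
  { induction n.
    - rewrite Y0. auto.
    - apply not_E_back. change (B (B (pt (y (S n))))) with (Bn B 2 (pt (y (S n)))). rewrite YS.
      now apply not_E_back. }
  assert (Wpos : forall u, Cmod u = 1 -> ~ in_E (B u) -> 0 < Cmod (w u)).
  { intros u Hu Hn. exact (proj1 (Cmod_gt_0 _) (W5 u Hu Hn)). }
  assert (Wrec : forall n, wn B w (2 * S n + 1) (pt (y (S n))) =
     (w (pt (y (S n))) * (w (B (pt (y (S n)))) * wn B w (2 * n + 1) (pt (y n))))%C).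
  { intros n. replace (2 * S n + 1)%nat with (S (S (2 * n + 1))) by lia.
    rewrite <- (YS n). reflexivity. }
  assert (YE2 : forall n, ~ in_E (B (B (pt (y (S n)))))).
  { intros n. change (B (B (pt (y (S n))))) with (Bn B 2 (pt (y (S n)))). rewrite YS.
    apply not_E_back, YE. }
  assert (Apos : forall n, 0 < Cmod (wn B w (2 * n + 1) (pt (y n)))).
  { induction n.
    - simpl. rewrite Cmult_1_r. apply Wpos; auto. apply pt_circle.
    - rewrite Wrec, !Cmod_mult. apply Rmult_lt_0_compat; [|apply Rmult_lt_0_compat]; auto.
      + apply Wpos; auto. apply pt_circle.
      + apply Wpos; auto. apply B_circle, pt_circle. }
  assert (Bnd : forall n, Bn B (2 * n + 1) (pt (y n)) = t).
  { induction n; [exact Y0|].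
    replace (2 * S n + 1)%nat with ((2 * n + 1) + 2)%nat by lia. rewrite Bn_add, YS. auto. }
  set (l := (s + lam 0) / 2). assert (Hl : s < l < lam 0) by (unfold l; lra).
  assert (O0 : in_orbit 0 (pt (xs 0))) by (exists 0%nat; split; [lia|auto]).
  assert (near : forall p, Cmod p = 1 -> Cmod (w p) = lam 0 -> forall v : nat -> C,
     (forall n, Cmod (v n) = 1) ->
     (forall e, 0 < e -> exists N, forall n, (N <= n)%nat -> Cmod (v n - p) < e) ->
     exists N, forall n, (N <= n)%nat -> l <= Cmod (w (v n))).
  { intros p Hp Ep v Hv Hc. destruct (proj2 W1 p ltac:(lra) (lam 0 - l) ltac:(lra)) as (del & Hdel & K).
    destruct (Hc del Hdel) as (N & HN). exists N. intros n Hn.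
    specialize (K (v n) ltac:(unfold closed_disc; rewrite Hv; lra) (HN n Hn)).
    pose proof (Cmod_le_sub (w p) (w (v n))) as Q. rewrite (Cmod_sub_sym (w p)) in Q. lra. }
  destruct (near (pt (xs 0)) (pt_circle _) (W3 0%nat _ O0) (fun n => pt (y (S n)))) as (N1 & H1).
  { intros; apply pt_circle. }
  { intros e He. destruct (pt_seq_cv y (xs 0) Yc e He) as (N & K). exists N. intros n Hn. apply K. lia. }
  destruct (near (B (pt (xs 0))) (B_circle _ (pt_circle _)) (W3 0%nat _ (orbit_forward _ _ O0))
    (fun n => B (pt (y (S n))))) as (N2 & H2).
  { intros; apply B_circle, pt_circle. }
  { intros e He. destruct (B_continuous _ e (pt_circle (xs 0)) He) as (del & Hdel & Kd).
    destruct (pt_seq_cv y (xs 0) Yc del Hdel) as (N & K). exists N. intros n Hn.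
    apply Kd; [apply pt_circle|]. apply K. lia. }
  assert (Hsp : forall k, 0 < s ^ k) by (intros; apply pow_lt; lra).
  destruct (growth_unbounded a (max N1 N2) ((l / s) ^ 2)) as (n & Hn).
  - apply Rdiv_lt_0_compat; auto.
  - assert (1 < l / s).
    { apply Rmult_lt_reg_r with s; [lra|]. replace (l / s * s) with l by (field; lra). lra. }
    simpl. nra.
  - intros n Hn. specialize (H1 n ltac:(lia)). specialize (H2 n ltac:(lia)). cbv beta in H1, H2.
    unfold a. rewrite Wrec, !Cmod_mult. specialize (Apos n).
    set (A := Cmod (wn B w (2 * n + 1) (pt (y n)))) in *.
    replace (2 * S n + 1)%nat with (S (S (2 * n + 1))) by lia.
    change (s ^ S (S (2 * n + 1))) with (s * (s * s ^ (2 * n + 1))).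
    specialize (Hsp (2 * n + 1)%nat). set (S1 := s ^ (2 * n + 1)) in *.
    replace ((l / s) ^ 2 * (A / S1)) with ((l * (l * A)) * / (s * (s * S1))) by (field; lra).
    unfold Rdiv. apply Rmult_le_compat_r.
    + left. apply Rinv_0_lt_compat. repeat apply Rmult_lt_0_compat; lra.
    + apply Rmult_le_compat; try lra; [apply Rmult_le_pos; lra|]. apply Rmult_le_compat_r; lra.
  - exists (2 * n + 1)%nat, (pt (y n)). split; [apply pt_circle|split; [apply Bnd|]].
    unfold a in Hn. specialize (Hsp (2 * n + 1)%nat).
    apply Rmult_lt_compat_r with (r := s ^ (2 * n + 1)) in Hn; auto.
    unfold Rdiv in Hn. rewrite Rmult_assoc, Rinv_l in Hn; lra.
Qed.

(** One step is enough on [E]: on [O_i] the weight at [t], or at its preimage in [O_i], decides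
    according to the sign of [|mu| - lam i], and elsewhere on [E] the weight is [0]. Off [E] the
    comparison is with [lam 0], the maximum of [|w|]. *)
Lemma not_usf (mu : C) : mu <> 0 -> (forall i, Cmod mu <> lam i) -> ~ in_sigma_usf (wco w B) mu.
Proof.
  intros Hmu Hi. assert (W := w_good). destruct W as (W1 & W2 & W3 & W4 & W5).
  assert (Hm : 0 < Cmod mu) by exact (proj1 (Cmod_gt_0 _) Hmu).
  apply not_usf_of_growth; auto using B_circle.
  { intros m u e. apply Bn_open. }
  assert (one : forall t, Cmod (wn B w 1 t) = Cmod (w t)) by (intros; simpl; now rewrite Cmult_1_r).
  intros t Ht. destruct (classic (exists i, in_orbit i t)) as [(i & Ho)|Hn].
  - destruct (Rlt_le_dec (lam i) (Cmod mu)) as [h|h].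
    + left. exists 1%nat. rewrite one, (W3 i t Ho). simpl. lra.
    + right. destruct (orbit_backward i t Ho) as (u & Hu & E). exists 1%nat, u.
      split; [apply E_circle; right; eauto|split; [exact E|]].
      rewrite one, (W3 i u Hu). simpl. specialize (Hi i). lra.
  - destruct (classic (in_E t)) as [HE|HE].
    + left. exists 1%nat. rewrite one, W4, Cmod_0; [simpl; lra|].
      split; [auto|split; [now apply E_forward|]]. intros i h. apply Hn; eauto.
    + destruct (Rlt_le_dec (lam 0) (Cmod mu)) as [h|h].
      * left. exists 1%nat. rewrite one. specialize (W2 t ltac:(lra)). simpl. lra.
      * right. apply growth_off_E; auto. specialize (Hi 0%nat). lra.
Qed.

(** * Values of [mu] with modulus some [lam i], and [mu = 0] *)

Lemma orbit_dist_pos i t : ~ in_orbit i t -> exists del, 0 < del /\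
  forall p, in_orbit i p -> del <= Cmod (p - t).
Proof.
  intros H.
  destruct (finite_min_pos (fun j => if excluded_middle_informative (pt (Fn j (xs i)) = t) then 1
     else Cmod (pt (Fn j (xs i)) - t)) (i + 2)) as (del & Hdel & K).
  { intros j. destruct (excluded_middle_informative _); [lra|now apply Csub_pos]. }
  exists del. split; auto. intros p (j & Hj & ->). specialize (K j Hj). cbv beta in K.
  destruct (excluded_middle_informative _) as [e|e]; auto.
  exfalso. apply H. exists j. auto.
Qed.

(** By compactness, a preimage of a point near [O_i] is near [B^-1 O_i], which consists of [O_i] and
    of zeros of [w]. *)
Lemma preimage_near_orbit i eta : 0 < eta -> exists del, 0 < del /\
  forall u p, Cmod u = 1 -> in_orbit i p -> Cmod (B u - p) < del ->
    Cmod (w u) < eta \/ (Cmod (w u) <= lam i + eta /\ exists p', in_orbit i p' /\ Cmod (u - p') < eta).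
Proof.
  intros He. destruct w_good as (W1 & W2 & W3 & W4 & W5). apply NNPP. intros N.
  assert (Hu : forall n : nat, {u : C | Cmod u = 1 /\ (exists p, in_orbit i p /\ Cmod (B u - p) < / (INR n + 1)) /\
     ~ (Cmod (w u) < eta \/ (Cmod (w u) <= lam i + eta /\ exists p', in_orbit i p' /\ Cmod (u - p') < eta))}).
  { intros n. apply constructive_indefinite_description. apply NNPP. intros Q. apply N.
    exists (/ (INR n + 1)). split; [apply Rinv_0_lt_compat; pose proof (pos_INR n); lra|].
    intros u p Hu Hp Hup. apply NNPP. intros Q2. apply Q. exists u. eauto. }
  destruct (circle_compact (fun n => proj1_sig (Hu n))) as (t & Ht & Ad).
  { intros n. apply (proj2_sig (Hu n)). }
  assert (HB : in_orbit i (B t)).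
  { apply NNPP. intros h. destruct (orbit_dist_pos i (B t) h) as (del & Hdel & K).
    destruct (B_continuous t (del / 2) Ht ltac:(lra)) as (d1 & Hd1 & K1).
    destruct (archimed_cor1 (del / 2) ltac:(lra)) as (N1 & HN1 & HN1').
    destruct (Ad d1 N1 Hd1) as (n & Hn & Hnt). destruct (Hu n) as (u & U1 & (p & Hp & Hup) & U3). simpl in Hnt.
    specialize (K1 u U1 Hnt). specialize (K p Hp).
    assert (0 < INR N1 <= INR n) by (split; [apply lt_0_INR|apply le_INR]; auto).
    assert (/ (INR n + 1) < / INR N1) by (apply Rinv_lt_contravar; nra).
    pose proof (Cmod_sub_triangle p (B u) (B t)) as Q. rewrite (Cmod_sub_sym p (B u)) in Q. lra. }
  destruct (proj2 W1 t ltac:(lra) eta He) as (d1 & Hd1 & K1).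
  destruct (Ad (Rmin d1 eta) 0%nat) as (n & _ & Hnt); [now apply Rmin_glb_lt|].
  destruct (Hu n) as (u & U1 & U2 & U3). simpl in Hnt.
  assert (H1 := Rlt_le_trans _ _ _ Hnt (Rmin_l _ _)). assert (H2 := Rlt_le_trans _ _ _ Hnt (Rmin_r _ _)).
  specialize (K1 u ltac:(unfold closed_disc; lra) H1). apply U3.
  destruct (classic (exists i', in_orbit i' t)) as [(i' & Ho)|Hn].
  - assert (i' = i) by (apply (orbit_disjoint i' i (B t)); auto; now apply orbit_forward). subst i'.
    right. split; [|exists t; auto].
    pose proof (Cmod_le_sub (w u) (w t)) as Q. rewrite (W3 i t Ho) in Q. lra.
  - left. rewrite (W4 t) in K1.
    + now replace (w u - 0)%C with (w u) in K1 by ring.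
    + split; [auto|split; [right; eauto|]]. intros i' h. apply Hn; eauto.
Qed.

(** Induction that peels off the last weight, taken at [B^j t]. Either this point is near a zero,
    and one small factor outweighs the bounded rest; or it is near [O_i], and the induction
    hypothesis applies with a factor close to [lam i]. *)
Lemma wn_near_orbit i j eta : 0 < eta -> exists del, 0 < del /\
  forall t p, Cmod t = 1 -> in_orbit i p -> Cmod (Bn B j t - p) < del -> Cmod (wn B w j t) <= lam i ^ j + eta.
Proof.
  revert eta. induction j; intros eta He.
  - exists 1. split; [lra|]. intros. simpl. rewrite Cmod_1. lra.
  - assert (W1 : disc_alg w) by apply w_good.
    assert (WA := wn_alg B w B_alg B_contr B_circle W1 j).
    destruct (disc_alg_bounded _ WA) as (Wj & HW).
    assert (Li := lam_pos i).
    (* The terms [e1 * lam i] and [e2 * M] will each take half of [eta]. *)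
    set (e1 := eta / (2 * (lam i + 1))). assert (He1 : 0 < e1) by (apply Rdiv_lt_0_compat; lra).
    destruct (IHj e1 He1) as (d1 & Hd1 & K1).
    assert (Lj : 0 < lam i ^ j) by now apply pow_lt.
    set (M := Rabs Wj + (lam i ^ j + e1)). assert (HM : 0 < M) by (unfold M; pose proof (Rabs_pos Wj); lra).
    set (e2 := Rmin d1 (eta / (2 * M))).
    assert (He2 : 0 < e2) by (apply Rmin_glb_lt; auto; apply Rdiv_lt_0_compat; lra).
    assert (He2M : e2 * M <= eta / 2).
    { replace (eta / 2) with (eta / (2 * M) * M) by (field; lra).
      apply Rmult_le_compat_r; [lra|apply Rmin_r]. }
    destruct (preimage_near_orbit i e2 He2) as (d2 & Hd2 & K2).
    exists d2. split; auto. intros t p Ht Hp Htp.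
    change (Bn B (S j) t) with (B (Bn B j t)) in Htp.
    assert (HBt : Cmod (Bn B j t) = 1) by (apply Bn_circ; auto using B_circle).
    rewrite wn_S_r, Cmod_mult. specialize (HW t ltac:(lra)).
    pose proof (Cmod_ge_0 (wn B w j t)) as P1. pose proof (Cmod_ge_0 (w (Bn B j t))) as P2.
    assert (Lj' : 0 < lam i ^ S j) by now apply pow_lt.
    destruct (K2 _ p HBt Hp Htp) as [h|(h & p' & Hp' & Hup)].
    + assert (Cmod (wn B w j t) <= M) by (unfold M; pose proof (Rle_abs Wj); lra).
      assert (Cmod (wn B w j t) * Cmod (w (Bn B j t)) <= M * e2) by (apply Rmult_le_compat; lra).
      lra.
    + specialize (K1 t p' Ht Hp' (Rlt_le_trans _ _ _ Hup (Rmin_l _ _))).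
      apply Rle_trans with ((lam i ^ j + e1) * (lam i + e2)); [apply Rmult_le_compat; lra|].
      assert (Q1 : e1 * lam i <= eta / 2).
      { replace (eta / 2) with (e1 * (lam i + 1)) by (unfold e1; field; lra). nra. }
      assert (Q2 : e2 * (lam i ^ j + e1) <= e2 * M).
      { apply Rmult_le_compat_l; [lra|]. unfold M. pose proof (Rabs_pos Wj). lra. }
      simpl pow. lra.
Qed.

Lemma wn_near_orbit_upto i J : exists del, 0 < del /\
  forall j t p, (j <= J)%nat -> Cmod t = 1 -> in_orbit i p -> Cmod (Bn B j t - p) < del ->
    Cmod (wn B w j t) <= 2 * lam i ^ j.
Proof.
  assert (one : forall j, exists del, 0 < del /\ forall t p, Cmod t = 1 -> in_orbit i p ->
     Cmod (Bn B j t - p) < del -> Cmod (wn B w j t) <= 2 * lam i ^ j).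
  { intros j. destruct (wn_near_orbit i j (lam i ^ j)) as (del & Hdel & K); [now apply pow_lt|].
    exists del. split; auto. intros t p Ht Hp Htp. specialize (K t p Ht Hp Htp). lra. }
  induction J as [|J (d1 & Hd1 & K1)].
  - destruct (one 0%nat) as (del & Hdel & K). exists del. split; auto.
    intros j t p Hj. replace j with 0%nat by lia. apply K.
  - destruct (one (S J)) as (d2 & Hd2 & K2). exists (Rmin d1 d2). split; [now apply Rmin_glb_lt|].
    intros j t p Hj Ht Hp Htp. destruct (Nat.eq_dec j (S J)) as [->|n].
    + apply (K2 t p); auto. eapply Rlt_le_trans; [apply Htp|apply Rmin_r].
    + apply (K1 j t p); auto; [lia|]. eapply Rlt_le_trans; [apply Htp|apply Rmin_l].
Qed.

Lemma wn_on_orbit i j t : in_orbit i t -> Cmod (wn B w j t) = lam i ^ j.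
Proof.
  revert t. induction j; intros t Ht; simpl; [apply Cmod_1|].
  rewrite Cmod_mult, IHj by now apply orbit_forward.
  destruct w_good as (_ & _ & W3 & _). now rewrite (W3 i t Ht).
Qed.

Lemma Bn_hseq m n q : Bn B (m * q) (pt (hseq m (n + q))) = pt (hseq m n).
Proof.
  induction q; [now rewrite Nat.mul_0_r, Nat.add_0_r|].
  rewrite Nat.mul_succ_r, Nat.add_succ_r, Bn_add, (Bn_pt m), hseq_S, pt_tau. auto.
Qed.

(** The point is carried to the fixed point by [B^(m n)]. If it were periodic it would be the fixed
    point itself, but it lies strictly between [0] and [tau]. *)
Lemma hseq_not_periodic m n k : (2 <= m)%nat -> (1 <= n)%nat -> (1 <= k)%nat ->
  Bn B k (pt (hseq m n)) <> pt (hseq m n).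
Proof.
  intros Hm Hn Hk E.
  assert (Fx : forall q, Bn B q (pt 0) = pt 0) by (intros q; rewrite Bn_pt, Fn_0; auto).
  assert (P0 : pt tau = pt 0) by (rewrite <- (Rplus_0_l tau); apply pt_tau).
  assert (E1 : forall q, Bn B (k * q) (pt (hseq m n)) = pt (hseq m n)).
  { induction q; [now rewrite Nat.mul_0_r|]. rewrite Nat.mul_succ_r, Bn_add, E. auto. }
  assert (E2 := Bn_hseq m 0 n). simpl hseq in E2 at 2. rewrite Nat.add_0_l, P0 in E2.
  specialize (E1 (m * n)%nat). replace (k * (m * n))%nat with ((k - 1) * (m * n) + m * n)%nat in E1 by nia.
  rewrite Bn_add, E2, Fx in E1.
  assert (Q := hseq_decr m 0 Hm). simpl hseq in Q at 2.
  assert (R1 : hseq m n <= hseq m 1).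
  { clear -Hm Hn d_ge2 F_cont F_incr F_period F_0 F_gt. induction Hn; [lra|].
    pose proof (hseq_decr m m0 Hm). lra. }
  assert (R2 := hseq_pos m n). pose proof tau_pos.
  apply pt_inj in E1; lra.
Qed.

(** Both [v] and [u] are taken from the sequence [hseq m] converging to [xs i]. As [M] is a multiple
    of the period [m], going back [M] steps from [v] along it stays near [xs i]; so [w_M(u)] is
    close to [w_M] at the periodic point, of modulus [lam i ^ M]. *)
Lemma approx_eigen_orbit i (mu : C) : Cmod mu = lam i -> approx_eigen B w mu.
Proof.
  intros Hmu. assert (Li := lam_pos i).
  assert (W1 : disc_alg w) by apply w_good.
  apply approx_eigen_of_orbits; auto using B_circle.
  { intros ->. rewrite Cmod_0 in Hmu. lra. }
  intros M0. set (m := (i + 2)%nat). set (M := (m * S M0)%nat).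
  assert (Hx : in_orbit i (pt (xs i))) by (exists 0%nat; split; [lia|auto]).
  destruct (xs_spec i) as (_ & _ & Hc & _). fold m in Hc.
  destruct (wn_near_orbit_upto i (2 * M)) as (d1 & Hd1 & K1).
  assert (WA := wn_alg B w B_alg B_contr B_circle W1 M).
  assert (LM : 0 < lam i ^ M) by now apply pow_lt.
  destruct (proj2 WA (pt (xs i)) ltac:(rewrite pt_circle; lra) (lam i ^ M / 2) ltac:(lra)) as (d2 & Hd2 & K2).
  destruct (pt_seq_cv _ _ Hc d1 Hd1) as (N1 & HN1). destruct (pt_seq_cv _ _ Hc d2 Hd2) as (N2 & HN2).
  set (n := S (max N1 N2)).
  exists M, (pt (hseq m (n + S M0))), (pt (hseq m n)).
  split; [unfold M, m; nia|split; [apply pt_circle|split; [apply Bn_hseq|split; [|split]]]].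
  - intros k Hk. apply hseq_not_periodic; unfold m, n; lia.
  - intros j t Hj Ht E. rewrite Hmu. apply (K1 j t (pt (xs i))); auto. rewrite E. apply HN1. unfold n; lia.
  - rewrite Hmu. specialize (HN2 (n + S M0)%nat ltac:(unfold n; lia)).
    specialize (K2 (pt (hseq m (n + S M0))) ltac:(unfold closed_disc; rewrite pt_circle; lra) HN2).
    pose proof (Cmod_le_sub (wn B w M (pt (xs i))) (wn B w M (pt (hseq m (n + S M0))))) as Q.
    rewrite (Cmod_sub_sym (wn B w M (pt (xs i)))), (wn_on_orbit i M _ Hx) in Q. lra.
Qed.

(** An approximate eigenvector for a small [lam i] serves for [0], since [lam i * x] is then itself
    small. *)
Lemma approx_eigen_0 : approx_eigen B w 0.
Proof.
  intros eps He. destruct (lam_small (eps / 2) ltac:(lra)) as (i & Hi). specialize (Hi i (le_n _)).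
  assert (Li := lam_pos i).
  assert (E : Cmod (RtoC (lam i)) = lam i) by (rewrite Cmod_R, Rabs_pos_eq; lra).
  destruct (approx_eigen_orbit i (RtoC (lam i)) E (eps / 2) ltac:(lra)) as (x & X1 & X2 & X3 & X4).
  exists x. split; [auto|split; [auto|split]].
  - intros z Hz. specialize (X3 z Hz).
    assert (X5 : Cmod (x z) <= 1) by (rewrite <- X2; now apply le_supnorm_disc_alg).
    replace (wco w B x z - 0 * x z)%C with ((wco w B x z - lam i * x z) + lam i * x z)%C by ring.
    eapply Rle_trans; [apply Cmod_triangle|]. rewrite Cmod_mult, E.
    pose proof (Cmod_ge_0 (x z)). nra.
  - intros z Hz. specialize (X4 z ltac:(lra)). lra.
Qed.

Lemma usf_iff mu : in_sigma_usf (wco w B) mu <->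
  (mu = RtoC 0 \/ exists (i : nat) (t : C), Cmod t = 1 /\ mu = Cmult (RtoC (lam i)) t).
Proof.
  assert (W1 : disc_alg w) by apply w_good. split.
  - intros H. destruct (classic (mu = 0)) as [|Hmu]; [left; auto|right].
    apply NNPP. intros N. apply (not_usf mu Hmu); auto.
    intros i E. assert (Li := lam_pos i).
    assert (L0 : RtoC (lam i) <> 0) by (intros h; apply RtoC_inj in h; lra).
    apply N. exists i, (mu / lam i)%C. split.
    + rewrite Cmod_div, E, Cmod_R, Rabs_pos_eq by (auto; lra). field. lra.
    + field. auto.
  - intros H. apply usf_of_approx_eigen; auto using B_circle.
    destruct H as [->|(i & t & Ht & ->)]; [apply approx_eigen_0|].
    apply (approx_eigen_orbit i). assert (Li := lam_pos i).
    rewrite Cmod_mult, Ht, Cmod_R, Rabs_pos_eq; lra.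
Qed.

End Spectrum.

End Dynamics.

Theorem theorem9 (theta : R) (a : list C) (lam : nat -> R) :
  (2 <= length a)%nat ->
  (forall aj : C, List.In aj a -> Cmod aj < 1) ->
  (elliptic (blaschke theta a) \/ doubly_parabolic (blaschke theta a)) ->
  (forall i, 0 < lam i) ->
  (forall i, lam (S i) < lam i) ->
  is_lim_seq lam 0 ->
  exists w : C -> C, in_disc_algebra w /\
    forall mu : C,
      in_sigma_usf (wco w (blaschke theta a)) mu <->
      (mu = RtoC 0 \/
       exists (i : nat) (t : C), Cmod t = 1 /\ mu = Cmult (RtoC (lam i)) t).
Proof.
  intros Hl Ha _ Lp Ld Ll.
  destruct (blaschke_lift theta a Ha ltac:(lia)) as (F0 & C0 & I0 & P0 & B0).
  assert (Hpi : 0 < 2 * PI) by (pose proof PI_RGT_0; lra).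
  destruct (lift_last_fixed_point F0 (length a) (2 * PI) Hpi Hl C0 I0 P0) as (x0 & Ex & Gx).
  (* The last fixed point of the lift becomes the origin of the coordinate, as [pt] expects. *)
  set (F := fun x => F0 (x + x0) - x0).
  assert (H1 : continuity F).
  { apply continuity_minus; [|apply continuity_const; intros ? ?; auto].
    apply (continuity_comp (fun x => x + x0) F0); auto.
    apply continuity_plus; [apply derivable_continuous, derivable_id|apply continuity_const; intros ? ?; auto]. }
  assert (H2 : forall x y, x < y -> F x < F y).
  { intros x y Hxy. unfold F. apply Rplus_lt_compat_r, I0. lra. }
  assert (H3 : forall x, F (x + tau) = F x + INR (length a) * tau).
  { intros x. unfold F, tau. replace (x + 2 * PI + x0) with (x + x0 + 2 * PI) by ring. rewrite P0. ring. }
  assert (H4 : F 0 = 0) by (unfold F; rewrite Rplus_0_l, Ex; ring).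
  assert (H5 : forall x, 0 < x -> x < F x).
  { intros x Hx. unfold F. specialize (Gx (x + x0) ltac:(lra)). lra. }
  assert (H6 : forall x, blaschke theta a (pt x0 x) = pt x0 (F x)).
  { intros x. unfold pt, F. rewrite B0. f_equal. ring. }
  destruct (good_weight_exists (blaschke theta a) F (length a) x0 Hl H1 H2 H3 H4 H5 H6 lam Lp Ld Ll) as (w & Hw).
  exists w. split; [apply in_disc_algebra_iff, Hw|].
  apply (usf_iff (blaschke theta a) F (length a) x0 Hl H1 H2 H3 H4 H5 H6 lam Lp Ll).
  - now apply blaschke_disc_alg.
  - intros r Hr. apply blaschke_lt_1; auto. lia.
  - exact Hw.
Qed.
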